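(* Let $g\in H^{\frac12-}(\mathbb T)$, $\mathbb T=\mathbb R/(2\pi\mathbb Z)$, and let $u$ be the solution of the KdV equation $u_t+u_{xxx}+uu_x=0$, $t\in\mathbb R$, $x\in\mathbb T$, with $u(0,\cdot)=g$. Then, locally in time, the nonlinear part of the evolution satisfies $$u-e^{-t\partial_{xxx}}g\in C^{\frac13-}_{t,x}.$$
   Context: $H^{\frac12-}(\mathbb T)=\bigcap_{s<1/2}H^s(\mathbb T)$. $e^{-t\partial_{xxx}}g=\sum_n\widehat g(n)e^{itn^3+inx}$ is the solution of the Airy equation $q_t+q_{xxx}=0$ with data $g$; the nonlinear part of the KdV evolution is the difference $u-e^{-t\partial_{xxx}}g$. $C^{\alpha}_{t,x}$ denotes joint Hölder continuity of exponent $\alpha$ in $(t,x)$, and $C^{\frac13-}_{t,x}=\bigcap_{\alpha<1/3}C^\alpha_{t,x}$; ''locally in time'' means that for each $\alpha<\frac13$ the $C^\alpha_{t,x}$ norm is finite on each compact subset of $\mathbb R\times\mathbb T$.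
   Formalization: The data g is additionally assumed to have mean zero on the torus; without this the claim fails: for g = 1/2 + sgn(sin x), at t = 2π the difference u − e^{-t∂xxx}g has jumps in x. *)

(* Defs.v *)
From HB Require Import structures.
From mathcomp Require Import all_boot all_order all_algebra.
From mathcomp Require Import complex.
From mathcomp Require Import all_classical all_reals all_analysis.

Set Implicit Arguments.
Unset Strict Implicit.
Unset Printing Implicit Defensive.

Import Order.TTheory GRing.Theory Num.Theory.
Import numFieldNormedType.Exports.

Local Open Scope classical_set_scope.
Local Open Scope ring_scope.

(* Functions on the torus R/(2 pi Z) are represented by 2 pi-periodic real
   functions on the line, identified when they agree almost everywhere. *)
Definition periodic2pi (R : realType) (f : R -> R) : Prop :=
  forall x, f (x + 2 * pi) = f x.

Definition circle (R : realType) : set R := `[0, 2 * pi].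

Definition in_L2 (R : realType) (f : R -> R) : Prop :=
  [/\ periodic2pi f,
      measurable_fun setT f &
      (\int[lebesgue_measure]_(x in @circle R) ((f x) ^+ 2)%:E < +oo)%E].

(* e^{i theta} *)
Definition cis (R : realType) (theta : R) : R[i] := Complex (cos theta) (sin theta).

(* (2 pi)^-1 \int_0^{2 pi} f(x) e^{-inx} dx, split into real and imaginary
   parts. *)
Definition fourier (R : realType) (f : R -> R) (n : int) : R[i] :=
  Complex
    ((2 * pi)^-1 *
       Rintegral lebesgue_measure (@circle R) (fun x => f x * cos (n%:~R * x)))
    (- ((2 * pi)^-1 *
       Rintegral lebesgue_measure (@circle R) (fun x => f x * sin (n%:~R * x)))).

Definition sqnormc (R : realType) (z : R[i]) : R :=
  complex.Re z ^+ 2 + complex.Im z ^+ 2.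

(* The squared norm of H^s: sum over n in Z of (1 + n^2)^s |f^(n)|^2. *)
Definition sobolev_sqnorm (R : realType) (s : R) (f : R -> R) : \bar R :=
  \esum_(n in [set: int])
     ((1 + (n%:~R : R) ^+ 2) `^ s * sqnormc (fourier f n))%:E.

(* H^s for s >= 0 only: for s < 0 it would contain distributions that are not
   functions. *)
Definition in_Hs (R : realType) (s : R) (f : R -> R) : Prop :=
  in_L2 f /\ (sobolev_sqnorm s f < +oo)%E.

(* H^{a-} for a > 0, the intersection of the H^s with s < a; the spaces are
   nested, so that 0 <= s < a is enough. *)
Definition in_Hminus (R : realType) (a : R) (f : R -> R) : Prop :=
  forall s : R, 0 <= s -> s < a -> in_Hs s f.

(* u belongs to C(R; H^{a-}), i.e. to C(R; H^s) for all s < a. *)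
Definition continuous_Hminus (R : realType) (a : R) (u : R -> R -> R) : Prop :=
  (forall t, in_Hminus a (u t)) /\
  (forall s : R, 0 <= s -> s < a -> forall t0 : R,
     sobolev_sqnorm s (fun x => u t x - u t0 x) @[t --> t0] --> 0%E).

Definition test_function (R : realType) (phi : R -> R) : Prop :=
  periodic2pi phi /\ (forall (k : nat) (x : R), derivable (derive1n k phi) x 1).

(* u_t + u_xxx + u u_x = 0 in the sense of distributions on the torus at every
   time, with u u_x = (u^2 / 2)_x and all x-derivatives moved to the test
   function. *)
Definition kdv_equation (R : realType) (u : R -> R -> R) : Prop :=
  forall phi : R -> R, test_function phi -> forall t : R,
    is_derive t 1
      (fun tau : R =>
         Rintegral lebesgue_measure (@circle R) (fun x => u tau x * phi x))
      (Rintegral lebesgue_measure (@circle R)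
         (fun x => u t x * derive1n 3 phi x + (u t x) ^+ 2 / 2 * derive1n 1 phi x)).

(* For data in H^{a-} with a > 0, the real-valued solution is the element of
   C(R; H^{a-}) solving the equation in the distributional sense; uniqueness
   holds already in C(R; L^2). *)
Definition kdv_solution (R : realType) (a : R) (g : R -> R) (u : R -> R -> R) :
    Prop :=
  [/\ continuous_Hminus a u,
      {ae lebesgue_measure, forall x : R, u 0 x = g x} &
      kdv_equation u].

(* Partial sum over |n| <= N of the series of g^(n) e^{itn^3 + inx}. *)
Definition airy_partial_sum (R : realType) (g : R -> R) (N : nat) (t x : R) :
    R[i] :=
  \sum_(k < (2 * N).+1)
     (let n : int := (k%:Z - N%:Z)%R in
      fourier g n * cis (t * n%:~R ^+ 3 + n%:~R * x)).

(* q(t, .) is e^{-t d_xxx} g, the sum in L^2 of the above series. *)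
Definition airy_evolution (R : realType) (g : R -> R) (q : R -> R -> R) : Prop :=
  forall t : R, in_L2 (q t) /\
    (\int[lebesgue_measure]_(x in @circle R)
        (sqnormc (Complex (q t x) 0 - airy_partial_sum g N t x))%:E)%E
      @[N --> \oo] --> 0%E.

(* Finiteness of the C^alpha norm on K; the distance is the sup distance on
   R * R. *)
Definition holder_on (R : realType) (K : set (R * R)) (alpha : R)
    (f : R * R -> R) : Prop :=
  exists C : R,
    (forall p, K p -> `|f p| <= C) /\
    (forall p p', K p -> K p' -> `|f p - f p'| <= C * `|p - p'| `^ alpha).

(* w is in C^{a-}_{t,x}, locally in time. As w is periodic in x, the condition
   on the compact subsets of R * R is the one on the compact subsets of
   R * (R/2 pi Z): compact sets longer than a period account for the distance
   across the period. *)
Definition holder_minus_loc (R : realType) (a : R) (w : R -> R -> R) : Prop :=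
  (forall t, periodic2pi (w t)) /\
  (forall alpha : R, 0 < alpha -> alpha < a ->
     forall K : set (R * R), compact K -> holder_on K alpha (fun p => w p.1 p.2)).

(* Main.v *)
(** In the variables [v_n(t) = e^{-itn^3} u_n(t)] the equation reads
    [v_n' = -(in/2) sum_{k+l=n} e^{-3inklt} v_k v_l].  As [k, l, n] are nonzero
    for mean zero data, the oscillating factor can be integrated in time, which
    gains [1/(kl)]; in the cubic terms so produced the phase vanishes exactly
    when [n] is one of the three frequencies, and there the sum of the odd
    function [|v_k|^2 / k] cancels, while in all others one integrates once
    more.  With [u] in [H^s] for all [s < 1/2] this bounds
    [sum_n |n|^b |v_n(t) - v_n(0)|] for every [b < 1].  All integrations by parts
    are made on truncated sums and integrated by the mean value theorem applied
    to a finite weighted combination of the [v_n]; the truncation error of the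
    quadratic term is a Parseval remainder, which is uniform in [n].

    The [n]-th coefficient of the nonlinear part is [e^{itn^3}(v_n(t) - v_n(0))].
    Interpolating with [|v_n'| <= C |n|] shows that a derivative of order
    [alpha] in time costs at most [|n|^(3 alpha)], whence the exponent [1/3]. *)
Require Import Defs.
From HB Require Import structures.
From mathcomp Require Import all_boot all_order all_algebra.
From mathcomp Require Import complex.
From mathcomp Require Import all_classical all_reals all_analysis.
From mathcomp Require Import measurable_realfun zify ring lra.

Set Implicit Arguments.
Unset Strict Implicit.
Unset Printing Implicit Defensive.

Import Order.TTheory GRing.Theory Num.Theory.
Import numFieldNormedType.Exports.

Local Open Scope classical_set_scope.
Local Open Scope ring_scope.

(** * Weighted sums over the integers *)

(** The estimates are made in weighted l^1 because an absolutely summable nonlinear part is a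
    Fourier series converging at every (t, x), whose Hölder moduli are bounded term by term. Two
    cut-offs occur: [N] limits the frequencies that are summed, [K] those that enter the
    convolutions. The equation itself is not truncated: [rem] records the exact discrepancy, so that
    the normal form is an identity for every [K]. The errors, of size |n| e and 1/(K - N), are small
    only if [K] is chosen after [N]; all other bounds must therefore be free of both. The obstacle
    is that v_n' has size |n|, and that |v_n'|/|n| is summable only against a small negative power
    of n. In each cubic sum it must sit at a root of the tree of weights, never across an edge J(x +
    y)^-b, which dictates the case distinctions in the trilinear bounds. *)

Definition zr (N : nat) : seq int := [seq (k%:Z - N%:Z)%R | k <- iota 0 (2 * N).+1].

Lemma mem_zr N n : (n \in zr N) = (`|n| <= N)%N.
Proof.
apply/mapP/idP => [[k]|nN]; first by rewrite mem_iota => kN ->; lia.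
by exists `|(n + N%:Z)%R|%N; rewrite ?mem_iota; lia.
Qed.

Lemma zr_uniq N : uniq (zr N).
Proof. by rewrite map_inj_uniq ?iota_uniq// => a b; lia. Qed.

(** The right-hand side is the indexing used in [airy_partial_sum], which thereby becomes a sum over
    [zr N]. *)
Lemma sum_zr (V : nmodType) N (F : int -> V) :
  \sum_(n <- zr N) F n = \sum_(k < (2 * N).+1) F (k%:Z - N%:Z)%R.
Proof. by rewrite /zr big_map -[iota 0 _]/(index_iota 0 (2 * N).+1) big_mkord. Qed.

Section sums.
Context {R : realType}.

Lemma sum_sub_le (J : eqType) (t r : seq J) (F : J -> R) :
  uniq t -> uniq r -> {subset t <= r} -> (forall j, 0 <= F j) ->
  \sum_(j <- t) F j <= \sum_(j <- r) F j.
Proof.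
move=> ut ur tr F0.
have tp : perm_eq t [seq x <- r | x \in t].
  apply: uniq_perm => //; first exact: filter_uniq.
  move=> x; rewrite mem_filter; case: (boolP (x \in t)) => // /tr ->; by [].
rewrite (perm_big _ tp)/= big_filter big_mkcond/=; apply: ler_sum => j _; case: ifP => // _; exact: F0.
Qed.

Lemma sum_inj_le (I J : eqType) (s : seq I) (r : seq J) (P : pred I) (h : I -> J)
    (F : J -> R) :
  uniq s -> uniq r ->
  {in s &, injective h} -> (forall i, i \in s -> P i -> h i \in r) ->
  (forall j, 0 <= F j) ->
  \sum_(i <- s | P i) F (h i) <= \sum_(j <- r) F j.
Proof.
move=> us ur hi hr F0.
rewrite -big_filter -(big_map h xpredT); apply: sum_sub_le => //.
- rewrite map_inj_in_uniq ?filter_uniq// => x y.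
  by rewrite !mem_filter => /andP[_ xs] /andP[_ ys]; exact: hi.
- move=> j; case/mapP => i; rewrite mem_filter => /andP[Pi si] ->; exact: hr.
Qed.

Lemma sum_zr_le N N' (F : int -> R) : (N <= N')%N -> (forall n, 0 <= F n) ->
  \sum_(n <- zr N) F n <= \sum_(n <- zr N') F n.
Proof.
move=> NN F0; apply: sum_sub_le; rewrite ?zr_uniq// => n.
by rewrite !mem_zr => /leq_trans; apply.
Qed.

Lemma sum_zr_shift N x (F : int -> R) : (forall n, 0 <= F n) ->
  \sum_(n <- zr N) F (x + n) <= \sum_(n <- zr (N + `|x|)) F n.
Proof.
move=> F0; rewrite big_mkcond/=.
rewrite -(@big_mkcond _ _ _ _ _ xpredT).
apply: sum_inj_le; rewrite ?zr_uniq//; first by move=> a b _ _ /addrI.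
by move=> n; rewrite !mem_zr; lia.
Qed.

Lemma sum_zr_opp (V : nmodType) N (F : int -> V) :
  \sum_(n <- zr N) F (- n) = \sum_(n <- zr N) F n.
Proof.
rewrite -(big_map -%R xpredT F); apply: perm_big.
apply: uniq_perm; rewrite ?zr_uniq//.
  by rewrite map_inj_uniq ?zr_uniq//; exact: oppr_inj.
move=> n; rewrite mem_zr; apply/mapP/idP => [[m]|nN].
  by rewrite mem_zr => mN ->; lia.
by exists (- n); rewrite ?opprK// mem_zr; lia.
Qed.

(** Stands for (1 + n^2)^(1/2). Being at least 1, its powers are monotone in the exponent also at n
    = 0; being |n| at other integers, it compares exactly with products of phases. *)
Definition J (n : int) : R := Num.max 1 `|n%:~R|.

Lemma J_ge1 n : 1 <= J n. Proof. by rewrite /J le_max lexx. Qed.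
Lemma J_gt0 n : 0 < J n. Proof. exact: lt_le_trans ltr01 (J_ge1 n). Qed.
Lemma J_ge0 n : 0 <= J n. Proof. exact: ltW (J_gt0 n). Qed.
Lemma le_J n : `|n%:~R| <= J n. Proof. by rewrite /J le_max lexx orbT. Qed.

Lemma J_neq0 n : n != 0 -> J n = `|n%:~R|.
Proof.
move=> n0; apply/max_idPr; rewrite -intr_norm -[1]/(1%:~R) ler_int; lia.
Qed.

Lemma JN n : J (- n) = J n.
Proof. by rewrite /J mulrNz normrN. Qed.

Lemma J_le (n : int) (x : R) : 1 <= x -> `|n%:~R| <= x -> J n <= x.
Proof. by move=> x1 nx; rewrite /J ge_max x1. Qed.

Lemma JD m n : J (m + n) <= J m + J n.
Proof.
apply: J_le; first by have := J_ge1 m; have := J_ge1 n; lra.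
rewrite intrD (le_trans (ler_normD _ _))//; apply: lerD; exact: le_J.
Qed.

Lemma addr_le_mul2 (x y : R) : 1 <= x -> 1 <= y -> x + y <= 2 * (x * y).
Proof. nra. Qed.

Lemma addr_le_mul3 (x y z : R) : 1 <= x -> 1 <= y -> 1 <= z ->
  x + y + z <= 3 * (x * y * z).
Proof.
move=> x1 y1 z1.
have : 1 <= x * y by nra.
have : 1 <= x * z by nra.
have : 1 <= y * z by nra.
nra.
Qed.

Lemma powR_le1 (x p : R) : 1 <= x -> p <= 0 -> x `^ p <= 1.
Proof. by move=> x1 p0; rewrite -(powRr0 x); exact: ler_powR. Qed.

Lemma powR_neg_le (x y p : R) : 0 < x -> x <= y -> p <= 0 -> y `^ p <= x `^ p.
Proof.
move=> x0 xy p0.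
have -> : p = - (- p) by rewrite opprK.
have y0 := lt_le_trans x0 xy.
rewrite (powRN y) (powRN x) lef_pV2 ?posrE ?powR_gt0//.
by apply: ge0_ler_powR; rewrite ?nnegrE ?oppr_ge0// ltW.
Qed.

(* telescoping: [(1 - 1/n)^-d >= 1 + d/n] *)
Lemma powR_telescope (d : R) (n : nat) : 0 < d ->
  (n.+2%:R : R) `^ (- (1 + d)) <=
  d^-1 * ((n.+1%:R : R) `^ (- d) - (n.+2%:R : R) `^ (- d)).
Proof.
move=> d0.
have a0 : (0 : R) < n.+2%:R by rewrite ltr0n.
have b0 : (0 : R) < n.+1%:R by rewrite ltr0n.
rewrite ler_pdivlMl//.
have -> : (n.+1%:R : R) = n.+2%:R * (n.+1%:R / n.+2%:R).
  by rewrite mulrCA divff ?mulr1// gt_eqF.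
rewrite powRM ?divr_ge0 ?(ltW a0) ?(ltW b0)// opprD powRD; last by rewrite (gt_eqF a0) implybT.
rewrite (powR_inv1 (ltW a0)).
have p0 : 0 < (n.+2%:R : R) `^ (- d) by rewrite powR_gt0.
rewrite mulrCA mulrC -mulrA -[X in _ <= _ - X]mulr1 -mulrBr.
rewrite mulrCA ler_pM2l//.
rewrite [X in _ <= X - _]/powR gt_eqF ?divr_gt0//.
have h : ln ((n.+1%:R : R) / n.+2%:R) <= - n.+2%:R^-1.
  have -> : (n.+1%:R : R) / n.+2%:R = 1 + (- n.+2%:R^-1).
    by apply: (mulIf (lt0r_neq0 a0)); rewrite mulfVK ?gt_eqF// mulrBl mulVf ?gt_eqF// mul1r -[n.+2]addn1 natrD addrK.
  by apply: le_ln1Dx; rewrite ltrNl opprK invf_lt1// ltr1n.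
have := expR_ge1Dx (- d * ln ((n.+1%:R : R) / n.+2%:R)).
have : - d * ln ((n.+1%:R : R) / n.+2%:R) >= d * n.+2%:R^-1.
  by rewrite mulNr -mulrN ler_pM2l// lerNr.
by move=> h1 h2; apply: (le_trans h1); rewrite lerBrDl.
Qed.

Lemma sum_powR_le (d : R) (N : nat) : 0 < d ->
  \sum_(k < N) (k.+1%:R : R) `^ (- (1 + d)) <= 1 + d^-1.
Proof.
move=> d0.
(* The subtracted remainder (n+1)^-d makes the induction telescope; it is dropped at the end. *)
suff H n : \sum_(k < n.+1) (k.+1%:R : R) `^ (- (1 + d)) <=
    1 + d^-1 * (1 - (n.+1%:R : R) `^ (- d)).
  case: N => [|n]; first by rewrite big_ord0 addr_ge0// invr_ge0 ltW.
  apply: le_trans (H n) _; rewrite lerD2l ger_pMr ?invr_gt0//.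
elim: n => [|n IH].
  by rewrite big_ord_recr big_ord0 /= !powR1 subrr mulr0 add0r addr0.
rewrite big_ord_recr/=; have := powR_telescope n d0; move: IH.
move: (\sum_(i < n.+1) _) (_ `^ (- (1 + d))) => A B; rewrite !mulrBr; lra.
Qed.

Lemma sum_zr_split N (F : int -> R) :
  \sum_(n <- zr N) F n = F 0 + \sum_(k < N) (F k.+1%:Z + F (- k.+1%:Z)).
Proof.
elim: N => [|N IH]; first by rewrite sum_zr muln0 !big_ord_recl !big_ord0 !addr0.
have hp : perm_eq (zr N.+1) [:: N.+1%:Z, - N.+1%:Z & zr N].
  apply: uniq_perm; rewrite ?zr_uniq//.
    have m1 : N.+1%:Z \notin zr N by rewrite mem_zr; lia.
    have m2 : - N.+1%:Z \notin zr N by rewrite mem_zr; lia.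
    move: (zr N) (zr_uniq N) m1 m2 => s us m1 m2.
    by rewrite !cons_uniq in_cons (negbTE m1) m2 us; lia.
  move=> n; rewrite mem_zr; move: (zr N) (mem_zr N n) => s h.
  by rewrite !in_cons h; lia.
rewrite (perm_big _ hp)/= 2!big_cons IH big_ord_recr/=; ring.
Qed.

Lemma J_nat (k : nat) : J k.+1%:Z = k.+1%:R.
Proof. by rewrite J_neq0//= ger0_norm// ler0z. Qed.

Lemma sum_J_le (p : R) N : 1 < p ->
  \sum_(n <- zr N) J n `^ (- p) <= 1 + 2 * (1 + (p - 1)^-1).
Proof.
move=> p1; have d0 : 0 < p - 1 by rewrite subr_gt0.
rewrite sum_zr_split; apply: lerD.
  by rewrite powR_le1 ?J_ge1// oppr_le0; lra.
have := sum_powR_le N d0.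
have -> : 1 + (p - 1) = p by ring.
move=> h; rewrite (eq_bigr (fun k : 'I_N => 2 * (k.+1%:R : R) `^ (- p))).
  by rewrite -mulr_sumr; apply: ler_wpM2l.
by move=> k _; rewrite JN J_nat mulr_natl mulr2n.
Qed.

Lemma sum_J_shift_le (p : R) x N : 1 < p ->
  \sum_(n <- zr N) J (x + n) `^ (- p) <= 1 + 2 * (1 + (p - 1)^-1).
Proof.
move=> p1; apply: le_trans (sum_J_le (N + `|x|) p1).
by apply: (@sum_zr_shift N x (fun n => J n `^ (- p))) => n; exact: powR_ge0.
Qed.

(** Cauchy-Schwarz in the additive form xy <= x^2 + y^2, with x = J^s a and y = J^-(s+k); the
    squares of y are summable because 2s + 2k > 1. *)
Lemma sum_weight_le (s k M : R) (a : int -> R) N :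
  1 < 2 * s + 2 * k ->
  (forall n, 0 <= a n) ->
  \sum_(n <- zr N) J n `^ (2 * s) * a n ^+ 2 <= M ->
  \sum_(n <- zr N) J n `^ (- k) * a n <=
    M + (1 + 2 * (1 + (2 * s + 2 * k - 1)^-1)).
Proof.
move=> sk a0 aM.
have := sum_J_le N sk; set P := (1 + 2 * _) => hP.
apply: le_trans (lerD aM hP).
rewrite -big_split/=; apply: ler_sum => n _.
set x := J n `^ s * a n; set y := J n `^ (- (s + k)).
have J0 : J n != 0 by rewrite gt_eqF// J_gt0.
have -> : J n `^ (- k) * a n = x * y.
  rewrite /x /y mulrAC -powRD ?J0 ?implybT//; congr (_ `^ _ * _); ring.
have -> : J n `^ (2 * s) * a n ^+ 2 = x ^+ 2.
  rewrite /x exprMn; congr (_ * _).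
  by rewrite -[RHS]powR_mulrn ?powR_ge0// -powRrM mulrC.
have -> : J n `^ (- (2 * s + 2 * k)) = y ^+ 2.
  rewrite /y -powR_mulrn ?powR_ge0// -powRrM; congr (_ `^ _); ring.
have : 0 <= (x - y) ^+ 2 by exact: sqr_ge0.
have : 0 <= x * y by rewrite /x /y !mulr_ge0 ?powR_ge0.
nra.
Qed.

(** The same splitting with a translated weight, which costs nothing since [sum_J_shift_le] is
    uniform in [x]. It serves along the edges of the trilinear sums. *)
Lemma sum_edge_le (th M : R) (a : int -> R) x N :
  1 < 2 * th ->
  (forall n, 0 <= a n) ->
  \sum_(n <- zr N) a n ^+ 2 <= M ->
  \sum_(n <- zr N) J (x + n) `^ (- th) * a n <=
    M + (1 + 2 * (1 + (2 * th - 1)^-1)).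
Proof.
move=> hth a0 aM.
have := sum_J_shift_le x N hth; set P := (1 + 2 * _) => hP.
apply: le_trans (lerD aM hP).
rewrite -big_split/=; apply: ler_sum => n _.
set y := J (x + n) `^ (- th).
have -> : J (x + n) `^ (- (2 * th)) = y ^+ 2.
  rewrite /y -powR_mulrn ?powR_ge0// -powRrM; congr (_ `^ _); ring.
have : 0 <= y * a n by rewrite mulr_ge0 ?powR_ge0.
have : 0 <= (a n - y) ^+ 2 by exact: sqr_ge0.
nra.
Qed.

(* The convolution case split: either [J (m+n) ^ 2 >= J m * J n], and the
   weight is shared by the two factors, or the weight of the sum may be
   increased at the expense of the factors. *)
Lemma J_conv_split (s k : R) (m n : int) : 0 <= s -> 0 <= k ->
  J (m + n) `^ (- k) <=
    J m `^ (- (k / 2)) * J n `^ (- (k / 2)) +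
    J m `^ s * J n `^ s * J (m + n) `^ (- (k + 2 * s)).
Proof.
move=> s0 k0.
have m0 := J_gt0 m; have n0 := J_gt0 n; have l0 := J_gt0 (m + n).
have l00 : J (m + n) != 0 by rewrite gt_eqF.
have mn0 : 0 < J m * J n by rewrite mulr_gt0.
rewrite -!powRM ?J_ge0//.
have [h|h] := leP (J m * J n) (J (m + n) `^ 2).
  rewrite -[leLHS]addr0 lerD//; last by rewrite mulr_ge0 ?powR_ge0.
  have -> : - k = 2 * (- (k / 2)) by field.
  rewrite (powRrM _ 2); apply: powR_neg_le => //.
  by rewrite oppr_le0 divr_ge0.
rewrite -[leLHS]add0r lerD//; first by rewrite powR_ge0.
have -> : - k = 2 * s + (- (k + 2 * s)) by ring.
rewrite powRD ?l00 ?implybT// ler_wpM2r ?powR_ge0//.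
rewrite powRrM; apply: ge0_ler_powR; rewrite ?nnegrE ?powR_ge0 ?(ltW mn0)//.
exact: ltW.
Qed.

(** The factors J(x + y)^-th are edges of a tree rooted at x. Leaves are summed first, each by an
    edge bound that is uniform in its parent, and the root last. The next two lemmas treat the path
    x - y - z and the edge x - z with an isolated root y in the same way. *)
Lemma sum3_star_le (K : nat) (g k th A : R) (a b c : int -> R) :
  (forall n, 0 <= a n) -> (forall n, 0 <= b n) -> (forall n, 0 <= c n) -> 0 <= A ->
  \sum_(x <- zr K) J x `^ (- k) * a x <= A ->
  (forall x, \sum_(y <- zr K) J (x + y) `^ (- th) * b y <= A) ->
  (forall x, \sum_(y <- zr K) J (x + y) `^ (- th) * c y <= A) ->
  \sum_(x <- zr K) \sum_(y <- zr K) \sum_(z <- zr K)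
     (J x `^ (- k) * a x) * (J (x + y) `^ (- th) * b y) *
     (J (x + z) `^ (- th) * c z) <= A ^+ 3.
Proof.
move=> a0 b0 c0 A0 ha hb hc.
apply: (@le_trans _ _ (\sum_(x <- zr K) (J x `^ (- k) * a x) * A ^+ 2)).
  apply: ler_sum => x _.
  under eq_bigr do rewrite -mulr_sumr.
  rewrite -mulr_suml -mulr_sumr -mulrA ler_wpM2l ?mulr_ge0 ?powR_ge0//.
  rewrite expr2; apply: ler_pM => //.
  - by apply: sumr_ge0 => y _; rewrite mulr_ge0 ?powR_ge0.
  - by apply: sumr_ge0 => y _; rewrite mulr_ge0 ?powR_ge0.
by rewrite -mulr_suml [leRHS]exprS ler_wpM2r// exprn_ge0.
Qed.

Lemma sum3_path_le (K : nat) (k th A : R) (a b c : int -> R) :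
  (forall n, 0 <= a n) -> (forall n, 0 <= b n) -> (forall n, 0 <= c n) -> 0 <= A ->
  \sum_(x <- zr K) J x `^ (- k) * a x <= A ->
  (forall x, \sum_(y <- zr K) J (x + y) `^ (- th) * b y <= A) ->
  (forall x, \sum_(y <- zr K) J (x + y) `^ (- th) * c y <= A) ->
  \sum_(x <- zr K) \sum_(y <- zr K) \sum_(z <- zr K)
     (J x `^ (- k) * a x) * (J (x + y) `^ (- th) * b y) *
     (J (y + z) `^ (- th) * c z) <= A ^+ 3.
Proof.
move=> a0 b0 c0 A0 ha hb hc.
apply: (@le_trans _ _ (\sum_(x <- zr K) (J x `^ (- k) * a x) * A ^+ 2)).
  apply: ler_sum => x _.
  apply: (@le_trans _ _ (\sum_(y <- zr K) (J x `^ (- k) * a x) *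
       (J (x + y) `^ (- th) * b y) * A)).
    apply: ler_sum => y _; rewrite -mulr_sumr.
    by rewrite ler_wpM2l// !mulr_ge0 ?powR_ge0.
  rewrite -mulr_suml -mulr_sumr -mulrA ler_wpM2l ?mulr_ge0 ?powR_ge0//.
  by rewrite expr2; apply: ler_wpM2r.
by rewrite -mulr_suml [leRHS]exprS ler_wpM2r// exprn_ge0.
Qed.

Lemma sum3_edge_le (K : nat) (k th A : R) (a b c : int -> R) :
  (forall n, 0 <= a n) -> (forall n, 0 <= b n) -> (forall n, 0 <= c n) -> 0 <= A ->
  \sum_(x <- zr K) J x `^ (- k) * a x <= A ->
  \sum_(x <- zr K) J x `^ (- k) * b x <= A ->
  (forall x, \sum_(y <- zr K) J (x + y) `^ (- th) * c y <= A) ->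
  \sum_(x <- zr K) \sum_(y <- zr K) \sum_(z <- zr K)
     (J x `^ (- k) * a x) * (J y `^ (- k) * b y) *
     (J (x + z) `^ (- th) * c z) <= A ^+ 3.
Proof.
move=> a0 b0 c0 A0 ha hb hc.
apply: (@le_trans _ _ (\sum_(x <- zr K) (J x `^ (- k) * a x) * A ^+ 2)).
  apply: ler_sum => x _.
  under eq_bigr do rewrite -mulr_sumr.
  rewrite -mulr_suml -mulr_sumr -mulrA ler_wpM2l ?mulr_ge0 ?powR_ge0//.
  rewrite expr2; apply: ler_pM => //.
  - by apply: sumr_ge0 => y _; rewrite mulr_ge0 ?powR_ge0.
  - by apply: sumr_ge0 => y _; rewrite mulr_ge0 ?powR_ge0.
by rewrite -mulr_suml [leRHS]exprS ler_wpM2r// exprn_ge0.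
Qed.

(** With n = x + y + z one has n^3 - x^3 - y^3 - z^3 = 3 (y + z)(x + z)(x + y), so this is the size
    of the cubic phase. *)
Definition resw (x y z : int) : R := J (y + z) * J (x + z) * J (x + y).

(** Twice a frequency is a signed sum of the three pair sums, so a large frequency forces a large
    phase. *)
Lemma J_le_resw (x y z : int) : J x <= 3 * resw x y z.
Proof.
have a1 := J_ge1 (y + z); have b1 := J_ge1 (x + z); have c1 := J_ge1 (x + y).
apply: le_trans (addr_le_mul3 a1 b1 c1).
apply: J_le; first lra.
have e : (x%:~R : R) *+ 2 = (x + z)%:~R + (x + y)%:~R - (y + z)%:~R.
  rewrite !intrD mulr2n; ring.
have : `|x%:~R *+ 2 : R| <= J (x + z) + J (x + y) + J (y + z).
  rewrite e; apply: le_trans (ler_normB _ _) _; apply: lerD; last exact: le_J.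
  by apply: le_trans (ler_normD _ _) _; apply: lerD; exact: le_J.
rewrite normrMn mulr2n; have := normr_ge0 (x%:~R : R); lra.
Qed.

Lemma reswC (x y z : int) : resw x y z = resw x z y.
Proof. rewrite /resw [z + y]addrC; ring. Qed.
Lemma reswC' (x y z : int) : resw x y z = resw y x z.
Proof. rewrite /resw [y + x]addrC; ring. Qed.

Lemma J_sum_le (x y z : int) : J (x + y + z) <= J (y + z) + J (x + z) + J (x + y).
Proof.
have a1 := J_ge1 (y + z); have b1 := J_ge1 (x + z); have c1 := J_ge1 (x + y).
apply: J_le; first lra.
have e : ((x + y + z)%:~R : R) *+ 2 = (x + z)%:~R + (x + y)%:~R + (y + z)%:~R.
  rewrite !intrD mulr2n; ring.
have : `|(x + y + z)%:~R *+ 2 : R| <= J (x + z) + J (x + y) + J (y + z).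
  rewrite e; apply: le_trans (ler_normD _ _) _; apply: lerD; last exact: le_J.
  by apply: le_trans (ler_normD _ _) _; apply: lerD; exact: le_J.
rewrite normrMn mulr2n; have := normr_ge0 ((x + y + z)%:~R : R); lra.
Qed.

Lemma powRD_le3 (a b c p : R) : 1 <= a -> 1 <= b -> 1 <= c -> 0 <= p -> p <= 1 ->
  (a + b + c) `^ p <= 3 * (a `^ p + b `^ p + c `^ p).
Proof.
move=> a1 b1 c1 p0 p1.
set m := Num.max a (Num.max b c).
have am : a <= m by rewrite /m le_max lexx.
have bm : b <= m by rewrite /m !le_max lexx orbT.
have cm : c <= m by rewrite /m !le_max lexx !orbT.
have h : (a + b + c) `^ p <= (3 * m) `^ p.
  apply: ge0_ler_powR => //; rewrite ?nnegrE; lra.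
apply: le_trans h _; rewrite powRM//; last by lra.
have pa := powR_ge0 a p; have pb := powR_ge0 b p; have pc := powR_ge0 c p.
apply: ler_pM; rewrite ?powR_ge0//; first by apply: ler1_powR => //; lra.
by rewrite /m /Num.max; case: ifP => _; [case: ifP => _|]; lra.
Qed.

Lemma powRN_split (x p : R) : 0 < x -> x^-1 = x `^ (- p) * x `^ (- (1 - p)).
Proof.
move=> x0; rewrite -powRD ?(gt_eqF x0) ?implybT//.
by rewrite -(powR_inv1 (ltW x0)); congr (_ `^ _); ring.
Qed.

Lemma powRN_le3 (x y p : R) : 0 < x -> x <= 3 * y -> 0 <= p -> p <= 1 ->
  y `^ (- p) <= 3 * x `^ (- p).
Proof.
move=> x0 xy p0 p1.
have y0 : 0 < y by lra.
have h : (3 * y) `^ (- p) <= x `^ (- p) by apply: powR_neg_le => //; rewrite oppr_le0.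
have -> : y `^ (- p) = 3 `^ p * (3 * y) `^ (- p).
  rewrite powRM ?(ltW y0)// mulrA -powRD ?subrr ?powRr0 ?mul1r//.
  by rewrite eqxx /=; apply/eqP; lra.
apply: ler_pM; rewrite ?powR_ge0//.
by apply: ler1_powR => //; lra.
Qed.

Lemma resw_gt0 (x y z : int) : 0 < resw x y z.
Proof. by rewrite /resw !mulr_gt0 ?J_gt0. Qed.

(** The inverse phase is split into powers 1 - b and b. The first is bounded through J x by
    [J_le_resw]; in the second, J(x + y + z)^b is at most a sum of b-th powers of pair sums, and
    each cancels one of the three pair factors. Two edges remain, which always form a tree. *)
Lemma resw_weight (b : R) x y z : 0 <= b -> b <= 1 ->
  J (x + y + z) `^ b / resw x y z <=
  9 * (J x `^ (- (1 - b)) * J (x + y) `^ (- b) * J (x + z) `^ (- b) +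
       J x `^ (- (1 - b)) * J (x + y) `^ (- b) * J (y + z) `^ (- b) +
       J x `^ (- (1 - b)) * J (x + z) `^ (- b) * J (y + z) `^ (- b)).
Proof.
move=> b0 b1.
have := J_ge1 (y + z); have := J_ge1 (x + z); have := J_ge1 (x + y).
have h := J_sum_le x y z.
have hw := J_le_resw x y z.
move: h hw (resw_gt0 x y z); rewrite /resw.
move: (J (y + z)) (J (x + z)) (J (x + y)) => A B C h hw w0 C1 B1 A1.
have [A0 B0 C0] : [/\ 0 < A, 0 < B & 0 < C] by split; lra.
have h1 : J (x + y + z) `^ b <= 3 * (A `^ b + B `^ b + C `^ b).
  apply: le_trans (powRD_le3 A1 B1 C1 b0 b1).
  by apply: ge0_ler_powR; rewrite ?nnegrE ?J_ge0//; lra.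
have h2 : (A * B * C) `^ (- (1 - b)) <= 3 * J x `^ (- (1 - b)).
  by apply: powRN_le3; rewrite ?J_gt0//; lra.
have e : (A * B * C)^-1 = (A * B * C) `^ (- (1 - b)) *
    (A `^ (- b) * B `^ (- b) * C `^ (- b)).
  rewrite (powRN_split (1 - b))//; congr (_ * _).
  rewrite !powRM ?mulr_ge0 ?(ltW A0) ?(ltW B0) ?(ltW C0)//.
  by have -> : - (1 - (1 - b)) = - b by ring.
have cc X : 0 < X -> X `^ b * X `^ (- b) = 1.
  move=> X0; rewrite -powRD ?subrr ?powRr0//.
  by rewrite eqxx /=; apply/eqP; lra.
rewrite e.
apply: (@le_trans _ _ ((3 * (A `^ b + B `^ b + C `^ b)) * ((3 * J x `^ (- (1 - b))) *
    (A `^ (- b) * B `^ (- b) * C `^ (- b))))).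
  apply: ler_pM; rewrite ?mulr_ge0 ?powR_ge0//.
  by apply: ler_wpM2r; rewrite ?mulr_ge0 ?powR_ge0.
move: (cc A A0) (cc B B0) (cc C C0).
move: (A `^ b) (B `^ b) (C `^ b) (A `^ (- b)) (B `^ (- b)) (C `^ (- b)) (J x `^ _).
move=> a b' c a' b'' c' j ea eb ec.
rewrite le_eqVlt; apply/orP; left; apply/eqP.
have -> : 9 * (j * c' * b'' + j * c' * a' + j * b'' * a') =
  9 * j * ((a * a') * c' * b'' + (b' * b'') * c' * a' + (c * c') * b'' * a').
  by rewrite ea eb ec; ring.
ring.
Qed.

Lemma ler_sum3 K (F G : int -> int -> int -> R) :
  (forall x y z, F x y z <= G x y z) ->
  \sum_(x <- zr K) \sum_(y <- zr K) \sum_(z <- zr K) F x y z <=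
  \sum_(x <- zr K) \sum_(y <- zr K) \sum_(z <- zr K) G x y z.
Proof. by move=> h; do 3! (apply: ler_sum => ? _). Qed.

Lemma sum3D K (F G : int -> int -> int -> R) :
  \sum_(x <- zr K) \sum_(y <- zr K) \sum_(z <- zr K) (F x y z + G x y z) =
  \sum_(x <- zr K) \sum_(y <- zr K) \sum_(z <- zr K) F x y z +
  \sum_(x <- zr K) \sum_(y <- zr K) \sum_(z <- zr K) G x y z.
Proof.
rewrite -big_split; apply: eq_bigr => x _ /=.
by rewrite -big_split; apply: eq_bigr => y _ /=; rewrite -big_split.
Qed.

Lemma sum3Z K (c : R) (F : int -> int -> int -> R) :
  \sum_(x <- zr K) \sum_(y <- zr K) \sum_(z <- zr K) (c * F x y z) =
  c * \sum_(x <- zr K) \sum_(y <- zr K) \sum_(z <- zr K) F x y z.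
Proof.
rewrite mulr_sumr; apply: eq_bigr => x _ /=.
by rewrite mulr_sumr; apply: eq_bigr => y _ /=; rewrite mulr_sumr.
Qed.

Lemma sum3_swap23 K (F : int -> int -> int -> R) :
  \sum_(x <- zr K) \sum_(y <- zr K) \sum_(z <- zr K) F x y z =
  \sum_(x <- zr K) \sum_(y <- zr K) \sum_(z <- zr K) F x z y.
Proof. by apply: eq_bigr => x _; rewrite exchange_big. Qed.

Lemma sum3_swap12 K (F : int -> int -> int -> R) :
  \sum_(x <- zr K) \sum_(y <- zr K) \sum_(z <- zr K) F x y z =
  \sum_(x <- zr K) \sum_(y <- zr K) \sum_(z <- zr K) F y x z.
Proof. exact: exchange_big. Qed.

(** The three terms of [resw_weight] are a star at x and the paths x - y - z and x - z - y, whence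
    27 = 9 * 3. In all of them [f] sits at the root and requires no edge bound. *)
Lemma sum3_resw_le K (b A : R) (f g h : int -> R) : 0 <= b -> b <= 1 -> 0 <= A ->
  (forall n, 0 <= f n) -> (forall n, 0 <= g n) -> (forall n, 0 <= h n) ->
  \sum_(x <- zr K) J x `^ (- (1 - b)) * f x <= A ->
  (forall x, \sum_(y <- zr K) J (x + y) `^ (- b) * g y <= A) ->
  (forall x, \sum_(y <- zr K) J (x + y) `^ (- b) * h y <= A) ->
  \sum_(x <- zr K) \sum_(y <- zr K) \sum_(z <- zr K)
     J (x + y + z) `^ b / resw x y z * (f x * g y * h z) <= 27 * A ^+ 3.
Proof.
move=> b0 b1 A0 f0 g0 h0 hf hg hh.
have H1 := sum3_star_le (1 - b) f0 g0 h0 A0 hf hg hh.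
have H2 := sum3_path_le f0 g0 h0 A0 hf hg hh.
have H3 := sum3_path_le f0 h0 g0 A0 hf hh hg.
rewrite sum3_swap23 in H3.
have -> : 27 * A ^+ 3 = 9 * (A ^+ 3 + A ^+ 3 + A ^+ 3) by ring.
apply: le_trans (ler_wpM2l _ (lerD (lerD H1 H2) H3)); last by [].
rewrite -!sum3D -sum3Z; apply: ler_sum3 => x y z.
apply: le_trans (ler_wpM2r _ (resw_weight x y z b0 b1)) _.
  by rewrite !mulr_ge0.
rewrite [z + y]addrC le_eqVlt; apply/orP; left; apply/eqP; ring.
Qed.

(** Here [g] is |v'|/J and the factor J y restores the derivative. By J y <= J x + J(x + y), one
    part cancels 1/J x and is [sum3_resw_le] rooted at y (constant 27); the other cancels a pair
    factor and leaves two roots x, y and the edge x - z (constant 6). *)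
Lemma sum3_resw_mid_le K (b A : R) (f g h : int -> R) : 0 <= b -> b <= 1 -> 0 <= A ->
  (forall n, 0 <= f n) -> (forall n, 0 <= g n) -> (forall n, 0 <= h n) ->
  \sum_(x <- zr K) J x `^ (- ((1 - b) / 2)) * f x <= A ->
  \sum_(x <- zr K) J x `^ (- ((1 - b) / 2)) * g x <= A ->
  (forall x, \sum_(y <- zr K) J (x + y) `^ (- b) * f y <= A) ->
  (forall x, \sum_(y <- zr K) J (x + y) `^ (- b) * h y <= A) ->
  \sum_(x <- zr K) \sum_(y <- zr K) \sum_(z <- zr K)
     J (x + y + z) `^ b * J y / (J x * resw x y z) * (f x * g y * h z) <= 33 * A ^+ 3.
Proof.
move=> b0 b1 A0 f0 g0 h0 hf hg hf' hh.
have hg' : \sum_(x <- zr K) J x `^ (- (1 - b)) * g x <= A.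
  apply: le_trans hg; apply: ler_sum => x _; apply: ler_wpM2r => //.
  by apply: ler_powR; [exact: J_ge1|lra].
have H1 := sum3_resw_le b0 b1 A0 g0 f0 h0 hg' hf' hh.
have H2 := sum3_edge_le f0 g0 h0 A0 hf hg hh.
rewrite sum3_swap12 in H1.
have -> : 33 * A ^+ 3 = 27 * A ^+ 3 + 6 * A ^+ 3 by ring.
apply: le_trans (lerD H1 (ler_wpM2l _ H2)); last by [].
rewrite -sum3Z -!sum3D; apply: ler_sum3 => x y z.
rewrite reswC' [y + x]addrC.
have -> : 6 * (J x `^ (- ((1 - b) / 2)) * f x * (J y `^ (- ((1 - b) / 2)) * g y) *
     (J (x + z) `^ (- b) * h z)) =
   6 * (J x `^ (- ((1 - b) / 2)) * J y `^ (- ((1 - b) / 2)) * J (x + z) `^ (- b))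
    * (f x * g y * h z) by ring.
have -> : g y * f x * h z = f x * g y * h z by ring.
rewrite -mulrDl; apply: ler_wpM2r; first by rewrite !mulr_ge0.
rewrite reswC'.
have X1 := J_ge1 x; have A1 := J_ge1 (y + z); have B1 := J_ge1 (x + z).
have C1 := J_ge1 (x + y); have Y1 := J_ge1 y.
have N0 := powR_ge0 (J (x + y + z)) b.
have hy : J y <= J x + J (x + y).
  have -> : y = - x + (x + y) by ring.
  by apply: le_trans (JD _ _) _; rewrite JN addKr.
have hn : J (x + y + z) <= 2 * (J x * J (y + z)).
  by rewrite -addrA; apply: le_trans (JD _ _) (addr_le_mul2 _ _).
have hy3 : J y <= 3 * (J x * J (y + z) * J (x + z)).
  apply: le_trans (addr_le_mul3 X1 A1 B1).
  have e : J y = J ((y + z) + (x + (- (x + z)))) by congr J; ring.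
  rewrite e; apply: le_trans (JD _ _) _; have := JD x (- (x + z)); rewrite JN; lra.
rewrite /resw.
move: hy hn hy3 X1 A1 B1 C1 Y1 N0 => hy hn hy3.
have hN : J (x + y + z) `^ b <= 2 * (J x * J (y + z)) `^ b.
  apply: (@le_trans _ _ ((2 * (J x * J (y + z))) `^ b)).
    by apply: ge0_ler_powR; rewrite ?nnegrE ?mulr_ge0 ?J_ge0.
  rewrite powRM ?mulr_ge0 ?J_ge0// ler_wpM2r ?powR_ge0//.
  by apply: ler1_powR => //; lra.
have hK : (J x * J (y + z) * J (x + z)) `^ (- ((1 - b) / 2)) <=
   3 * J y `^ (- ((1 - b) / 2)).
  by apply: powRN_le3; rewrite ?J_gt0//; lra.
have hX : (J x * J (y + z)) `^ (- ((1 - b) / 2)) <= J x `^ (- ((1 - b) / 2)).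
  apply: powR_neg_le; rewrite ?J_gt0//; last by lra.
  by rewrite ler_peMr ?J_ge0 ?J_ge1.
have hB : J (x + z) `^ (- (1 - (1 - b) / 2)) <= J (x + z) `^ (- b).
  by apply: ler_powR; rewrite ?J_ge1//; lra.
have eB := powRN_split ((1 - b) / 2) (J_gt0 (x + z)).
have eX := powRN_split (1 - b) (mulr_gt0 (J_gt0 x) (J_gt0 (y + z))).
have eX2 : (J x * J (y + z)) `^ (- (1 - b)) =
   (J x * J (y + z)) `^ (- ((1 - b) / 2)) * (J x * J (y + z)) `^ (- ((1 - b) / 2)).
  rewrite -powRD; first by congr (_ `^ _); field.
  by apply/implyP => _; rewrite gt_eqF// mulr_gt0 ?J_gt0.
have eb : (J x * J (y + z)) `^ b * (J x * J (y + z)) `^ (- (1 - (1 - b))) = 1.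
  have -> : - (1 - (1 - b)) = - b by ring.
  rewrite -powRD ?subrr ?powRr0//.
  by apply/implyP => _; rewrite gt_eqF// mulr_gt0 ?J_gt0.
move=> X1 A1 B1 C1 Y1 N0.
(* J(x + y + z)^b <= 2 (J x J(y + z))^b eats the power b of J x J(y + z). Of the remaining power 1 -
   b, one half combines with J(x + z)^-((1-b)/2) into a bound by J y, and the other half goes to J
   x. What is left of J(x + z) has exponent (1 + b)/2 >= b. *)
have key : J (x + y + z) `^ b / (J x * J (y + z) * J (x + z)) <=
  6 * (J x `^ (- ((1 - b) / 2)) * J y `^ (- ((1 - b) / 2)) * J (x + z) `^ (- b)).
  rewrite invfM eX eB eX2.
  rewrite (powRM _ (mulr_ge0 (J_ge0 x) (J_ge0 (y + z))) (J_ge0 (x + z))) in hK.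
  move: hN hK hX hB eb.
  have q1 := powR_ge0 (J x * J (y + z)) b.
  have q2 := powR_ge0 (J x * J (y + z)) (- ((1 - b) / 2)).
  have q3 := powR_ge0 (J x * J (y + z)) (- (1 - (1 - b))).
  have q4 := powR_ge0 (J (x + z)) (- ((1 - b) / 2)).
  have q5 := powR_ge0 (J (x + z)) (- (1 - (1 - b) / 2)).
  have q6 := powR_ge0 (J x) (- ((1 - b) / 2)).
  have q7 := powR_ge0 (J y) (- ((1 - b) / 2)).
  have q8 := powR_ge0 (J (x + z)) (- b).
  move: N0 q1 q2 q3 q4 q5 q6 q7 q8.
  move: (J (x + y + z) `^ b) ((J x * J (y + z)) `^ b)
    ((J x * J (y + z)) `^ (- ((1 - b) / 2)))
    ((J x * J (y + z)) `^ (- (1 - (1 - b)))) (J (x + z) `^ (- ((1 - b) / 2)))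
    (J (x + z) `^ (- (1 - (1 - b) / 2))) (J x `^ (- ((1 - b) / 2)))
    (J y `^ (- ((1 - b) / 2))) (J (x + z) `^ (- b)).
  move=> N xb xg xm zg zm xg' yg zb N0 q1 q2 q3 q4 q5 q6 q7 q8 hN hK hX hB eb.
  apply: (@le_trans _ _ ((2 * xb) * (xg * xg * xm * (zg * zm)))).
    by rewrite ler_wpM2r// !mulr_ge0.
  rewrite (_ : 2 * xb * _ = 2 * (xb * xm) * ((xg * zg) * xg * zm)); last by ring.
  rewrite eb mulr1 (_ : 6 * _ = 2 * ((3 * yg) * xg' * zb)); last by ring.
  apply: ler_wpM2l => //; apply: ler_pM => //; rewrite ?mulr_ge0//.
  by apply: ler_pM; rewrite ?mulr_ge0.
have eq1 : J (x + y + z) `^ b * J y / (J x * (J (y + z) * J (x + z) * J (x + y))) =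
  J (x + y + z) `^ b / (J x * J (y + z) * J (x + z) * J (x + y)) * J y.
  by rewrite !mulrA mulrAC.
rewrite eq1.
have I0 : 0 <= J (x + y + z) `^ b / (J x * J (y + z) * J (x + z) * J (x + y)).
  by rewrite divr_ge0 ?mulr_ge0 ?J_ge0.
apply: le_trans (ler_wpM2l I0 hy) _.
have -> : J (x + y + z) `^ b / (J x * J (y + z) * J (x + z) * J (x + y)) *
   (J x + J (x + y)) =
   J (x + y + z) `^ b / (J (y + z) * J (x + z) * J (x + y)) +
   J (x + y + z) `^ b / (J x * J (y + z) * J (x + z)).
  by field; rewrite !gt_eqF ?J_gt0.
by rewrite lerD2l.
Qed.

End sums.

(** * Complex-valued functions of a real variable *)

Section complex_tools.
Context {R : realType}.
Local Notation normc := (@Normc.normc R).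
Local Notation Re := (@complex.Re R).
Local Notation Im := (@complex.Im R).
Implicit Types (z w : R[i]).

Definition iC : R[i] := Complex 0 1.

Lemma Re_sum I (s : seq I) (P : pred I) (F : I -> R[i]) :
  Re (\sum_(i <- s | P i) F i) = \sum_(i <- s | P i) Re (F i).
Proof. by apply: (big_morph Re) => //; case=> a b [c d]. Qed.

Lemma Re_add z w : Re (z + w) = Re z + Re w. Proof. by case: z w => a b [c d]. Qed.
Lemma Im_add z w : Im (z + w) = Im z + Im w. Proof. by case: z w => a b [c d]. Qed.
Lemma Re_opp z : Re (- z) = - Re z. Proof. by case: z. Qed.
Lemma Im_opp z : Im (- z) = - Im z. Proof. by case: z. Qed.
Lemma Re_mul z w : Re (z * w) = Re z * Re w - Im z * Im w.
Proof. by case: z w => a b [c d]. Qed.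
Lemma Im_mul z w : Im (z * w) = Re z * Im w + Im z * Re w.
Proof. by case: z w => a b [c d]. Qed.

Lemma complex_eq z w : Re z = Re w -> Im z = Im w -> z = w.
Proof. by case: z w => a b [c d] /= -> ->. Qed.

Lemma Re_int (n : int) : Re (n%:~R) = n%:~R.
Proof. by rewrite -(rmorph_int (real_complex R)). Qed.
Lemma Im_int (n : int) : Im (n%:~R) = 0.
Proof. by rewrite -(rmorph_int (real_complex R)). Qed.

Lemma normc_ge0 z : 0 <= normc z.
Proof. by case: z => a b; exact: sqrtr_ge0. Qed.

Lemma normcD z w : normc (z + w) <= normc z + normc w.
Proof. exact: le_normcD. Qed.

Lemma normcB z w : normc (z - w) <= normc z + normc w.
Proof. by rewrite (le_trans (normcD _ _))// normcN. Qed.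

Lemma normc_sum I (s : seq I) (P : pred I) (F : I -> R[i]) :
  normc (\sum_(i <- s | P i) F i) <= \sum_(i <- s | P i) normc (F i).
Proof.
elim/big_ind2 : _ => //; first by rewrite Normc.normc0.
by move=> z a w b za wb; apply: le_trans (normcD _ _) (lerD za wb).
Qed.

Lemma normc_real (x : R) : normc (x%:C)%C = `|x|.
Proof. by rewrite /= expr0n/= addr0 sqrtr_sqr. Qed.

Lemma normc_int (n : int) : normc (n%:~R) = `|n%:~R|.
Proof. by rewrite -(rmorph_int (real_complex R)) normc_real. Qed.

Lemma normc_natV (n : nat) : normc (n%:R^-1) = n%:R^-1.
Proof. by rewrite Normc.normcV -[n%:R]/((n%:Z)%:~R) normc_int normr_nat. Qed.

Lemma normc_i : normc iC = 1.
Proof. by rewrite /= expr0n/= add0r expr1n sqrtr1. Qed.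

Lemma normc_sqr z : normc z ^+ 2 = sqnormc z.
Proof. by case: z => a b; rewrite /= sqr_sqrtr// addr_ge0 ?sqr_ge0. Qed.

Lemma normc_conj z : normc (conjc z) = normc z.
Proof. by case: z => a b; rewrite /= sqrrN. Qed.

Lemma normc_Re z : `|Re z| <= normc z.
Proof.
case: z => a b; rewrite /= -(sqrtr_sqr a) ler_wsqrtr// lerDl sqr_ge0//.
Qed.

Lemma normc_Im z : `|Im z| <= normc z.
Proof.
case: z => a b; rewrite /= -(sqrtr_sqr b) ler_wsqrtr// lerDr sqr_ge0//.
Qed.

(** A constant rotation that makes [z] real and nonnegative, through which norms of complex
    increments are reached by the real mean value theorem. *)
Lemma normc_polar z : exists w, normc w <= 1 /\ Re (w * z) = normc z.
Proof.
have [->|z0] := eqVneq z 0; first by exists 0; rewrite mulr0 Normc.normc0.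
have n0 : normc z != 0 by apply: contra_neq z0; exact: Normc.eq0_normc.
exists (((normc z)^-1)%:C%C * conjc z); split.
  by rewrite Normc.normcM normc_real normc_conj ger0_norm ?invr_ge0 ?normc_ge0// mulVf.
rewrite -mulrA Re_mul /= mul0r subr0.
have -> : Re (conjc z * z) = normc z ^+ 2.
  rewrite normc_sqr /sqnormc; case: (z) => a b /=; ring.
by rewrite expr2 mulrA mulVf// mul1r.
Qed.

Lemma cisD (a b : R) : cis (a + b) = cis a * cis b.
Proof. by rewrite /cis sinD cosD; simpc; rewrite [sin a * _ + _]addrC. Qed.

Lemma cis0 : cis 0 = 1 :> R[i].
Proof. by rewrite /cis cos0 sin0. Qed.

Lemma cisN (a : R) : cis (- a) = conjc (cis a).
Proof. by rewrite /cis cosN sinN. Qed.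

Lemma normc_cis (a : R) : normc (cis a) = 1.
Proof. by rewrite /= cos2Dsin2 sqrtr1. Qed.

Definition cderiv (f : R -> R[i]) (t : R) (l : R[i]) :=
  is_derive t 1 (fun x => Re (f x)) (Re l) /\
  is_derive t 1 (fun x => Im (f x)) (Im l).

Lemma cderiv_cst z t : cderiv (fun=> z) t 0.
Proof. by split; apply: is_derive_cst. Qed.

Lemma cderivD f g t a b : cderiv f t a -> cderiv g t b ->
  cderiv (fun x => f x + g x) t (a + b).
Proof.
move=> [fa fb] [ga gb]; split.
  rewrite Re_add [X in is_derive _ _ X](_ : _ = (fun x => Re (f x)) + (fun x => Re (g x))).
    exact: is_deriveD.
  by apply/funext => x; rewrite Re_add.
rewrite Im_add [X in is_derive _ _ X](_ : _ = (fun x => Im (f x)) + (fun x => Im (g x))).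
  exact: is_deriveD.
by apply/funext => x; rewrite Im_add.
Qed.

Lemma cderivM f g t a b : cderiv f t a -> cderiv g t b ->
  cderiv (fun x => f x * g x) t (a * g t + f t * b).
Proof.
move=> [fa fb] [ga gb]; split.
  have h1 := is_deriveM fa ga; have h2 := is_deriveM fb gb.
  have h3 := is_deriveM fa gb; have h4 := is_deriveM fb ga.
  rewrite [X in is_derive _ _ X](_ : _ = (fun x => Re (f x)) * (fun x => Re (g x)) -
     (fun x => Im (f x)) * (fun x => Im (g x))); last first.
    by apply/funext => x; rewrite Re_mul.
  apply: is_derive_eq (is_deriveB h1 h2) _.
  by rewrite /GRing.scale/= Re_add !Re_mul; ring.
have h3 := is_deriveM fa gb; have h4 := is_deriveM fb ga.
rewrite [X in is_derive _ _ X](_ : _ = (fun x => Re (f x)) * (fun x => Im (g x)) +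
     (fun x => Im (f x)) * (fun x => Re (g x))); last first.
  by apply/funext => x; rewrite Im_mul.
apply: is_derive_eq (is_deriveD h3 h4) _.
by rewrite /GRing.scale/= Im_add !Im_mul; ring.
Qed.

Lemma cderiv_eq f t a b : cderiv f t a -> a = b -> cderiv f t b.
Proof. by move=> h <-. Qed.

Lemma cderivZ z f t a : cderiv f t a -> cderiv (fun x => z * f x) t (z * a).
Proof. by move=> h; apply: cderiv_eq (cderivM (cderiv_cst z t) h) _; rewrite mul0r add0r. Qed.

Lemma cderivN f t a : cderiv f t a -> cderiv (fun x => - f x) t (- a).
Proof.
move=> h; have := cderivZ (-1) h; rewrite mulN1r.
by under [X in cderiv X]funext do rewrite mulN1r.
Qed.

Lemma cderivB f g t a b : cderiv f t a -> cderiv g t b ->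
  cderiv (fun x => f x - g x) t (a - b).
Proof. by move=> fa gb; apply: cderivD => //; exact: cderivN. Qed.

Lemma cderiv_sum (I : Type) (s : seq I) (P : pred I) (F : I -> R -> R[i]) t
    (D : I -> R[i]) :
  (forall i, P i -> cderiv (F i) t (D i)) ->
  cderiv (fun x => \sum_(i <- s | P i) F i x) t (\sum_(i <- s | P i) D i).
Proof.
move=> h; elim: s => [|i s IH].
  rewrite big_nil; under [X in cderiv X]funext do rewrite big_nil.
  exact: cderiv_cst.
rewrite big_cons; under [X in cderiv X]funext do rewrite big_cons.
by case: ifP => // Pi; apply: cderivD => //; exact: h.
Qed.

Lemma cderiv_cis (a t : R) :
  cderiv (fun x => cis (a * x)) t (Complex 0 a * cis (a * t)).
Proof.
split; rewrite ?Re_mul ?Im_mul /= mul0r.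
  apply: is_derive_eq; rewrite /GRing.scale/=; ring.
apply: is_derive_eq; rewrite /GRing.scale/=; ring.
Qed.

End complex_tools.

(** * Normal form reduction *)

(** Together with k in [zr K] it keeps both factors of a convolution in range, a condition symmetric
    under k -> n - k. *)
Definition cut (K : nat) (n k : int) : bool := (`|n - k| <= K)%N.

Lemma sum_cut_sym (V : nmodType) K n (F : int -> V) :
  \sum_(k <- zr K | cut K n k) F (n - k) = \sum_(k <- zr K | cut K n k) F k.
Proof.
rewrite -big_filter -[RHS]big_filter.
rewrite -(big_map (fun k => n - k) xpredT F); apply: perm_big.
apply: uniq_perm.
- by rewrite map_inj_uniq ?filter_uniq ?zr_uniq//; move=> a b; lia.
- by rewrite filter_uniq ?zr_uniq.
move=> m; rewrite mem_filter mem_zr; apply/idP/idP.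
  by case/mapP => k; rewrite mem_filter mem_zr /cut => kn ->; lia.
move=> h; apply/mapP; exists (n - m); last by rewrite subKr.
by rewrite mem_filter mem_zr /cut; move: h; rewrite /cut; lia.
Qed.

Section sums.
Context {R : realType}.

(** For fixed [k] the map n -> n - k is injective into the range, so the constraint between the
    frequencies disappears and the bound is independent of [N]. *)
Lemma sum_conv_le N K (F : int -> int -> R) : (forall k l, 0 <= F k l) ->
  \sum_(n <- zr N) \sum_(k <- zr K | cut K n k) F k (n - k) <=
  \sum_(k <- zr K) \sum_(l <- zr K) F k l.
Proof.
move=> F0; under eq_bigr do rewrite big_mkcond/=.
rewrite exchange_big/=; apply: ler_sum => k _.
rewrite -big_mkcond/=; apply: sum_inj_le; rewrite ?zr_uniq//.
  by move=> a b _ _ /addIr.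
by move=> n _; rewrite mem_zr.
Qed.

Lemma sum_conv3_le N K (F : int -> int -> int -> R) : (forall k l m, 0 <= F k l m) ->
  \sum_(n <- zr N) \sum_(k <- zr K) \sum_(m <- zr K | cut K (n - k) m)
     F k m (n - k - m) <=
  \sum_(k <- zr K) \sum_(m <- zr K) \sum_(j <- zr K) F k m j.
Proof.
move=> F0; rewrite exchange_big/=; apply: ler_sum => k _.
under eq_bigr do rewrite big_mkcond/=.
rewrite exchange_big/=; apply: ler_sum => m _.
rewrite -big_mkcond/=; apply: sum_inj_le; rewrite ?zr_uniq//.
  by move=> a b _ _ /addIr/addIr.
by move=> n _; rewrite mem_zr.
Qed.

Lemma sum_mul2 (a b : int -> R) K :
  \sum_(k <- zr K) \sum_(l <- zr K) a k * b l =
  (\sum_(k <- zr K) a k) * (\sum_(l <- zr K) b l).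
Proof. by rewrite mulr_suml; apply: eq_bigr => k _; rewrite mulr_sumr. Qed.

(** Meant for |v_n'|/|n|, a convolution square by the equation. The first part of [J_conv_split]
    factors into the square of a weighted sum. The second is a Schur test: V_m V_j <= V_m^2 + V_j^2
    against the kernel J(m + j)^-(k + 2s), summable in either variable. *)
Lemma conv_weight_le (s k M A : R) (a : int -> R) N K :
  0 <= s -> 0 <= k -> 1 < k + 2 * s -> 0 <= M ->
  (forall n, 0 <= a n) ->
  \sum_(n <- zr K) J n `^ (2 * s) * a n ^+ 2 <= M ->
  \sum_(n <- zr K) J n `^ (- (k / 2)) * a n <= A ->
  \sum_(n <- zr N) J n `^ (- k) * (\sum_(m <- zr K | cut K n m) a m * a (n - m)) <=
  A ^+ 2 + M * (2 * (1 + 2 * (1 + (k + 2 * s - 1)^-1))).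
Proof.
move=> s0 k0 ks M0 a0 hM hA.
apply: (@le_trans _ _ (\sum_(m <- zr K) \sum_(j <- zr K) J (m + j) `^ (- k) * (a m * a j))).
  apply: (@le_trans _ _ (\sum_(n <- zr N) \sum_(m <- zr K | cut K n m)
     J (m + (n - m)) `^ (- k) * (a m * a (n - m)))).
    apply: ler_sum => n _; rewrite mulr_sumr; apply: ler_sum => m _.
    by rewrite subrKC.
  by apply: (@sum_conv_le N K (fun m j => J (m + j) `^ (- k) * (a m * a j))) => m j;
     rewrite !mulr_ge0 ?powR_ge0.
pose V n := J n `^ s * a n.
pose P := 1 + 2 * (1 + (k + 2 * s - 1)^-1 : R).
have hV : \sum_(n <- zr K) V n ^+ 2 <= M.
  apply: le_trans hM; apply: ler_sum => n _; rewrite /V exprMn.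
  by rewrite -[X in X * _]powR_mulrn ?powR_ge0// -powRrM mulrC [s * _]mulrC mulrC.
apply: (@le_trans _ _ (\sum_(m <- zr K) \sum_(j <- zr K)
   ((J m `^ (- (k / 2)) * a m) * (J j `^ (- (k / 2)) * a j) +
    (V m ^+ 2 * J (m + j) `^ (- (k + 2 * s)) +
     V j ^+ 2 * J (m + j) `^ (- (k + 2 * s)))))).
  apply: ler_sum => m _; apply: ler_sum => j _.
  apply: le_trans (ler_wpM2r _ (J_conv_split m j s0 k0)) _; first by rewrite mulr_ge0.
  rewrite mulrDl; apply: lerD.
    by rewrite le_eqVlt; apply/orP; left; apply/eqP; ring.
  rewrite -mulrDl mulrAC; apply: ler_wpM2r; first exact: powR_ge0.
  have -> : J m `^ s * J j `^ s * (a m * a j) = V m * V j by rewrite /V; ring.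
  have : 0 <= (V m - V j) ^+ 2 by exact: sqr_ge0.
  have : 0 <= V m * V j by rewrite /V !mulr_ge0 ?powR_ge0.
  nra.
under eq_bigr do rewrite big_split/=.
rewrite big_split/=; apply: lerD.
  rewrite sum_mul2 expr2.
  have h0 : 0 <= \sum_(n <- zr K) J n `^ (- (k / 2)) * a n.
    by apply: sumr_ge0 => n _; rewrite mulr_ge0 ?powR_ge0.
  by apply: ler_pM.
have hP m : \sum_(j <- zr K) J (m + j) `^ (- (k + 2 * s)) <= P.
  exact: sum_J_shift_le.
have P0 : 0 <= P by apply: le_trans (hP 0); apply: sumr_ge0 => j _; exact: powR_ge0.
rewrite -/P.
have hVP : \sum_(m <- zr K) V m ^+ 2 * P <= M * P by rewrite -mulr_suml ler_wpM2r.
under eq_bigr do rewrite big_split/=.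
have -> : M * (2 * P) = M * P + M * P by ring.
rewrite big_split/=; apply: lerD; apply: le_trans hVP.
  by apply: ler_sum => m _; rewrite -mulr_sumr ler_wpM2l ?sqr_ge0.
rewrite exchange_big/=; apply: ler_sum => m _.
rewrite -mulr_sumr ler_wpM2l ?sqr_ge0//.
by under eq_bigr do rewrite addrC.
Qed.

End sums.

Section normal_form.
Context {R : realType} (v dv : int -> R -> R[i]).
Local Notation normc := (@Normc.normc R).

Definition ph (k : int) (t : R) : R[i] := cis (k%:~R * t).

Lemma phD k l t : ph (k + l) t = ph k t * ph l t.
Proof. by rewrite /ph intrD mulrDl cisD. Qed.

Lemma ph0 t : ph 0 t = 1. Proof. by rewrite /ph mul0r cis0. Qed.

Lemma normc_ph k t : normc (ph k t) = 1. Proof. exact: normc_cis. Qed.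

Lemma cderiv_ph k t : cderiv (ph k) t (iC * k%:~R * ph k t).
Proof.
apply: cderiv_eq (cderiv_cis _ _) _; congr (_ * _).
apply: complex_eq; rewrite ?Re_mul ?Im_mul Re_int Im_int /=; ring.
Qed.

(* [3 k (n - k) n = n ^ 3 - k ^ 3 - (n - k) ^ 3] is the phase left by the linear flow. *)
Definition qsum K n t : R[i] :=
  \sum_(k <- zr K | cut K n k)
    ph (- (3 * (k * (n - k) * n))) t * (v k t * v (n - k) t).

(** Discrepancy between v_n' and the truncated quadratic term of the equation. No smallness is built
    in; that enters only later, through [hR]. *)
Definition rem K n t : R[i] := dv n t + iC * n%:~R / 2 * qsum K n t.

(* [bnd2] and [bnd3] are the boundary terms of the first and second integration by
   parts; [rest] collects the derivatives falling on [v] in the second one, and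
   [resn] the cubic terms without oscillation. *)
Definition bnd2 K n t : R[i] :=
  \sum_(k <- zr K | cut K n k)
    (6 * (k * (n - k)))%:~R^-1 *
      (ph (- (3 * (k * (n - k) * n))) t * (v k t * v (n - k) t)).

Definition admissible K n k m : bool :=
  [&& cut K n k, n - k != 0 & cut K (n - k) m].

(** As [admissible] makes n - k nonzero, this is exactly the vanishing of [ph3 n k m]. *)
Definition resonant (n k m : int) : bool := (k + m == 0) || (n - m == 0).

(* Phase of the cubic term with frequencies [k], [m] and [n - k - m]. *)
Definition ph3 (n k m : int) : int := - (3 * ((n - k) * (k + m) * (n - m))).

Definition trip n k m t : R[i] :=
  ph (ph3 n k m) t * (v k t * (v m t * v (n - k - m) t)).

Definition bnd3 K n t : R[i] :=
  \sum_(k <- zr K) \sum_(m <- zr K | admissible K n k m && ~~ resonant n k m)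
     (6 * k * ph3 n k m)%:~R^-1 * trip n k m t.

Definition rest K n t : R[i] :=
  \sum_(k <- zr K) \sum_(m <- zr K | admissible K n k m && ~~ resonant n k m)
     (6 * k * ph3 n k m)%:~R^-1 * (ph (ph3 n k m) t *
       (dv k t * (v m t * v (n - k - m) t) +
        v k t * (dv m t * v (n - k - m) t) +
        v k t * (v m t * dv (n - k - m) t))).

Definition resn K n t : R[i] :=
  \sum_(k <- zr K) \sum_(m <- zr K | admissible K n k m && resonant n k m)
     iC * (6 * k)%:~R^-1 * trip n k m t.

(** The contribution of [rem] when the derivative left by the first integration by parts is replaced
    through the equation. *)
Definition rem2 K n t : R[i] :=
  \sum_(k <- zr K | cut K n k)
    (3 * (k * (n - k)))%:~R^-1 *
      (ph (- (3 * (k * (n - k) * n))) t * (v k t * rem K (n - k) t)).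

Context (v0 : forall t, v 0 t = 0).
Context (vd : forall n t, cderiv (v n) t (dv n t)).

Lemma intr_neq0 (k : int) : k != 0 -> (k%:~R : R[i]) != 0.
Proof. by rewrite intr_eq0. Qed.

Lemma cderiv_bnd2 K n t :
  cderiv (bnd2 K n) t (- (iC * n%:~R / 2 * qsum K n t) +
    \sum_(k <- zr K | cut K n k) (3 * (k * (n - k)))%:~R^-1 *
      (ph (- (3 * (k * (n - k) * n))) t * (v k t * dv (n - k) t))).
Proof.
have h k : cderiv (fun t => (6 * (k * (n - k)))%:~R^-1 *
      (ph (- (3 * (k * (n - k) * n))) t * (v k t * v (n - k) t))) t
    (- (iC * n%:~R / 2) * (ph (- (3 * (k * (n - k) * n))) t * (v k t * v (n - k) t)) +
     ((6 * (k * (n - k)))%:~R^-1 * (ph (- (3 * (k * (n - k) * n))) t * (dv k t * v (n - k) t)) +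
      (6 * (k * (n - k)))%:~R^-1 * (ph (- (3 * (k * (n - k) * n))) t * (v k t * dv (n - k) t)))).
  apply: cderiv_eq (cderivZ _ (cderivM (cderiv_ph _ _) (cderivM (vd _ _) (vd _ _)))) _.
  rewrite mulrDr addrC [in RHS]addrC; congr (_ + _); first by ring.
  (* At a zero frequency the coefficient is 0 by the convention 0^-1 = 0 and cannot cancel the
     phase; both sides vanish because v_0 = 0. *)
  have [->|k0] := eqVneq k 0; first by rewrite v0 !(mul0r, mulr0).
  have [->|nk0] := eqVneq (n - k) 0; first by rewrite v0 !(mul0r, mulr0).
  rewrite !(mulrNz, intrM) /=.
  have := intr_neq0 k0; have := intr_neq0 nk0.
  move: ((n - k)%:~R : R[i]) (k%:~R : R[i]) => a b a0 b0.
  by field; rewrite a0 b0.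
apply: cderiv_eq (cderiv_sum _ (fun k _ => h k)) _.
rewrite big_split/= -mulr_sumr mulNr; congr (_ + _).
(* The reflection k -> n - k carries the derivative of the first factor to the second, so 1/6 + 1/6
   = 1/3. *)
rewrite big_split/= -[X in X + _]sum_cut_sym -big_split/=; apply: eq_bigr => k _.
rewrite subKr [(n - k) * k]mulrC [dv (n - k) t * _]mulrC -mulrDl; congr (_ * _).
rewrite !intrM invfM [in RHS]invfM -mulrDl; congr (_ * _).
by field.
Qed.

Lemma cderiv_bnd3 K n t :
  cderiv (bnd3 K n) t
    (\sum_(k <- zr K) \sum_(m <- zr K | admissible K n k m && ~~ resonant n k m)
       iC * (6 * k)%:~R^-1 * trip n k m t + rest K n t).
Proof.
rewrite /rest -big_split/=; apply: cderiv_sum => k _; rewrite -big_split/=.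
apply: cderiv_sum => m /andP[/and3P[_ nk0 _]]; rewrite /resonant negb_or => /andP[km0 nm0].
apply: cderiv_eq (cderivZ _ (cderivM (cderiv_ph _ _)
  (cderivM (vd _ _) (cderivM (vd _ _) (vd _ _))))) _.
rewrite /trip mulrDr; congr (_ + _); last by ring.
have : ((ph3 n k m)%:~R : R[i]) != 0.
  by rewrite intr_eq0 /ph3 oppr_eq0 !mulf_eq0 !negb_or nk0 km0 nm0.
rewrite intrM invfM.
move: ((ph3 n k m)%:~R : R[i]) ((6 * k)%:~R^-1 : R[i]) => a b a0.
by field.
Qed.

(** The factor n - k of the equation for v_(n-k) cancels the one in the denominator, leaving 1/(6k),
    and the two quadratic phases add up to [ph3]. *)
Lemma qsum_subst K n t :
  \sum_(k <- zr K | cut K n k) (3 * (k * (n - k)))%:~R^-1 *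
      (ph (- (3 * (k * (n - k) * n))) t * (v k t * dv (n - k) t)) =
  rem2 K n t - \sum_(k <- zr K) \sum_(m <- zr K | admissible K n k m)
     iC * (6 * k)%:~R^-1 * trip n k m t.
Proof.
have -> : \sum_(k <- zr K) \sum_(m <- zr K | admissible K n k m)
     iC * (6 * k)%:~R^-1 * trip n k m t =
  \sum_(k <- zr K | cut K n k) (3 * (k * (n - k)))%:~R^-1 *
      (ph (- (3 * (k * (n - k) * n))) t * (v k t *
         (iC * (n - k)%:~R / 2 * qsum K (n - k) t))).
  rewrite [RHS]big_mkcond/=; apply: eq_bigr => k _; rewrite /admissible.
  case: (cut K n k); last by rewrite big_pred0.
  have [->|nk0]/= := eqVneq (n - k) 0.
    have -> : (3 * (k * 0))%:~R^-1 = 0 :> R[i] by rewrite mulr0 mulr0 mulr0z invr0.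
    by rewrite big_pred0// mul0r.
  rewrite /qsum !mulr_sumr; apply: eq_bigr => m _.
  rewrite /trip (_ : ph3 n k m = - (3 * (k * (n - k) * n)) + - (3 * (m * (n - k - m) * (n - k)))); last by rewrite /ph3; ring.
  rewrite phD !intrM !invfM.
  have := intr_neq0 nk0; move: ((n - k)%:~R : R[i]) => a a0.
  have e6 : (6%:~R : R[i])^-1 = 3%:~R^-1 / 2 by field.
  by rewrite e6; move: (3%:~R^-1 : R[i]) (k%:~R^-1 : R[i]) => x y; field.
rewrite /rem2 -sumrB; apply: eq_bigr => k _.
by rewrite /rem; ring.
Qed.

Lemma cderiv_normal_form K n t :
  cderiv (fun t => v n t - bnd2 K n t - bnd3 K n t) t
    (rem K n t - rem2 K n t + resn K n t - rest K n t).
Proof.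
apply: cderiv_eq (cderivB (cderivB (vd n t) (cderiv_bnd2 K n t)) (cderiv_bnd3 K n t)) _.
rewrite qsum_subst.
have -> : \sum_(k <- zr K) \sum_(m <- zr K | admissible K n k m)
     iC * (6 * k)%:~R^-1 * trip n k m t =
   resn K n t + \sum_(k <- zr K) \sum_(m <- zr K | admissible K n k m && ~~ resonant n k m)
     iC * (6 * k)%:~R^-1 * trip n k m t.
  by rewrite /resn -big_split/=; apply: eq_bigr => k _; rewrite (bigID (resonant n k)).
by rewrite /rem; ring.
Qed.

Context (vN : forall n t, v (- n) t = conjc (v n t)).

Lemma mul_conjc (z : R[i]) : z * conjc z = ((normc z ^+ 2)%:C)%C.
Proof.
rewrite normc_sqr; apply: complex_eq; rewrite ?Re_mul ?Im_mul /sqnormc.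
  by case: z => a b /=; ring.
by case: z => a b /=; ring.
Qed.

Definition oddsum K n t : R :=
  \sum_(k <- zr K | cut K n k && (n - k != 0)) normc (v k t) ^+ 2 / k%:~R.

Lemma normv_opp n t : normc (v (- n) t) = normc (v n t).
Proof. by rewrite vN normc_conj. Qed.

(* The full sum of the odd function [|v_k|^2 / k] vanishes; only the terms
   excluded by the cut-offs survive. *)
Lemma oddsum_le K n t : n != 0 ->
  `|oddsum K n t| <= normc (v n t) ^+ 2 / J n +
    \sum_(k <- zr K | ~~ cut K n k) normc (v k t) ^+ 2 / J k.
Proof.
move=> n0.
have tot : \sum_(k <- zr K) normc (v k t) ^+ 2 / k%:~R = 0 :> R.
  set X := (X in X = _).
  have : X = - X.
    rewrite {1}/X -sum_zr_opp -sumrN; apply: eq_bigr => k _.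
    by rewrite normv_opp mulrNz invrN mulrN.
  lra.
have -> : oddsum K n t = - \sum_(k <- zr K | ~~ (cut K n k && (n - k != 0)))
    normc (v k t) ^+ 2 / k%:~R.
  move: tot; rewrite (bigID (fun k => cut K n k && (n - k != 0)))/= => /eqP.
  by rewrite addr_eq0 => /eqP.
rewrite normrN; apply: le_trans (ler_norm_sum _ _ _) _.
have h k : `|normc (v k t) ^+ 2 / k%:~R : R| <= normc (v k t) ^+ 2 / J k.
  have [->|k0] := eqVneq k 0; first by rewrite v0 Normc.normc0 expr0n/= !mul0r normr0.
  by rewrite normrM normfV -J_neq0// ger0_norm// exprn_ge0 ?normc_ge0.
apply: (@le_trans _ _ (\sum_(k <- zr K | ~~ (cut K n k && (n - k != 0)))
   (normc (v k t) ^+ 2 / J k))).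
  by apply: ler_sum => k _.
have p0 k : 0 <= normc (v k t) ^+ 2 / J k.
  by rewrite divr_ge0 ?J_ge0// exprn_ge0 ?normc_ge0.
have -> : normc (v n t) ^+ 2 / J n = \sum_(k <- [:: n]) normc (v k t) ^+ 2 / J k.
  by rewrite big_seq1.
apply: (@le_trans _ _ (\sum_(k <- zr K | k == n) normc (v k t) ^+ 2 / J k +
    \sum_(k <- zr K | ~~ cut K n k) normc (v k t) ^+ 2 / J k)).
  rewrite big_mkcond [X in _ <= X + _]big_mkcond [X in _ <= _ + X]big_mkcond/=.
  rewrite -big_split/=; apply: ler_sum => k _.
  rewrite subr_eq0 [k == n]eq_sym; case: (cut K n k) => /=; case: (n == k) => /=;
    by have := p0 k; lra.
rewrite lerD2r; apply: (@sum_inj_le R _ _ (zr K) [:: n] (fun k => k == n) id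
  (fun k => normc (v k t) ^+ 2 / J k)); rewrite ?zr_uniq//.
by move=> k _ /eqP ->; rewrite inE.
Qed.

Lemma real_complex_divz (x : R) (k : int) :
  ((x / k%:~R)%:C)%C = (x%:C)%C / k%:~R :> R[i].
Proof.
by rewrite (rmorphM (real_complex R)) (fmorphV (real_complex R)) rmorph_int.
Qed.

Definition resterm n k t : R[i] :=
  iC / 6 * (((normc (v k t) ^+ 2 / k%:~R)%:C)%C * v n t).

(** For m = -k or m = n the frequencies m and n - k - m are -k and n in some order. The phase is
    then trivial, and v_k meets v_(-k), its conjugate. *)
Lemma trip_resonant n k m t : resonant n k m ->
  iC * (6 * k)%:~R^-1 * trip n k m t = resterm n k t.
Proof.
move=> h; have {h} e : (k + m = 0) \/ (n - m = 0).
  by case/orP: h => /eqP; [left|right].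
have -> : trip n k m t = ((normc (v k t) ^+ 2)%:C)%C * v n t.
  rewrite /trip (_ : ph3 n k m = 0); last by rewrite /ph3; case: e => ->; rewrite !(mulr0, mul0r) oppr0.
  rewrite ph0 mul1r -mul_conjc -vN -mulrA; congr (_ * _).
  case: e => e.
    have -> : m = - k by apply/eqP; rewrite -addr_eq0 addrC e.
    by rewrite opprK subrK.
  have -> : m = n by apply/esym/eqP; rewrite -subr_eq0 e.
  by rewrite addrAC subrr add0r mulrC.
by rewrite /resterm intrM invfM real_complex_divz; ring.
Qed.

Lemma resn_inner K n k t : (`|n| <= K)%N -> (`|k| <= K)%N -> k != - n ->
  \sum_(m <- zr K | cut K (n - k) m && resonant n k m)
     iC * (6 * k)%:~R^-1 * trip n k m t = resterm n k t + resterm n k t.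
Proof.
move=> nK kK kn.
rewrite (eq_bigr (fun=> resterm n k t)); last by move=> m /andP[_ /trip_resonant].
rewrite -big_filter.
have hp : perm_eq [seq m <- zr K | cut K (n - k) m && resonant n k m] [:: - k; n].
  apply: uniq_perm; rewrite ?filter_uniq ?zr_uniq//.
    by rewrite /= inE andbT; lia.
  by move=> m; rewrite mem_filter mem_zr /resonant /cut !inE; lia.
by rewrite (perm_big _ hp)/= !big_cons big_nil addr0.
Qed.

Lemma resn_inner1 K n t : (`|n| <= K)%N ->
  \sum_(m <- zr K | cut K (n - - n) m && resonant n (- n) m)
     iC * (6 * - n)%:~R^-1 * trip n (- n) m t = resterm n (- n) t.
Proof.
move=> nK.
rewrite (eq_bigr (fun=> resterm n (- n) t)); last by move=> m /andP[_ /trip_resonant].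
rewrite -big_filter.
have hp : perm_eq [seq m <- zr K | cut K (n - - n) m && resonant n (- n) m] [:: n].
  apply: uniq_perm; rewrite ?filter_uniq ?zr_uniq//.
  by move=> m; rewrite mem_filter mem_zr /resonant /cut !inE; lia.
by rewrite (perm_big _ hp)/= !big_cons big_nil addr0.
Qed.

(** In general there are two resonant values m = -k and m = n, and 2/6 = 1/3. They coincide when k =
    -n, so the doubled sum counts that term once too often. *)
Lemma resnE K n t : (`|n| <= K)%N ->
  resn K n t = iC / 3 * ((oddsum K n t)%:C%C * v n t) -
    \sum_(k <- zr K | (cut K n k && (n - k != 0)) && (k == - n)) resterm n k t.
Proof.
move=> nK.
have -> : iC / 3 * ((oddsum K n t)%:C%C * v n t) =
    \sum_(k <- zr K | cut K n k && (n - k != 0)) (resterm n k t + resterm n k t).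
  rewrite /oddsum rmorph_sum/= mulr_suml mulr_sumr; apply: eq_bigr => k _.
  by rewrite /resterm; move: ((_)%:C)%C (v n t) => z w; field.
apply/eqP; rewrite eq_sym subr_eq; apply/eqP.
rewrite /resn big_seq_cond [in RHS]big_seq.
rewrite [X in _ = X + _](_ : _ = \sum_(k <- zr K | (k \in zr K) && (cut K n k && (n - k != 0)))
   (resterm n k t + (if k == - n then 0 else resterm n k t))).
  rewrite [X in _ = _ + X]big_seq_cond [X in _ = _ + X]big_mkcondr.
  rewrite [X in _ = _ + X](_ : _ = \sum_(k <- zr K | (k \in zr K) && (cut K n k && (n - k != 0)))
     (if k == - n then resterm n k t else 0)).
    by rewrite -big_split/=; apply: eq_bigr => k _; case: ifP; rewrite ?addr0.
  rewrite -[LHS]big_mkcondr -[RHS]big_mkcondr.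
  by apply: eq_bigl => k; rewrite andbA.
rewrite [RHS]big_mkcondr; apply: eq_bigr => k; rewrite mem_zr => kK.
rewrite /admissible; case: (cut K n k) => /=; last by rewrite big_pred0.
case: (n - k != 0) => /=; last by rewrite big_pred0.
have [->|kn] := eqVneq k (- n); first by rewrite resn_inner1// addr0.
by rewrite resn_inner.
Qed.

Lemma normc_resterm n k t :
  normc (resterm n k t) = 6^-1 * (normc (v k t) ^+ 2 / `|k%:~R| * normc (v n t)).
Proof.
rewrite /resterm !Normc.normcM normc_i mul1r normc_real normrM normfV.
rewrite ger0_norm ?exprn_ge0 ?normc_ge0//; congr (_ * _).
exact: normc_natV.
Qed.

Lemma normc_resn K n t : (`|n| <= K)%N ->
  normc (resn K n t) <= normc (v n t) * (normc (v n t) ^+ 2 / J n +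
    \sum_(k <- zr K | ~~ cut K n k) normc (v k t) ^+ 2 / J k).
Proof.
move=> nK; have [->|n0] := eqVneq n 0.
  rewrite v0 Normc.normc0 mul0r.
  suff -> : resn K 0 t = 0 by rewrite Normc.normc0.
  rewrite /resn big1// => k _; rewrite big1// => m /andP[_ /trip_resonant ->].
  by rewrite /resterm v0 !mulr0.
rewrite resnE//; apply: le_trans (normcB _ _) _.
have p0 k : 0 <= normc (v k t) ^+ 2 / J k.
  by rewrite divr_ge0 ?J_ge0// exprn_ge0 ?normc_ge0.
have nn0 := normc_ge0 (v n t).
have h1 : normc (iC / 3 * ((oddsum K n t)%:C%C * v n t)) =
    3^-1 * (`|oddsum K n t| * normc (v n t)).
  rewrite !Normc.normcM normc_i mul1r normc_real; congr (_ * _).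
  exact: normc_natV.
have h2 : normc (\sum_(k <- zr K | (cut K n k && (n - k != 0)) && (k == - n)) resterm n k t)
    <= 6^-1 * (normc (v n t) ^+ 2 / J n * normc (v n t)).
  apply: le_trans (normc_sum _ _ _) _.
  have -> : 6^-1 * (normc (v n t) ^+ 2 / J n * normc (v n t)) =
      \sum_(k <- [:: - n]) 6^-1 * (normc (v k t) ^+ 2 / J k * normc (v n t)).
    by rewrite big_seq1 normv_opp JN.
  apply: (@le_trans _ _ (\sum_(k <- zr K | (cut K n k && (n - k != 0)) && (k == - n))
      6^-1 * (normc (v k t) ^+ 2 / J k * normc (v n t)))).
    apply: ler_sum => k /andP[_ /eqP ->]; rewrite normc_resterm J_neq0//.
    by rewrite oppr_eq0.
  apply: (@sum_inj_le R _ _ (zr K) [:: - n] (fun k => (cut K n k && (n - k != 0)) && (k == - n)) id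
    (fun k => 6^-1 * (normc (v k t) ^+ 2 / J k * normc (v n t)))); rewrite ?zr_uniq//.
    by move=> k _ /andP[_ /eqP ->]; rewrite inE.
  by move=> k; rewrite mulr_ge0// mulr_ge0.
rewrite h1; have h3 := oddsum_le K t n0.
have h4 : 0 <= \sum_(k <- zr K | ~~ cut K n k) normc (v k t) ^+ 2 / J k.
  by apply: sumr_ge0 => k _.
have := p0 n; move: h2 h3 h4.
move: (normc (\sum_(k <- zr K | (cut K n k && (n - k != 0)) && (k == - n)) resterm n k t))
  (\sum_(k <- zr K | ~~ cut K n k) normc (v k t) ^+ 2 / J k)
  (normc (v n t) ^+ 2 / J n) `|oddsum K n t| => X Y Z W h2 h3 h4 Z0.
have : W * normc (v n t) <= (Z + Y) * normc (v n t) by apply: ler_wpM2r.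
have : 0 <= Z * normc (v n t) by rewrite mulr_ge0.
have : 0 <= Y * normc (v n t) by rewrite mulr_ge0.
lra.
Qed.

(** Off resonance the three factors of [ph3] are nonzero integers, on which J is the absolute value,
    and they are the pair sums of k, m and n - k - m. The term k = 0 has coefficient 0 by
    convention. *)
Lemma normc_coef3 K n k m : admissible K n k m -> ~~ resonant n k m ->
  normc ((6 * k * ph3 n k m)%:~R^-1) <= (J k * resw k m (n - k - m))^-1.
Proof.
move=> /and3P[_ nk0 _]; rewrite /resonant negb_or => /andP[km0 nm0].
have [->|k0] := eqVneq k 0.
  rewrite mulr0 mul0r mulr0z invr0 Normc.normc0 invr_ge0.
  by rewrite mulr_ge0 ?J_ge0// ltW// resw_gt0.
have e1 : J (n - k) = J (m + (n - k - m)) :> R by congr (J _); ring.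
have e2 : J (n - m) = J (k + (n - k - m)) :> R by congr (J _); ring.
rewrite Normc.normcV normc_int lef_pV2 ?posrE; last 2 first.
- by rewrite normr_gt0 intr_eq0 /ph3 mulf_neq0 ?mulf_neq0// oppr_eq0 !mulf_neq0.
- by rewrite mulr_gt0 ?J_gt0 ?resw_gt0.
rewrite /resw -e1 -e2 !J_neq0// /ph3 mulrN mulrNz normrN !intrM !normrM.
have -> : `|6%:~R| = 6 :> R by rewrite ger0_norm.
have -> : `|3%:~R| = 3 :> R by rewrite ger0_norm.
have := normr_ge0 (k%:~R : R); have := normr_ge0 ((n - k)%:~R : R).
have := normr_ge0 ((k + m)%:~R : R); have := normr_ge0 ((n - m)%:~R : R).
move: `|k%:~R| `|(n - k)%:~R| `|(k + m)%:~R| `|(n - m)%:~R| => a b c d d0 c0 b0 a0.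
have -> : 6 * a * (3 * (b * c * d)) = 18 * (a * (b * d * c)) :> R by ring.
by rewrite ler_peMl ?mulr_ge0//; lra.
Qed.

Lemma half_exp_le (b : R) : b <= 1 -> - (1 - b) <= - ((1 - b) / 2).
Proof. by move=> b1; lra. Qed.

Lemma one_exp_le (b : R) : 0 <= b -> - 1 <= - ((1 - b) / 2).
Proof. by move=> b0; lra. Qed.

(** * Bounds at a fixed time, uniform in the cut-offs *)

Section fixed_time.
Context (t b A : R).
Local Notation a := (fun n => normc (v n t)).
Local Notation q := (fun n => normc (dv n t) / J n).
Context (b0 : 0 <= b).
Context (b1 : b <= 1).
Context (A0 : 0 <= A).
Context (L1 : forall K, \sum_(n <- zr K) J n `^ (- ((1 - b) / 2)) * a n <= A).
Context (L2 : forall x K, \sum_(n <- zr K) J (x + n) `^ (- b) * a n <= A).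
Context (Q1 : forall K, \sum_(n <- zr K) J n `^ (- ((1 - b) / 2)) * q n <= A).

Let a0 n : 0 <= normc (v n t). Proof. exact: normc_ge0. Qed.
Let d0 n : 0 <= normc (dv n t). Proof. exact: normc_ge0. Qed.
Let q0 n : 0 <= normc (dv n t) / J n.
Proof. by rewrite divr_ge0 ?normc_ge0 ?J_ge0. Qed.

Lemma weaken_half (f : int -> R) K : (forall n, 0 <= f n) ->
  \sum_(n <- zr K) J n `^ (- ((1 - b) / 2)) * f n <= A ->
  \sum_(n <- zr K) J n `^ (- (1 - b)) * f n <= A.
Proof.
move=> f0; apply: le_trans; apply: ler_sum => n _; apply: ler_wpM2r => //.
by apply: ler_powR; [exact: J_ge1|exact: half_exp_le].
Qed.

Lemma J_powB n : J n `^ b / J n = J n `^ (- (1 - b)).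
Proof.
rewrite -(powR_inv1 (J_ge0 n)) -powRD; first by congr (_ `^ _); ring.
by rewrite (gt_eqF (J_gt0 n)) implybT.
Qed.

(** J n^b <= 2 J k^b J(n - k)^b distributes the weight as the gain 1/(k (n - k)) is distributed, so
    the double sum decouples. *)
Lemma sum_bnd2_le N K :
  \sum_(n <- zr N) J n `^ b * normc (bnd2 K n t) <= 2 * A ^+ 2.
Proof.
apply: (@le_trans _ _ (\sum_(n <- zr N) \sum_(k <- zr K | cut K n k)
   2 * ((J k `^ (- (1 - b)) * a k) * (J (n - k) `^ (- (1 - b)) * a (n - k))))).
  apply: ler_sum => n _; rewrite /bnd2.
  apply: le_trans (ler_wpM2l (powR_ge0 _ _) (normc_sum _ _ _)) _.
  rewrite mulr_sumr; apply: ler_sum => k _.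
  rewrite !Normc.normcM normc_ph mul1r.
  have [->|k0] := eqVneq k 0; first by rewrite v0 Normc.normc0 !(mul0r, mulr0).
  have [->|nk0] := eqVneq (n - k) 0; first by rewrite v0 Normc.normc0 !(mul0r, mulr0).
  have h1 : normc ((6 * (k * (n - k)))%:~R^-1) <= (J k * J (n - k))^-1.
    rewrite Normc.normcV normc_int lef_pV2 ?posrE; last 2 first.
    - by rewrite normr_gt0 intr_eq0 !mulf_neq0.
    - by rewrite mulr_gt0 ?J_gt0.
    rewrite !intrM !normrM -(J_neq0 k0) -(J_neq0 nk0) ler_peMl ?mulr_ge0 ?J_ge0//.
    by rewrite ger0_norm// -[6%:~R]/(6%:R) ler1n.
  have h2 : J n `^ b <= 2 * (J k `^ b * J (n - k) `^ b).
    apply: (@le_trans _ _ ((2 * (J k * J (n - k))) `^ b)).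
      apply: ge0_ler_powR; rewrite ?nnegrE ?mulr_ge0 ?J_ge0//.
      rewrite {1}(_ : n = k + (n - k)); last by ring.
      by apply: le_trans (JD _ _) (addr_le_mul2 _ _); exact: J_ge1.
    rewrite powRM ?mulr_ge0 ?J_ge0// powRM ?J_ge0//.
    apply: ler_wpM2r; first by rewrite mulr_ge0 ?powR_ge0.
    by apply: ler1_powR => //; lra.
  rewrite -!J_powB.
  apply: (@le_trans _ _ (2 * (J k `^ b * J (n - k) `^ b) * ((J k * J (n - k))^-1 *
     (normc (v k t) * normc (v (n - k) t))))).
    apply: ler_pM => //; rewrite ?powR_ge0 ?mulr_ge0 ?normc_ge0//.
    by apply: ler_wpM2r; rewrite ?mulr_ge0.
  rewrite invfM le_eqVlt; apply/orP; left; apply/eqP; ring.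
apply: le_trans (@sum_conv_le R N K (fun k l => 2 * ((J k `^ (- (1 - b)) * a k) *
  (J l `^ (- (1 - b)) * a l))) _) _.
  by move=> k l; rewrite !mulr_ge0 ?powR_ge0.
under eq_bigr do rewrite -mulr_sumr.
rewrite -mulr_sumr ler_wpM2l// sum_mul2 expr2.
have h : 0 <= \sum_(n <- zr K) J n `^ (- (1 - b)) * a n.
  by apply: sumr_ge0 => n _; rewrite mulr_ge0 ?powR_ge0.
by apply: ler_pM => //; exact: weaken_half.
Qed.

(** Common reduction for [bnd3] and [rest]: the sum over n, k, m becomes a free sum over the three
    frequencies x = k, y = m, z = n - k - m. *)
Lemma sum_trip_le N K (F : int -> int -> int -> R)
    (G : int -> int -> int -> R[i]) C :
  (forall x y z, 0 <= F x y z) ->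
  (forall n k m, normc (G n k m) <= F k m (n - k - m)) ->
  \sum_(x <- zr K) \sum_(y <- zr K) \sum_(z <- zr K)
     J (x + y + z) `^ b * ((J x * resw x y z)^-1 * F x y z) <= C ->
  \sum_(n <- zr N) J n `^ b *
    normc (\sum_(k <- zr K) \sum_(m <- zr K | admissible K n k m && ~~ resonant n k m)
     (6 * k * ph3 n k m)%:~R^-1 * G n k m) <= C.
Proof.
move=> F0 GF; apply: le_trans.
pose H x y z : R := J (x + y + z) `^ b * ((J x * resw x y z)^-1 * F x y z).
have H0 x y z : 0 <= H x y z.
  by rewrite /H !mulr_ge0 ?powR_ge0 ?invr_ge0 ?mulr_ge0 ?J_ge0 ?(ltW (resw_gt0 _ _ _)).
apply: (@le_trans _ _ (\sum_(n <- zr N) \sum_(k <- zr K)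
   \sum_(m <- zr K | cut K (n - k) m) H k m (n - k - m))); last exact: sum_conv3_le.
apply: ler_sum => n _.
apply: le_trans (ler_wpM2l (powR_ge0 _ _) (normc_sum _ _ _)) _.
rewrite mulr_sumr; apply: ler_sum => k _.
apply: le_trans (ler_wpM2l (powR_ge0 _ _) (normc_sum _ _ _)) _.
rewrite mulr_sumr big_mkcond [leRHS]big_mkcond/=; apply: ler_sum => m _.
case: ifP => [/andP[h1 h2]|_]; last by case: ifP.
have [_ _ ->] := and3P h1.
rewrite /H (_ : k + m + (n - k - m) = n); last by ring.
apply: ler_wpM2l; first exact: powR_ge0.
rewrite Normc.normcM; apply: ler_pM; rewrite ?normc_ge0//.
exact: normc_coef3 h1 h2.
Qed.

Lemma sum_bnd3_le N K :
  \sum_(n <- zr N) J n `^ b * normc (bnd3 K n t) <= 27 * A ^+ 3.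
Proof.
apply: (@sum_trip_le N K (fun x y z => a x * a y * a z)).
- by move=> x y z; rewrite !mulr_ge0.
- by move=> n k m; rewrite /trip !Normc.normcM normc_ph mul1r mulrA.
have h := sum3_resw_le b0 b1 A0 a0 a0 a0 (weaken_half a0 (L1 K)) (fun x => L2 x K) (fun x => L2 x K).
apply: le_trans h; apply: ler_sum3 => x y z.
rewrite [leLHS]mulrA; apply: ler_wpM2r; first by rewrite !mulr_ge0.
apply: ler_wpM2l; first exact: powR_ge0.
have w0 : 0 < resw x y z :> R := resw_gt0 x y z.
by rewrite lef_pV2 ?posrE ?mulr_gt0 ?J_gt0// ler_peMl ?J_ge1// (ltW w0).
Qed.

(** One term for each position of the derivative. On [k] it is absorbed by the 1/J k of the
    coefficient (27); on either other factor it is not, and [sum3_resw_mid_le] applies (33 each). *)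
Lemma sum_rest_le N K :
  \sum_(n <- zr N) J n `^ b * normc (rest K n t) <= 93 * A ^+ 3.
Proof.
pose d n := normc (dv n t).
apply: (@sum_trip_le N K (fun x y z => d x * a y * a z + a x * d y * a z + a x * a y * d z)).
- by move=> x y z; rewrite /d !addr_ge0 ?mulr_ge0//.
- move=> n k m; rewrite Normc.normcM normc_ph mul1r.
  apply: le_trans (normcD _ _) _; apply: lerD.
    by apply: le_trans (normcD _ _) _; rewrite !Normc.normcM !mulrA.
  by rewrite !Normc.normcM !mulrA.
have h1 := sum3_resw_le b0 b1 A0 q0 a0 a0 (weaken_half q0 (Q1 K)) (fun x => L2 x K) (fun x => L2 x K).
have h2 := sum3_resw_mid_le b0 b1 A0 a0 q0 a0 (L1 K) (Q1 K) (fun x => L2 x K) (fun x => L2 x K).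
have h3 := h2; rewrite sum3_swap23 in h3.
have -> : 93 * A ^+ 3 = 27 * A ^+ 3 + 33 * A ^+ 3 + 33 * A ^+ 3 by ring.
apply: le_trans (lerD (lerD h1 h2) h3).
rewrite -!sum3D; apply: ler_sum3 => x y z.
rewrite (reswC x z y) (_ : x + z + y = x + y + z); last by ring.
have x0 : J x != 0 :> R by rewrite gt_eqF ?J_gt0.
have y0 : J y != 0 :> R by rewrite gt_eqF ?J_gt0.
have z0 : J z != 0 :> R by rewrite gt_eqF ?J_gt0.
have w0 : resw x y z != 0 :> R by rewrite gt_eqF ?resw_gt0.
rewrite le_eqVlt; apply/orP; left; apply/eqP; rewrite /d.
move: x0 y0 z0 w0; move: (J x) (J y) (J z) (resw x y z) (J (x + y + z) `^ b).
move=> X Y Z W B X0 Y0 Z0 W0.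
by field; rewrite X0 Y0 Z0 W0.
Qed.

(** The factor |n - k| in the bound on [rem] is cancelled by the denominator, and the remaining 1/J
    k is summable against |v_k|. *)
Lemma normc_rem2_le K n e : 0 <= e -> (forall l, normc (rem K l t) <= `|l%:~R| * e) ->
  normc (rem2 K n t) <= A * e.
Proof.
move=> e0 he; rewrite /rem2.
apply: le_trans (normc_sum _ _ _) _.
apply: (@le_trans _ _ (\sum_(k <- zr K) J k `^ (- ((1 - b) / 2)) * a k * e)); last first.
  by rewrite -mulr_suml ler_wpM2r.
rewrite big_mkcond/=; apply: ler_sum => k _; case: ifP => _; last first.
  by rewrite !mulr_ge0 ?powR_ge0.
rewrite !Normc.normcM normc_ph mul1r.
have [->|k0] := eqVneq k 0; first by rewrite v0 Normc.normc0 !(mul0r, mulr0).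
have [->|nk0] := eqVneq (n - k) 0.
  by rewrite mulr0 mulr0 mulr0z invr0 Normc.normc0 mul0r !mulr_ge0 ?powR_ge0.
apply: (@le_trans _ _ ((J k * J (n - k))^-1 * (normc (v k t) * (J (n - k) * e)))).
  apply: ler_pM; rewrite ?mulr_ge0 ?normc_ge0//; last first.
    by apply: ler_wpM2l => //; rewrite J_neq0.
  rewrite Normc.normcV normc_int lef_pV2 ?posrE; last 2 first.
  - by rewrite normr_gt0 intr_eq0 !mulf_neq0.
  - by rewrite mulr_gt0 ?J_gt0.
  rewrite !intrM !normrM -(J_neq0 k0) -(J_neq0 nk0) ler_peMl ?mulr_ge0 ?J_ge0//.
  by rewrite ger0_norm// -[3%:~R]/(3%:R) ler1n.
have -> : (J k * J (n - k))^-1 * (normc (v k t) * (J (n - k) * e)) = (J k)^-1 * a k * e.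
  by field; rewrite !gt_eqF ?J_gt0.
do 2 (apply: ler_wpM2r => //).
by rewrite -(powR_inv1 (J_ge0 k)); apply: ler_powR; [exact: J_ge1|exact: one_exp_le].
Qed.

(** The surviving resonant term has weight J n^b / J n and falls under [L1]. In the cut-off sum, |n|
    <= N and |n - k| > K force |k| > K - N, whence the second term. *)
Lemma sum_resn_le N K M : (N < K)%N -> 0 <= M -> (forall K, \sum_(n <- zr K) a n ^+ 2 <= M) ->
  \sum_(n <- zr N) J n `^ b * normc (resn K n t) <=
  M * A + (\sum_(n <- zr N) J n `^ b) * ((M + 1) * (M / (K - N)%:R)).
Proof.
move=> NK M0 hM.
have hm n : a n ^+ 2 <= M.
  apply: le_trans (hM `|n|%N).
  have -> : a n ^+ 2 = \sum_(k <- [:: n]) a k ^+ 2 by rewrite big_seq1.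
  apply: sum_sub_le; rewrite ?zr_uniq//.
    by move=> k; rewrite inE => /eqP ->; rewrite mem_zr.
  by move=> k; rewrite exprn_ge0.
have ha n : a n <= M + 1.
  have := hm n; have := a0 n; move: (a n) => x x0 xM.
  have := sqr_ge0 (x - 1); nra.
have p0 : 0 < (K - N)%:R :> R by rewrite ltr0n subn_gt0.
apply: (@le_trans _ _ (\sum_(n <- zr N) (M * (J n `^ (- (1 - b)) * a n) +
     J n `^ b * ((M + 1) * (M / (K - N)%:R))))); last first.
  rewrite big_split/= -mulr_sumr -mulr_suml lerD2r ler_wpM2l//.
  exact: weaken_half.
rewrite big_seq [leRHS]big_seq; apply: ler_sum => n; rewrite mem_zr => nN.
have nK : (`|n| <= K)%N by lia.
apply: le_trans (ler_wpM2l (powR_ge0 _ _) (normc_resn t nK)) _.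
rewrite -J_powB !mulrDr; apply: lerD.
  rewrite (_ : M * _ = J n `^ b * (normc (v n t) * (M / J n))); last by ring.
  do 2 (apply: ler_wpM2l; rewrite ?powR_ge0//).
  by rewrite ler_wpM2r ?invr_ge0 ?J_ge0.
apply: ler_wpM2l; first exact: powR_ge0.
apply: ler_pM => //.
  by apply: sumr_ge0 => k _; rewrite divr_ge0 ?exprn_ge0 ?J_ge0.
apply: (@le_trans _ _ (\sum_(k <- zr K) a k ^+ 2 * ((K - N)%:R^-1))); last first.
  by rewrite -mulr_suml; apply: ler_wpM2r => //; rewrite invr_ge0 (ltW p0).
rewrite big_mkcond/=; apply: ler_sum => k _; case: ifP => hc; last first.
  by rewrite mulr_ge0 ?exprn_ge0 ?invr_ge0 ?(ltW p0).
rewrite ler_wpM2l ?exprn_ge0// lef_pV2 ?posrE ?J_gt0//.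
apply: le_trans (le_J _); rewrite -intr_norm -[(K - N)%:R]/((K - N)%:Z%:~R) ler_int.
by move: hc; rewrite /cut; lia.
Qed.

End fixed_time.

(** * Integration in time and the smoothing bound *)

Lemma mvt_bound (f df : R -> R) (t D : R) :
  (forall x : R, is_derive x 1 f (df x)) ->
  (forall x : R, `|x| <= `|t| -> `|df x| <= D) -> f t - f 0 <= D * `|t|.
Proof.
move=> fd hD.
have fc a b : {within `[a, b], continuous f}.
  apply: continuous_subspaceT => x; apply: differentiable_continuous.
  by apply/derivable1_diffP; have := fd x => -[].
have [t0|t0|->] := ltgtP t 0; last by rewrite subrr normr0 mulr0.
- have [c] := MVT t0 (fun x _ => fd x) (fc t 0).
  rewrite in_itv/= => /andP[tc c0] e.
  have -> : f t - f 0 = - df c * - t by rewrite -opprB e; ring.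
  rewrite (ltr0_norm t0) ler_wpM2r ?oppr_ge0 ?(ltW t0)//.
  rewrite (le_trans _ (hD c _)) ?ler_norm//; first by rewrite -normrN ler_norm.
  by rewrite !ltr0_norm// lerN2 ltW.
have [c] := MVT t0 (fun x _ => fd x) (fc 0 t).
rewrite in_itv/= => /andP[c0 ct] ->.
rewrite subr0 (gtr0_norm t0) ler_wpM2r ?(ltW t0)//.
rewrite (le_trans _ (hD c _)) ?ler_norm//.
by rewrite !gtr0_norm// ltW.
Qed.

(** The mean value theorem applied to each coefficient would give different intermediate times, at
    which the sum is not controlled. With the rotations frozen at time [t], the sum of norms is the
    increment of one real function. *)
Lemma sum_increment_le N (w : int -> R) (G dG : int -> R -> R[i]) t D :
  (forall n, 0 <= w n) ->
  (forall n x, cderiv (G n) x (dG n x)) ->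
  (forall x, `|x| <= `|t| -> \sum_(n <- zr N) w n * normc (dG n x) <= D) ->
  \sum_(n <- zr N) w n * normc (G n t - G n 0) <= D * `|t|.
Proof.
move=> w0 hd hD.
have /choice[sg hsg] n : exists z, normc z <= 1 /\
    complex.Re (z * (G n t - G n 0)) = normc (G n t - G n 0) := normc_polar _.
pose F x := complex.Re (\sum_(n <- zr N) ((w n)%:C)%C * (sg n * G n x)).
have e : \sum_(n <- zr N) w n * normc (G n t - G n 0) = F t - F 0.
  rewrite /F !Re_sum -sumrB; apply: eq_bigr => n _.
  rewrite -(hsg n).2 mulrBr !(Re_mul (_%:C)%C) Re_add Re_opp /=; ring.
rewrite e; apply: (@mvt_bound F (fun x => complex.Re (\sum_(n <- zr N) ((w n)%:C)%C * (sg n * dG n x)))).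
  move=> x; have [] // := @cderiv_sum R _ (zr N) xpredT (fun n x => ((w n)%:C)%C * (sg n * G n x)) x
    (fun n => ((w n)%:C)%C * (sg n * dG n x)) _.
  by move=> n _; apply: cderivZ; apply: cderivZ.
move=> x /hD; apply: le_trans.
apply: le_trans (normc_Re _) _; apply: le_trans (normc_sum _ _ _) _.
apply: ler_sum => n _; rewrite !Normc.normcM normc_real ger0_norm//.
apply: ler_wpM2l => //; apply: ler_piMl; first exact: normc_ge0.
by have [] := hsg n.
Qed.

Context (T : R).
Context (T0 : 0 <= T).
Context (hM : forall s, 0 <= s -> s < 1 / 2 -> exists M, forall N t, `|t| <= T ->
  \sum_(n <- zr N) J n `^ (2 * s) * normc (v n t) ^+ 2 <= M).
Context (hR : forall e, 0 < e -> exists K0, forall K n t, (K0 <= K)%N -> `|t| <= T ->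
  normc (rem K n t) <= `|n%:~R| * e).

Lemma exists_cutoff (N K0 : nat) (X : R) : 0 <= X ->
  exists K, [/\ (N < K)%N, (K0 <= K)%N & X <= (K - N)%:R].
Proof.
move=> X0; exists (K0 + N.+1 + Num.bound X)%N; have := archi_boundP X0.
move: (Num.bound X) => B hB; split; [lia|lia|].
by apply: le_trans (ltW hB) _; rewrite ler_nat; lia.
Qed.

Lemma weight_ge (s : R) (f : int -> R) N : 0 <= s -> (forall n, 0 <= f n) ->
  \sum_(n <- zr N) f n <= \sum_(n <- zr N) J n `^ s * f n.
Proof.
move=> s0 f0; apply: ler_sum => n _; rewrite ler_peMl//.
by rewrite -(powRr0 (J n)); apply: ler_powR; rewrite ?J_ge1.
Qed.

Lemma uniform_bounds (b : R) : 3 / 4 <= b -> b < 1 -> exists M A, [/\ 0 <= M, 0 <= A &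
  forall t, `|t| <= T ->
  [/\ forall K, \sum_(n <- zr K) J n `^ (- ((1 - b) / 2)) * normc (v n t) <= A,
      forall x K, \sum_(n <- zr K) J (x + n) `^ (- b) * normc (v n t) <= A,
      forall K, \sum_(n <- zr K) J n `^ (- ((1 - b) / 2)) * (normc (dv n t) / J n) <= A &
      forall K, \sum_(n <- zr K) normc (v n t) ^+ 2 <= M]].
Proof.
(* The loss in s gives 2s + k = 1 + (1-b)/4 > 1, which covers a convolution, where each factor
   receives only the weight k/2. *)
move=> b34 b1; pose s := 1 / 2 - (1 - b) / 8; pose k := (1 - b) / 2.
have [s0 s12] : 0 <= s /\ s < 1 / 2 by rewrite /s; split; lra.
have [M h] := hM s0 s12.
have a0 t n : 0 <= normc (v n t) := normc_ge0 _.
have M0 : 0 <= M.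
  apply: le_trans (h 0%N 0 _); last by rewrite normr0.
  by apply: sumr_ge0 => n _; rewrite mulr_ge0 ?powR_ge0 ?exprn_ge0.
have k1 : 1 < 2 * s + 2 * k by rewrite /s /k; lra.
have k2 : 1 < 2 * s + 2 * (k / 2) by rewrite /s /k; lra.
have k3 : 1 < k + 2 * s by rewrite /s /k; lra.
have k0 : 0 <= k by rewrite /k; lra.
have b2 : 1 < 2 * b by lra.
pose A1 := M + (1 + 2 * (1 + (2 * s + 2 * k - 1)^-1)).
pose A2 := M + (1 + 2 * (1 + (2 * b - 1)^-1)).
pose A3 := M + (1 + 2 * (1 + (2 * s + 2 * (k / 2) - 1)^-1)).
pose A4 := A3 ^+ 2 + M * (2 * (1 + 2 * (1 + (k + 2 * s - 1)^-1))) + 1.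
have hM2 t K : `|t| <= T -> \sum_(n <- zr K) normc (v n t) ^+ 2 <= M.
  move=> tT; apply: le_trans (h K t tT); apply: weight_ge; first lra.
  by move=> n; rewrite exprn_ge0.
exists M, (Num.max 0 (Num.max A1 (Num.max A2 A4))); split => //.
  by rewrite le_max lexx.
move=> t tT; split => //.
- move=> K; rewrite !le_max; apply/orP; right; apply/orP; left.
  exact: sum_weight_le (h K t tT).
- move=> x K; rewrite !le_max; do 2 (apply/orP; right); apply/orP; left.
  by apply: (@sum_edge_le _ b M (fun n => normc (v n t))) => //; exact: hM2.
- move=> N; rewrite !le_max; do 3 (apply/orP; right).
  pose W := \sum_(n <- zr N) J n `^ (- k) : R.
  have W0 : 0 <= W by apply: sumr_ge0 => n _; exact: powR_ge0.
  (* [K] may depend on [N] here: it only makes the truncation error contribute at most 1, and [A4]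
     involves neither. *)
  have e0 : 0 < (1 + W)^-1 by rewrite invr_gt0; lra.
  have [K hK] := hR e0.
  apply: (@le_trans _ _ (\sum_(n <- zr N) (J n `^ (- k) *
     (\sum_(m <- zr K | cut K n m) normc (v m t) * normc (v (n - m) t)) +
     J n `^ (- k) * (1 + W)^-1))).
    apply: ler_sum => n _; rewrite -mulrDr; apply: ler_wpM2l; first exact: powR_ge0.
    rewrite ler_pdivrMr ?J_gt0//.
    have -> : dv n t = rem K n t - iC * n%:~R / 2 * qsum K n t by rewrite /rem; ring.
    apply: le_trans (normcB _ _) _; rewrite mulrDl addrC; apply: lerD.
      rewrite mulrC !Normc.normcM normc_i mul1r normc_int normc_natV.
      have hq : normc (qsum K n t) <=
         \sum_(m <- zr K | cut K n m) normc (v m t) * normc (v (n - m) t).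
        apply: le_trans (normc_sum _ _ _) _; apply: ler_sum => m _.
        by rewrite !Normc.normcM normc_ph mul1r.
      have q0 := normc_ge0 (qsum K n t).
      apply: ler_pM => //.
      have := le_J n : `|n%:~R| <= J n :> R; have := normr_ge0 (n%:~R : R); lra.
    rewrite mulrC; apply: le_trans (hK K n t (leqnn _) tT) _.
    by apply: ler_wpM2r; [exact: ltW|exact: le_J].
  rewrite big_split/= /A4; apply: lerD.
    apply: (@conv_weight_le _ s k M A3 (fun n => normc (v n t))) => //.
      exact: h.
    exact: sum_weight_le (h K t tT).
  by rewrite -mulr_suml -/W ler_pdivrMr; lra.
- by move=> K; exact: hM2.
Qed.

Lemma smoothing_aux (b : R) : 3 / 4 <= b -> b < 1 -> exists C, forall N t, `|t| <= T ->
  \sum_(n <- zr N) J n `^ b * normc (v n t - v n 0) <= C.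
Proof.
move=> b34 b1; have [M [A [M0 A0 hA]]] := uniform_bounds b34 b1.
have b0 : 0 <= b by lra.
have b1' : b <= 1 by lra.
(* One unit for [rem] and [rem2], one for the cut-off part of the resonant terms, [M * A] for their
   surviving part, the last term for [rest]. The witness below adds the boundary terms at both end
   points. *)
pose D := 2 + M * A + 93 * A ^+ 3.
exists (D * T + 2 * (2 * A ^+ 2 + 27 * A ^+ 3)) => N t tT.
pose W := \sum_(n <- zr N) J n `^ b : R.
pose W' := \sum_(n <- zr N) J n `^ b * `|n%:~R| : R.
have W0 : 0 <= W by apply: sumr_ge0 => n _; exact: powR_ge0.
have W'0 : 0 <= W' by apply: sumr_ge0 => n _; rewrite mulr_ge0 ?powR_ge0.
have S0 : 0 < 1 + W' + W * A by have := mulr_ge0 W0 A0; lra.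
have e0 : 0 < (1 + W' + W * A)^-1 by rewrite invr_gt0.
have [K0 hK0] := hR e0; set e := (1 + W' + W * A)^-1 in e0 hK0.
pose X := W * ((M + 1) * M).
have X0 : 0 <= X by rewrite /X !mulr_ge0//; lra.
have [K [NK K0K XK]] := exists_cutoff N K0 X0.
have KN0 : 0 < (K - N)%:R :> R by rewrite ltr0n subn_gt0.
have {}XK : X / (K - N)%:R <= 1 by rewrite ler_pdivrMr// mul1r.
pose G n t := v n t - bnd2 K n t - bnd3 K n t.
pose dG n t := rem K n t - rem2 K n t + resn K n t - rest K n t.
have hG : \sum_(n <- zr N) J n `^ b * normc (G n t - G n 0) <= D * `|t|.
  apply: (@sum_increment_le N (fun n => J n `^ b) G dG).
  - by move=> n; exact: powR_ge0.
  - by move=> n x; exact: cderiv_normal_form.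
  move=> x xt; have xT := le_trans xt tT.
  have [L1 L2 Q1 MM] := hA x xT.
  have h1 := sum_resn_le b0 b1' A0 L1 NK M0 MM.
  have h2 := sum_rest_le b0 b1' A0 L1 L2 Q1 N K.
  apply: (@le_trans _ _ (\sum_(n <- zr N) (J n `^ b * `|n%:~R| * e + J n `^ b * (A * e) +
    J n `^ b * normc (resn K n x) + J n `^ b * normc (rest K n x)))).
    apply: ler_sum => n _; rewrite -[_ * _ * e]mulrA -!mulrDr.
    apply: ler_wpM2l; first exact: powR_ge0.
    apply: le_trans (normcB _ _) _; rewrite lerD2r.
    apply: le_trans (normcD _ _) _; rewrite lerD2r.
    apply: le_trans (normcB _ _) _; apply: lerD; first exact: hK0.
    apply: (normc_rem2_le b0 L1); first exact: ltW.
    by move=> l; exact: hK0.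
  rewrite !big_split/= -!mulr_suml -/W -/W'.
  have he : W' * e + W * (A * e) <= 1.
    by rewrite mulrA -mulrDl /e ler_pdivrMr// mul1r; lra.
  have hX : W * ((M + 1) * (M / (K - N)%:R)) <= 1.
    by apply: le_trans XK; rewrite /X le_eqVlt; apply/orP; left; apply/eqP; ring.
  by move: h1 h2 he hX; rewrite -/W /D; lra.
have [L1 L2 _ _] := hA t tT.
have T00 : `|0 : R| <= T by rewrite normr0.
have [L1' L2' _ _] := hA 0 T00.
have g1 := sum_bnd2_le b0 b1' L1 N K; have g2 := sum_bnd2_le b0 b1' L1' N K.
have g3 := sum_bnd3_le b0 b1' A0 L1 L2 N K.
have g4 := sum_bnd3_le b0 b1' A0 L1' L2' N K.
have D0 : 0 <= D.
  rewrite /D; have := mulr_ge0 M0 A0; have := exprn_ge0 3 A0; lra.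
have hG' : \sum_(n <- zr N) J n `^ b * normc (G n t - G n 0) <= D * T.
  by apply: le_trans hG _; rewrite ler_wpM2l.
apply: (@le_trans _ _ (\sum_(n <- zr N) (J n `^ b * normc (G n t - G n 0) +
   J n `^ b * normc (bnd2 K n t) + J n `^ b * normc (bnd2 K n 0) +
   J n `^ b * normc (bnd3 K n t) + J n `^ b * normc (bnd3 K n 0)))).
  apply: ler_sum => n _; rewrite -!mulrDr; apply: ler_wpM2l; first exact: powR_ge0.
  have -> : v n t - v n 0 = (G n t - G n 0) + bnd2 K n t - bnd2 K n 0 + bnd3 K n t - bnd3 K n 0.
    by rewrite /G; ring.
  apply: le_trans (normcB _ _) _; rewrite lerD2r.
  apply: le_trans (normcD _ _) _; rewrite lerD2r.
  apply: le_trans (normcB _ _) _; rewrite lerD2r.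
  exact: normcD.
rewrite !big_split/=; move: hG' g1 g2 g3 g4; lra.
Qed.

(** The bound b >= 3/4 keeps 2b > 1, as the edge sums require; smaller exponents follow from J >=
    1. *)
Lemma smoothing (b : R) : b < 1 -> exists C, forall N t, `|t| <= T ->
  \sum_(n <- zr N) J n `^ b * normc (v n t - v n 0) <= C.
Proof.
move=> b1; pose b' := Num.max b (3 / 4).
have h1 : 3 / 4 <= b' by rewrite le_max lexx orbT.
have h2 : b' < 1 by rewrite gt_max b1; lra.
have h3 : b <= b' by rewrite le_max lexx.
have [C hC] := smoothing_aux h1 h2; exists C => N t tT.
apply: le_trans (hC N t tT); apply: ler_sum => n _.
by apply: ler_wpM2r; [exact: normc_ge0|apply: ler_powR; rewrite ?J_ge1].
Qed.

End normal_form.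

(** * Fourier series on the circle *)

Section circle_integral.
Context {R : realType}.
Local Notation mu := (@lebesgue_measure R).
Local Notation I := (@circle R).
Local Notation normc := (@Normc.normc R).
Implicit Types (f g : R -> R).

Definition ig f := mu.-integrable I (EFin \o f).
Definition ir f : R := Rintegral mu I f.

Lemma two_pi_gt0 : 0 < 2 * pi :> R.
Proof. by rewrite mulr_gt0 ?pi_gt0. Qed.

Lemma measurable_circle : @measurable _ (measurableTypeR R) I.
Proof. exact: measurable_itv. Qed.
Local Notation mI := measurable_circle.

Lemma mu_circle : mu I = (2 * pi)%:E.
Proof. by rewrite /circle lebesgue_measure_itv/= lte_fin two_pi_gt0 oppr0 adde0. Qed.

Lemma mu_circle_fin : (mu I < +oo)%E.
Proof. by rewrite mu_circle ltry. Qed.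

Lemma ig_measurable f : ig f -> measurable_fun I f.
Proof. by move=> /integrableP[/measurable_EFinP]. Qed.

Lemma igD f g : ig f -> ig g -> ig (fun x => f x + g x).
Proof. by move=> hf hg; have := integrableD mI hf hg. Qed.

Lemma igZ c f : ig f -> ig (fun x => c * f x).
Proof. by move=> hf; have := integrableZl mI c hf. Qed.

Lemma igN f : ig f -> ig (fun x => - f x).
Proof. by move=> hf; have := integrableN hf. Qed.

Lemma igB f g : ig f -> ig g -> ig (fun x => f x - g x).
Proof. by move=> hf hg; apply: igD => //; exact: igN. Qed.

Lemma ig0 : ig (fun=> 0).
Proof. exact: integrable0. Qed.

Lemma ig_norm f : ig f -> ig (fun x => `|f x|).
Proof. by move=> hf; have := integrable_norm hf. Qed.

Lemma ig_le f g : measurable_fun I f -> (forall x, I x -> `|f x| <= g x) ->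
  ig g -> ig f.
Proof.
move=> mf fg hg; apply: (le_integrable mI _ _ hg); first exact/measurable_EFinP.
by move=> x Ix; rewrite /= lee_fin (le_trans (fg x Ix))// ler_norm.
Qed.

Lemma ig_bounded f M : measurable_fun I f -> (forall x, I x -> `|f x| <= M) -> ig f.
Proof.
move=> mf fM; apply: measurable_bounded_integrable => //; first exact: mI.
  exact: mu_circle_fin.
exists M; split; first exact: num_real.
by move=> x Mx y Iy; rewrite /= (le_trans (fM y Iy))// ltW.
Qed.

Lemma ig_cst c : ig (fun=> c).
Proof. by apply: (@ig_bounded _ `|c|) => // x _. Qed.

Lemma irD f g : ig f -> ig g -> ir (fun x => f x + g x) = ir f + ir g.
Proof. by move=> hf hg; rewrite /ir RintegralD//; exact: mI. Qed.

Lemma irZ c f : ig f -> ir (fun x => c * f x) = c * ir f.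
Proof. by move=> hf; rewrite /ir RintegralZl//; exact: mI. Qed.

Lemma irN f : ig f -> ir (fun x => - f x) = - ir f.
Proof.
move=> hf; rewrite -mulN1r -irZ//; congr ir; apply/funext => x; by rewrite mulN1r.
Qed.

Lemma irB f g : ig f -> ig g -> ir (fun x => f x - g x) = ir f - ir g.
Proof. by move=> hf hg; rewrite irD ?irN//; exact: igN. Qed.

Lemma ir0 : ir (fun=> 0) = 0.
Proof. by rewrite /ir /Rintegral integral0. Qed.

Lemma ir_cst c : ir (fun=> c) = c * (2 * pi).
Proof. by rewrite /ir (Rintegral_cst _ mI)/= mu_circle. Qed.

Lemma ir_le f g : ig f -> ig g -> (forall x, I x -> f x <= g x) -> ir f <= ir g.
Proof. by move=> hf hg fg; apply: le_Rintegral => //; exact: mI. Qed.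

Lemma ir_ge0 f : (forall x, I x -> 0 <= f x) -> 0 <= ir f.
Proof. by move=> h; apply: Rintegral_ge0. Qed.

Lemma ir_norm f : ig f -> `|ir f| <= ir (fun x => `|f x|).
Proof. by move=> hf; apply: le_normr_Rintegral => //; exact: mI. Qed.

Lemma eq_ir f g : (forall x, I x -> f x = g x) -> ir f = ir g.
Proof. by move=> fg; apply: eq_Rintegral => x /set_mem; exact: fg. Qed.

(** Square integrability over one period without periodicity, which products with cut-off or
    approximating functions would not preserve. *)
Definition sqi f := measurable_fun I f /\ ig (fun x => f x ^+ 2).

Lemma sqi_mul f g : sqi f -> sqi g -> ig (fun x => f x * g x).
Proof.
move=> [mf hf] [mg hg].
apply: (@ig_le _ (fun x => f x ^+ 2 + g x ^+ 2)); last exact: igD.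
  exact: measurable_funM.
move=> x _; rewrite normrM -(normr_id (f x)) -[f x ^+ 2]real_normK ?num_real//.
rewrite -[g x ^+ 2]real_normK ?num_real//.
have := normr_ge0 (f x); have := normr_ge0 (g x).
rewrite normr_id; move: `|f x| `|g x| => a b b0 a0.
have := sqr_ge0 (a - b); nra.
Qed.

Lemma sqiD f g : sqi f -> sqi g -> sqi (fun x => f x + g x).
Proof.
move=> hf hg; split; first by apply: measurable_funD; [exact: hf.1|exact: hg.1].
have -> : (fun x => (f x + g x) ^+ 2) =
   (fun x => f x ^+ 2 + 2 * (f x * g x) + g x ^+ 2) by apply/funext => x; ring.
apply: igD; last exact: hg.2.
by apply: igD; [exact: hf.2|apply: igZ; exact: sqi_mul].
Qed.

Lemma sqiZ c f : sqi f -> sqi (fun x => c * f x).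
Proof.
move=> hf; split; first by apply: measurable_funM => //; exact: hf.1.
have -> : (fun x => (c * f x) ^+ 2) = (fun x => c ^+ 2 * f x ^+ 2).
  by apply/funext => x; ring.
by apply: igZ; exact: hf.2.
Qed.

Lemma sqiB f g : sqi f -> sqi g -> sqi (fun x => f x - g x).
Proof.
move=> hf hg; have -> : (fun x => f x - g x) = (fun x => f x + (-1) * g x).
  by apply/funext => x; ring.
by apply: sqiD => //; exact: sqiZ.
Qed.

Lemma sqi_bounded f M : measurable_fun I f -> (forall x, I x -> `|f x| <= M) -> sqi f.
Proof.
move=> mf fM; split => //; apply: (@ig_bounded _ (M ^+ 2)).
  exact: measurable_funX.
move=> x Ix; rewrite normrX lerXn2r ?nnegrE ?fM//.
by apply: le_trans (fM x Ix).
Qed.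

Lemma sqi_ig f : sqi f -> ig f.
Proof.
move=> hf; have := sqi_mul hf (@sqi_bounded (fun=> 1) 1 (measurable_cst _) _).
have -> : (fun x => f x * 1) = f by apply/funext => x; rewrite mulr1.
by apply => x _; rewrite normr1.
Qed.

Lemma in_L2_sqi f : in_L2 f -> sqi f.
Proof.
move=> [_ mf fi]; have mf' : measurable_fun I f by exact: measurable_funTS.
split => //; apply/integrableP; split.
  by apply/measurable_EFinP; apply: measurable_funX.
apply: le_lt_trans fi; rewrite le_eqVlt; apply/orP; left; apply/eqP.
by apply: eq_integral => x _; rewrite /= ger0_norm ?sqr_ge0.
Qed.

Lemma ir_sqD_le f g : sqi f -> sqi g ->
  ir (fun x => (f x + g x) ^+ 2) <= 2 * ir (fun x => f x ^+ 2) + 2 * ir (fun x => g x ^+ 2).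
Proof.
move=> hf hg; rewrite -!irZ ?(hf.2) ?(hg.2)// -irD; last 2 first.
- by apply: igZ; exact: hf.2.
- by apply: igZ; exact: hg.2.
apply: ir_le.
- exact: (sqiD hf hg).2.
- by apply: igD; apply: igZ; [exact: hf.2|exact: hg.2].
by move=> x _; have := sqr_ge0 (f x - g x); nra.
Qed.

Lemma continuous_measurable_circle f : continuous f -> measurable_fun I f.
Proof. by move=> cf; apply: measurable_funTS; exact: continuous_measurable_fun. Qed.

Implicit Types (F G : R -> R[i]).
Local Notation Re := (@complex.Re R).
Local Notation Im := (@complex.Im R).

Definition cig F := ig (fun x => Re (F x)) /\ ig (fun x => Im (F x)).
Definition cint F : R[i] := Complex (ir (fun x => Re (F x))) (ir (fun x => Im (F x))).

Lemma cigD F G : cig F -> cig G -> cig (fun x => F x + G x).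
Proof.
move=> [f1 f2] [g1 g2]; split.
  by under [X in ig X]funext do rewrite Re_add; exact: igD.
by under [X in ig X]funext do rewrite Im_add; exact: igD.
Qed.

Lemma cintD F G : cig F -> cig G -> cint (fun x => F x + G x) = cint F + cint G.
Proof.
move=> [f1 f2] [g1 g2]; apply: complex_eq; rewrite ?Re_add ?Im_add /=.
  by under [X in ir X]funext do rewrite Re_add; exact: irD.
by under [X in ir X]funext do rewrite Im_add; exact: irD.
Qed.

Lemma cigZ (c : R[i]) F : cig F -> cig (fun x => c * F x).
Proof.
move=> [f1 f2]; split.
  by under [X in ig X]funext do rewrite Re_mul; apply: igB; exact: igZ.
by under [X in ig X]funext do rewrite Im_mul; apply: igD; exact: igZ.
Qed.

Lemma cintZ (c : R[i]) F : cig F -> cint (fun x => c * F x) = c * cint F.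
Proof.
move=> [f1 f2]; apply: complex_eq; rewrite ?Re_mul ?Im_mul /=.
  by under [X in ir X]funext do rewrite Re_mul; rewrite irB ?irZ//; exact: igZ.
by under [X in ir X]funext do rewrite Im_mul; rewrite irD ?irZ//; exact: igZ.
Qed.

Lemma cig0 : cig (fun=> 0). Proof. by split; exact: ig0. Qed.
Lemma cint0 : cint (fun=> 0) = 0. Proof. by apply: complex_eq; rewrite /= ir0. Qed.

Lemma cig_sum J (s : seq J) (P : pred J) (F : J -> R -> R[i]) :
  (forall i, P i -> cig (F i)) -> cig (fun x => \sum_(i <- s | P i) F i x).
Proof.
move=> h; elim: s => [|i s IH].
  by under [X in cig X]funext do rewrite big_nil; exact: cig0.
under [X in cig X]funext do rewrite big_cons.
case Pi : (P i) => //; apply: cigD => //; exact: h.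
Qed.

Lemma cint_sum J (s : seq J) (P : pred J) (F : J -> R -> R[i]) :
  (forall i, P i -> cig (F i)) ->
  cint (fun x => \sum_(i <- s | P i) F i x) = \sum_(i <- s | P i) cint (F i).
Proof.
move=> h; elim: s => [|i s IH].
  by rewrite big_nil; under [X in cint X]funext do rewrite big_nil; exact: cint0.
rewrite big_cons; under [X in cint X]funext do rewrite big_cons.
case Pi : (P i) => //; rewrite cintD ?IH//; [exact: h|exact: cig_sum].
Qed.

Lemma normc_cint F : cig F -> normc (cint F) <= 2 * ir (fun x => `|Re (F x)| + `|Im (F x)|).
Proof.
move=> [f1 f2]; rewrite irD; try exact: ig_norm.
have h1 := ir_norm f1; have h2 := ir_norm f2.
have -> : cint F = ((ir (fun x => Re (F x)))%:C)%C + iC * ((ir (fun x => Im (F x)))%:C)%C.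
  by apply: complex_eq; rewrite ?Re_add ?Im_add ?Re_mul ?Im_mul /=; ring.
apply: le_trans (normcD _ _) _; rewrite Normc.normcM normc_i mul1r !normc_real.
have := normr_ge0 (ir (fun x => Re (F x))); have := normr_ge0 (ir (fun x => Im (F x))).
lra.
Qed.

Lemma cis_int_2pi (n : int) : cis (n%:~R * (2 * pi)) = 1 :> R[i].
Proof.
have e : cis (2 * pi) = 1 :> R[i].
  by rewrite /cis mulr_natl cos2pi sin2pi.
have h (k : nat) : cis (k%:R * (2 * pi)) = 1 :> R[i].
  elim: k => [|k IH]; first by rewrite mul0r cis0.
  by rewrite -addn1 natrD mulrDl cisD IH mul1r mul1r e.
case: n => k; first exact: h.
by rewrite NegzE mulrNz mulNr cisN -[(k.+1)%:~R]/(k.+1%:R) h conjc1.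
Qed.

Lemma deriv_continuous (H h : R -> R) : (forall x : R, is_derive x 1 H (h x)) -> continuous H.
Proof.
move=> dF x; apply: differentiable_continuous; apply/derivable1_diffP.
by have := dF x => -[].
Qed.

Lemma continuous_cos_int (n : int) : continuous (fun x : R => cos (n%:~R * x)).
Proof.
apply: (@deriv_continuous _ (fun x => - n%:~R * sin (n%:~R * x))) => x.
by apply: is_derive_eq; rewrite /GRing.scale/=; ring.
Qed.

Lemma continuous_sin_int (n : int) : continuous (fun x : R => sin (n%:~R * x)).
Proof.
apply: (@deriv_continuous _ (fun x => n%:~R * cos (n%:~R * x))) => x.
by apply: is_derive_eq; rewrite /GRing.scale/=; ring.
Qed.

Lemma measurable_cos_int (n : int) : measurable_fun I (fun x : R => cos (n%:~R * x)).
Proof.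
apply: continuous_measurable_circle; exact: continuous_cos_int.
Qed.

Lemma measurable_sin_int (n : int) : measurable_fun I (fun x : R => sin (n%:~R * x)).
Proof.
apply: continuous_measurable_circle; exact: continuous_sin_int.
Qed.

Lemma sqi_cos (n : int) : sqi (fun x : R => cos (n%:~R * x)).
Proof.
apply: (@sqi_bounded _ 1); first exact: measurable_cos_int.
by move=> x _; rewrite ler_norml cos_geN1 cos_le1.
Qed.

Lemma sqi_sin (n : int) : sqi (fun x : R => sin (n%:~R * x)).
Proof.
apply: (@sqi_bounded _ 1); first exact: measurable_sin_int.
by move=> x _; rewrite ler_norml sin_geN1 sin_le1.
Qed.

Lemma cig_cis (n : int) : cig (fun x : R => cis (n%:~R * x)).
Proof. by split; apply: sqi_ig; [exact: sqi_cos|exact: sqi_sin]. Qed.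

Lemma ir_deriv f (F : R -> R) : (forall x : R, is_derive x 1 F (f x)) -> continuous f ->
  ir f = F (2 * pi) - F 0.
Proof.
move=> dF cf; rewrite /ir /Rintegral /circle.
rewrite (@continuous_FTC2 _ f F 0 (2 * pi) two_pi_gt0)//.
- exact: continuous_subspaceT.
- have cF := deriv_continuous dF.
  split; first by move=> x _; have := dF x => -[].
    exact: cvg_at_right_filter (cF _).
  exact: cvg_at_left_filter (cF _).
by move=> x _; rewrite derive1E; apply: derive_val.
Qed.

Lemma cint_cis (n : int) :
  cint (fun x : R => cis (n%:~R * x)) = if n == 0 then ((2 * pi)%:C)%C else 0.
Proof.
have [->|n0] := eqVneq n 0.
  apply: complex_eq => /=.
    rewrite -[RHS]mul1r -ir_cst; apply: eq_ir => x _.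
    by rewrite mul0r cos0.
  rewrite -[RHS]ir0; apply: eq_ir => x _.
  by rewrite mul0r sin0.
have nr : (n%:~R : R) != 0 by rewrite intr_eq0.
have e := cis_int_2pi n.
have c2 : cos (n%:~R * (2 * pi)) = 1 :> R by have [] := e.
have s2 : sin (n%:~R * (2 * pi)) = 0 :> R by have [] := e.
apply: complex_eq => /=.
  have h (x : R) : is_derive x 1 (fun x => n%:~R^-1 * sin (n%:~R * x)) (cos (n%:~R * x)).
    by apply: is_derive_eq; rewrite /GRing.scale/=; field; exact: nr.
  by rewrite (ir_deriv h (@continuous_cos_int n)) s2 !(mulr0, sin0) subrr.
have h (x : R) : is_derive x 1 (fun x => - n%:~R^-1 * cos (n%:~R * x)) (sin (n%:~R * x)).
  by apply: is_derive_eq; rewrite /GRing.scale/=; field; exact: nr.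
by rewrite (ir_deriv h (@continuous_sin_int n)) c2 [n%:~R * 0]mulr0 cos0 subrr.
Qed.

(** * Approximation by trigonometric polynomials *)

Definition tsum (s : seq (R[i] * int)) (x : R) : R[i] :=
  \sum_(p <- s) p.1 * cis (p.2%:~R * x).

Definition trig (N : nat) (c : int -> R[i]) (x : R) : R[i] :=
  \sum_(n <- zr N) c n * cis (n%:~R * x).

(** [tsum] admits repeated and unordered frequencies, which makes products immediate; here they are
    regrouped into one coefficient per frequency. *)
Lemma tsum_trig s : exists N c, forall x, tsum s x = trig N c x.
Proof.
pose N := \max_(p <- s) `|p.2|%N.
exists N, (fun n => \sum_(p <- s | p.2 == n) p.1) => x; rewrite /tsum /trig.
under [RHS]eq_bigr do rewrite mulr_suml big_mkcond/=.
rewrite exchange_big/= big_seq [RHS]big_seq; apply: eq_bigr => p ps.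
have pN : p.2 \in zr N.
  by rewrite mem_zr; apply: (@leq_bigmax_seq _ s xpredT (fun p => `|p.2|%N)).
rewrite (bigD1_seq _ pN (zr_uniq N))/= eqxx.
by rewrite big1 ?addr0// => n; rewrite eq_sym => /negbTE ->.
Qed.

Lemma tsum_mul s s' : exists s'', forall x, tsum s x * tsum s' x = tsum s'' x.
Proof.
exists [seq (p.1 * p'.1, p.2 + p'.2) | p <- s, p' <- s'] => x.
rewrite /tsum big_allpairs_dep/= mulr_suml; apply: eq_bigr => p _.
rewrite mulr_sumr; apply: eq_bigr => p' _.
rewrite intrD mulrDl cisD; ring.
Qed.

(** The de la Vallée Poussin kernel cos^(2k)(z/2), not normalized: a nonnegative trigonometric
    polynomial that concentrates at multiples of 2 pi as k grows. *)
Definition kern (k : nat) (z : R) : R := ((1 + cos z) / 2) ^+ k.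

Lemma half_cos_ge0 z : 0 <= (1 + cos z) / 2 :> R.
Proof. by have := cos_geN1 z; lra. Qed.

Lemma kern_ge0 k z : 0 <= kern k z.
Proof. by rewrite exprn_ge0// half_cos_ge0. Qed.

Lemma kern_le1 k z : kern k z <= 1.
Proof.
have h0 := cos_geN1 z; have h1 := cos_le1 z.
by apply: exprn_ile1; lra.
Qed.

Lemma kern_tsum k : exists s, forall z, ((kern k z)%:C)%C = tsum s z.
Proof.
elim: k => [|k [s IH]].
  by exists [:: (1, 0)] => z; rewrite /tsum big_seq1 /kern expr0 mul0r cis0 mul1r.
have [s' h] := tsum_mul [:: (2^-1, 0); (4^-1, 1); (4^-1, -1)] s.
exists s' => z; rewrite -h -IH /kern exprS rmorphM; congr (_ * _).
rewrite /tsum !big_cons big_nil /= addr0 mul0r cis0 mulN1r mul1r cisN.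
have -> : 2^-1 = (((2:R)^-1)%:C)%C by rewrite fmorphV rmorph_nat.
have -> : 4^-1 = (((4:R)^-1)%:C)%C by rewrite fmorphV rmorph_nat.
by apply: complex_eq; rewrite ?Re_add ?Im_add ?Re_mul ?Im_mul ?Re_add ?Im_add ?Re_mul ?Im_mul /=; field.
Qed.

Lemma continuous_kern k x : continuous (fun y : R => kern k (x - y)).
Proof.
have h (y : R) : is_derive y 1 (fun y : R => (1 + cos (x - y)) / 2) (sin (x - y) / 2).
  by apply: is_derive_eq; rewrite /GRing.scale/=; ring.
move=> y; rewrite /kern.
apply: (@continuous_comp _ _ _ (fun y : R => (1 + cos (x - y)) / 2) (fun z : R => z ^+ k)).
  exact: (deriv_continuous h).
exact: exprn_continuous.
Qed.

Lemma ig_mul_kern (h : R -> R) M k x : measurable_fun I h -> (forall y, I y -> `|h y| <= M) ->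
  ig (fun y => h y * kern k (x - y)).
Proof.
move=> mh hM; apply: (@ig_bounded _ M).
  by apply: measurable_funM => //; apply: continuous_measurable_circle; exact: continuous_kern.
move=> y Iy; rewrite normrM (ger0_norm (kern_ge0 _ _)).
by apply: le_trans (hM y Iy); rewrite ler_piMr ?kern_le1.
Qed.

Lemma cig_mul_cis (h : R -> R) (n : int) : sqi h -> cig (fun y => ((h y)%:C)%C * cis (n%:~R * y)).
Proof.
move=> hh; split.
  under [X in ig X]funext do rewrite Re_mul /= mul0r subr0.
  by apply: sqi_mul => //; exact: sqi_cos.
under [X in ig X]funext do rewrite Im_mul /= mul0r addr0.
by apply: sqi_mul => //; exact: sqi_sin.
Qed.

Lemma cint_real (h : R -> R) : cint (fun y => ((h y)%:C)%C) = ((ir h)%:C)%C.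
Proof. by apply: complex_eq => //=; exact: ir0. Qed.

Lemma conv_tsum (h : R -> R) k s : sqi h -> (forall z, ((kern k z)%:C)%C = tsum s z) ->
  forall x, ((ir (fun y => h y * kern k (x - y)))%:C)%C =
  \sum_(p <- s) p.1 * cint (fun y => ((h y)%:C)%C * cis ((- p.2)%:~R * y)) *
     cis (p.2%:~R * x).
Proof.
move=> hh hs x; rewrite -cint_real.
transitivity (cint (fun y => \sum_(p <- s) (p.1 * cis (p.2%:~R * x)) *
   (((h y)%:C)%C * cis ((- p.2)%:~R * y)))).
  congr cint; apply/funext => y; 
  have -> : ((h y * kern k (x - y))%:C)%C = ((h y)%:C)%C * tsum s (x - y).
    by rewrite -hs; apply: complex_eq; rewrite ?Re_mul ?Im_mul /=; ring.
  rewrite /tsum mulr_sumr.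
  apply: eq_bigr => p _; rewrite mulrBr cisD mulrNz mulNr; ring.
rewrite cint_sum; last by move=> p _; apply: cigZ; exact: cig_mul_cis.
by apply: eq_bigr => p _; rewrite cintZ; [ring|exact: cig_mul_cis].
Qed.

Definition kmass k : R := ir (fun y => kern k (- y)).

(** Only the zero frequency survives integration over a period; this takes the place of a change of
    variables on the circle. *)
Lemma kmassE k x : ir (fun y => kern k (x - y)) = kmass k.
Proof.
have [s hs] := kern_tsum k.
have h1 : sqi (fun=> 1 : R) by apply: (@sqi_bounded _ 1) => // y _; rewrite normr1.
have E x' : ((ir (fun y => kern k (x' - y)))%:C)%C =
    \sum_(p <- s) p.1 * (if p.2 == 0 then ((2 * pi)%:C)%C else 0).
  have := conv_tsum h1 hs x'; under [X in ir X]funext do rewrite mul1r.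
  move=> ->; apply: eq_bigr => p _.
  under [X in cint X]funext do rewrite mul1r.
  rewrite cint_cis oppr_eq0; case: eqP => [->|_]; last by rewrite !mulr0 mul0r.
  by rewrite mul0r cis0 mulr1.
apply: complexI; rewrite E /kmass.
under [X in ir X]funext do rewrite -[- _]add0r.
by rewrite E.
Qed.

Lemma ig_kern k x : ig (fun y => kern k (x - y)).
Proof.
apply: (@ig_bounded _ 1); first by apply: continuous_measurable_circle; exact: continuous_kern.
by move=> y _; rewrite ger0_norm ?kern_ge0 ?kern_le1.
Qed.

Lemma kmass_ge (d : R) k : 0 < d -> d < pi ->
  (2 * d) * ((1 + cos d) / 2) ^+ k <= kmass k.
Proof.
move=> d0 dpi; have pi0 := @pi_gt0 R.
(* Centring at pi keeps the window of half-width [d] inside [0, 2 pi]. *)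
rewrite -(kmassE k pi).
pose A : set R := [set` `[pi - d, pi + d]%R].
have mA : @measurable _ (measurableTypeR R) A by exact: measurable_itv.
have AI : A `<=` I.
  move=> y; rewrite /A /circle/= !in_itv/= => /andP[y1 y2]; apply/andP; split; lra.
have muA : mu A = (2 * d)%:E.
  rewrite /A lebesgue_measure_itv/= lte_fin ifT; last by lra.
  by rewrite -EFinB; congr EFin; ring.
have h1 : Rintegral mu A (fun=> ((1 + cos d) / 2) ^+ k) =
   (2 * d) * ((1 + cos d) / 2) ^+ k.
  by rewrite (Rintegral_cst _ mA)/= muA mulrC.
have igA : mu.-integrable A (EFin \o (fun y => kern k (pi - y))).
  by apply: integrableS (ig_kern k pi) => //; exact: mI.
rewrite -h1; apply: (@le_trans _ _ (Rintegral mu A (fun y => kern k (pi - y)))).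
  apply: le_Rintegral => //.
    by apply: integrableS (ig_cst _) => //; exact: mI.
  move=> y; rewrite /A/= in_itv/= => /andP[y1 y2].
  rewrite /kern; apply: lerXn2r; rewrite ?nnegrE ?half_cos_ge0//.
  rewrite ler_pM2r ?invr_gt0// lerD2l -(cos_norm (pi - y)).
  have yd : `|pi - y| <= d by rewrite ler_norml; apply/andP; split; lra.
  rewrite le_eqVlt; have [->|ne] := eqVneq `|pi - y| d; first by rewrite eqxx.
  apply/orP; right; rewrite ltr_cos ?in_itv/=; last 2 first.
  - by rewrite normr_ge0/= (le_trans yd (ltW dpi)).
  - by rewrite (ltW d0) (ltW dpi).
  by rewrite lt_neqAle ne.
have fin1 : (\int[mu]_(x in A) (kern k (pi - x))%:E)%E \is a fin_num by exact: integrable_fin_num igA.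
have fin2 : (\int[mu]_(x in I) (kern k (pi - x))%:E)%E \is a fin_num.
  by apply: integrable_fin_num (ig_kern k pi); exact: mI.
apply: fine_le => //; apply: ge0_subset_integral => //; first exact: mI.
  by apply/measurable_EFinP; exact: ig_measurable (ig_kern k pi).
by move=> y _; rewrite lee_fin kern_ge0.
Qed.

Lemma kmass_gt0 k : 0 < kmass k.
Proof.
have pi0 := @pi_gt0 R.
have d0 : 0 < pi / 2 :> R by rewrite divr_gt0.
have d1 : pi / 2 < pi :> R by lra.
apply: lt_le_trans (kmass_ge k d0 d1).
by rewrite cos_pihalf addr0 mulr_gt0 ?exprn_gt0// mulr_gt0.
Qed.

Definition kmean (h : R -> R) k x : R := ir (fun y => h y * kern k (x - y)) / kmass k.

Lemma kmean_le (h : R -> R) M k x : measurable_fun I h -> (forall y, I y -> `|h y| <= M) ->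
  `|kmean h k x| <= M.
Proof.
move=> mh hM; have ihk := ig_mul_kern k x mh hM.
rewrite normrM normfV (gtr0_norm (kmass_gt0 k)) ler_pdivrMr ?kmass_gt0//.
apply: le_trans (ir_norm ihk) _; rewrite -(kmassE k x) -irZ; last exact: ig_kern.
apply: ir_le; [exact: ig_norm|by apply: igZ; exact: ig_kern|].
move=> y Iy; rewrite normrM (ger0_norm (kern_ge0 _ _)).
by rewrite ler_wpM2r ?kern_ge0 ?hM.
Qed.

Lemma cos_le_away (d z : R) : 0 < d -> d < pi -> d <= `|z| -> `|z| <= 2 * pi - d ->
  cos z <= cos d.
Proof.
move=> d0 dpi dz zd; rewrite -(cos_norm z).
have [zpi|piz] := leP `|z| pi.
  have [->//|ne] := eqVneq `|z| d.
  apply: ltW; rewrite ltr_cos ?in_itv/= ?normr_ge0//; last by apply/andP; split; lra.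
  by rewrite lt_neqAle eq_sym ne.
have -> : cos `|z| = cos (2 * pi - `|z|).
  by rewrite -cosN -(cosD2pi (- `|z|)) addrC mulr_natl.
have [->//|ne] := eqVneq (2 * pi - `|z|) d.
apply: ltW; rewrite ltr_cos ?in_itv/=; last 2 first.
- by apply/andP; split; lra.
- by apply/andP; split; lra.
by rewrite lt_neqAle eq_sym ne/=; lra.
Qed.

(** [h] need not be periodic, hence interior points only. With d at most x and 2 pi - x, any y at
    distance at least d from x has |x - y| <= 2 pi - d, so the kernel is small there also modulo the
    period. *)
Lemma kmean_cvg (h : R -> R) M x : continuous h -> (forall y, `|h y| <= M) ->
  0 < x -> x < 2 * pi -> kmean h k x @[k --> \oo] --> h x.
Proof.
move=> ch hM x0 x2; have pi0 := @pi_gt0 R.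
have mh := continuous_measurable_circle ch.
have M0 : 0 <= M by apply: le_trans (hM 0).
apply/cvgrPdist_le => e e0.
have e20 : 0 < e / 2 by rewrite divr_gt0.
have /cvgrPdist_lt/(_ _ e20) [d0 /= d00 hd0] := ch x.
pose d := Num.min d0 (Num.min x (Num.min (2 * pi - x) (pi / 2))).
have d_gt0 : 0 < d by rewrite /d !lt_min d00 x0 subr_gt0 x2 divr_gt0.
have [dd0 dx dx2 dpi] : [/\ d <= d0, d <= x, d <= 2 * pi - x & d <= pi / 2].
  by rewrite /d; split; rewrite !ge_min lexx ?orbT.
have dltpi : d < pi by lra.
(* Away from x the kernel is at most rho^k, while its mass is at least d r^k by the window of half
   the width; rho < r makes the quotient decay geometrically. *)
pose rho := (1 + cos d) / 2; pose r := (1 + cos (d / 2)) / 2.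
have r0 : 0 < r.
  have : 0 < cos (d / 2) by apply: cos_gt0_pihalf; apply/andP; split; lra.
  by rewrite /r; lra.
have rho_ge0 : 0 <= rho by rewrite /rho divr_ge0// -lerBlDl sub0r cos_geN1.
have rhor : rho < r.
  rewrite /rho /r ltr_pM2r ?invr_gt0// ltrD2l ltr_cos ?in_itv/=; first lra.
  - by apply/andP; split; lra.
  - by apply/andP; split; lra.
have key k : `|h x - kmean h k x| <= e / 2 + (2 * M * (2 * pi) / d) * (rho / r) ^+ k.
  have m0 := kmass_gt0 k.
  have -> : h x - kmean h k x = ir (fun y => (h x - h y) * kern k (x - y)) / kmass k.
    rewrite /kmean; have -> : (fun y => (h x - h y) * kern k (x - y)) =
       (fun y => h x * kern k (x - y) - h y * kern k (x - y)).
      by apply/funext => y; ring.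
    rewrite irB; last 2 first.
    - by apply: igZ; exact: ig_kern.
    - by apply: (@ig_mul_kern _ M) => // y _.
    by rewrite irZ ?kmassE; [field; rewrite gt_eqF|exact: ig_kern].
  have ihk : ig (fun y => (h x - h y) * kern k (x - y)).
    apply: (@ig_mul_kern _ (M + M)); first exact: measurable_funB.
    by move=> y _; apply: le_trans (ler_normB _ _) (lerD _ _).
  rewrite normrM normfV (gtr0_norm m0) ler_pdivrMr//.
  apply: le_trans (ir_norm ihk) _.
  apply: (@le_trans _ _ (ir (fun y => e / 2 * kern k (x - y) + 2 * M * rho ^+ k))).
    apply: ir_le; [exact: ig_norm| |].
      by apply: igD; [apply: igZ; exact: ig_kern|exact: ig_cst].
    move=> y; rewrite /circle/= in_itv/= => /andP[y0 y2].
    rewrite normrM (ger0_norm (kern_ge0 _ _)).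
    have k0 := kern_ge0 k (x - y).
    have [xy|xy] := ltP `|x - y| d.
      apply: (@le_trans _ _ (e / 2 * kern k (x - y))).
        rewrite ler_wpM2r// ltW//; apply: hd0 => /=.
        exact: lt_le_trans xy dd0.
      by rewrite lerDl !mulr_ge0// exprn_ge0.
    apply: (@le_trans _ _ (2 * M * rho ^+ k)).
      apply: ler_pM => //.
        rewrite mulr_natl mulr2n.
        by apply: le_trans (ler_normB _ _) (lerD _ _).
      rewrite /kern; apply: lerXn2r; rewrite ?nnegrE ?half_cos_ge0//.
      rewrite /rho ler_pM2r ?invr_gt0// lerD2l; apply: cos_le_away => //.
      by rewrite ler_norml; apply/andP; split; lra.
    by rewrite lerDr mulr_ge0// ltW.
  rewrite irD; [|by apply: igZ; exact: ig_kern|exact: ig_cst].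
  rewrite irZ ?kmassE ?ir_cst; last exact: ig_kern.
  rewrite [leRHS]mulrDl lerD2l.
  have hm : d * r ^+ k <= kmass k.
    have := @kmass_ge (d / 2) k; rewrite -/r (_ : 2 * (d / 2) = d); last by field.
    by apply; lra.
  have -> : 2 * M * rho ^+ k * (2 * pi) =
    (2 * M * (2 * pi) / d) * (rho / r) ^+ k * (d * r ^+ k).
    rewrite [(rho / r) ^+ k]expr_div_n; have rk0 : r ^+ k != 0 by rewrite expf_neq0// gt_eqF.
    have dn0 : d != 0 by rewrite gt_eqF.
    move: (rho ^+ k) (r ^+ k) rk0 (d) dn0 => a b b0 d' d'0.
    by field; rewrite b0 d'0.
  apply: ler_wpM2l => //.
  have := ltW d_gt0; have := ltW r0; have := ltW pi0.
  by move=> h1 h2 h3; rewrite !mulr_ge0 ?invr_ge0 ?exprn_ge0 ?mulr_ge0 ?invr_ge0.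
have geo : (2 * M * (2 * pi) / d) * (rho / r) ^+ k @[k --> \oo] --> (2 * M * (2 * pi) / d) * 0.
  apply: cvgMr; apply: cvg_expr.
  by rewrite ger0_norm ?divr_ge0 ?(ltW r0)// ltr_pdivrMr// mul1r.
rewrite mulr0 in geo.
have /cvgrPdist_le/(_ _ e20) := geo.
apply: filterS => k; rewrite sub0r normrN => hk.
apply: le_trans (key k) _; have := le_trans (ler_norm _) hk; lra.
Qed.

(** The end points form a null set, so convergence in the interior suffices. *)
Lemma ir_dominated (F : nat -> R -> R) g :
  (forall k, measurable_fun I (F k)) -> ig g ->
  (forall k x, I x -> `|F k x| <= g x) ->
  (forall x, 0 < x -> x < 2 * pi -> F k x @[k --> \oo] --> 0) ->
  forall e, 0 < e -> exists k, `|ir (F k)| <= e.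
Proof.
move=> mF igg Fg F0 e e0.
have h : {ae mu, forall x, I x -> (EFin \o F k) x @[k --> \oo] --> (0%:E : \bar R)}.
  have h0 : mu [set 0; 2 * pi] = 0.
    by apply: countable_lebesgue_measure0; exact: finite_set_countable.
  apply: (@negligibleS _ _ _ mu [set 0; 2 * pi]).
    move=> x /= /not_implyP[]; rewrite /circle/= in_itv/= => /andP[x0 x2] nx.
    have [->|xn0] := eqVneq x 0; first by left.
    have [->|xn2] := eqVneq x (2 * pi); first by right.
    exfalso; apply: nx; apply: cvg_EFin; first by near=> k.
    apply: F0; first by rewrite lt_neqAle eq_sym xn0.
    by rewrite lt_neqAle xn2.
  by apply/negligibleP => //; apply: measurableU; exact: measurable_set1.
have h2 : {ae mu, forall x n, I x -> (`|(EFin \o F n) x| <= (EFin \o g) x)%E}.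
  by apply: aeW => x k Ix; rewrite /= lee_fin; exact: Fg.
have [_ _] := @dominated_convergence _ _ _ mu I mI (fun k => EFin \o F k) (cst 0%:E) (EFin \o g)
  (fun k => (@measurable_EFinP _ _ _ _ _).2 (mF k)) (measurable_cst _) h igg h2.
rewrite integral0 => /fine_cvgP[_].
move=> /cvgrPdist_le/(_ _ e0)[k _ /(_ k (leqnn k))] /=.
by rewrite sub0r normrN => hk; exists k.
Unshelve. all: by end_near. Qed.

Lemma cig_tsum s : cig (tsum s).
Proof. by apply: cig_sum => p _; apply: cigZ; exact: cig_cis. Qed.

Lemma kmean_tsum (h : R -> R) k : sqi h ->
  exists s, forall x, ((kmean h k x)%:C)%C = tsum s x.
Proof.
move=> hh; have [s hs] := kern_tsum k.
exists [seq (p.1 * cint (fun y => ((h y)%:C)%C * cis ((- p.2)%:~R * y)) *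
   (((kmass k)^-1)%:C)%C, p.2) | p <- s] => x.
rewrite /tsum big_map/=.
have -> : ((kmean h k x)%:C)%C =
   ((ir (fun y => h y * kern k (x - y)))%:C)%C * (((kmass k)^-1)%:C)%C.
  by apply: complex_eq; rewrite ?Re_mul ?Im_mul /= /kmean; ring.
rewrite (conv_tsum hh hs) mulr_suml; apply: eq_bigr => p _; ring.
Qed.

Lemma measurable_kmean (h : R -> R) k : sqi h -> measurable_fun I (kmean h k).
Proof.
move=> hh; have [s hs] := kmean_tsum k hh.
have -> : kmean h k = (fun x => Re (tsum s x)) by apply/funext => x; rewrite -hs.
exact: ig_measurable (cig_tsum s).1.
Qed.

Lemma approx_trig_continuous (h : R -> R) M e : continuous h -> (forall y, `|h y| <= M) ->
  0 < e -> exists k, ir (fun x => (h x - kmean h k x) ^+ 2) <= e.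
Proof.
move=> ch hM e0.
have mh := continuous_measurable_circle ch.
have hh : sqi h by exact: (@sqi_bounded _ M).
have [||||k hk] := @ir_dominated (fun k x => (h x - kmean h k x) ^+ 2) (fun=> (M + M) ^+ 2) _ _ _ _ e e0.
- move=> k; apply: measurable_funX; apply: measurable_funB => //.
  exact: measurable_kmean.
- exact: ig_cst.
- move=> k x Ix; rewrite normrX; apply: lerXn2r; rewrite ?nnegrE//.
    by rewrite (le_trans _ (lerD (hM 0) (hM 0)))// addr_ge0.
  by apply: le_trans (ler_normB _ _) (lerD _ _) => //; exact: kmean_le.
- move=> x x0 x2; rewrite -[X in _ --> X](expr0n _ 2) -(subrr (h x)).
  have := kmean_cvg ch hM x0 x2 => hc.
  have hc2 : h x - kmean h k x @[k --> \oo] --> h x - h x.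
    by apply: cvgB => //; exact: cvg_cst.
  by rewrite !expr2; under eq_fun do rewrite expr2; apply: cvgM.
by exists k; apply: le_trans hk; exact: ler_norm.
Qed.

Definition clamp (M x : R) : R := Num.max (- M) (Num.min M x).

Lemma clamp_le M x : 0 <= M -> `|clamp M x| <= M.
Proof.
move=> M0; rewrite /clamp ler_norml; apply/andP; split.
  by rewrite le_max lexx.
by rewrite ge_max ge_min lexx/=; lra.
Qed.

Lemma clamp_id M x : `|x| <= M -> clamp M x = x.
Proof.
by rewrite ler_norml => /andP[h1 h2]; rewrite /clamp (min_idPr h2) (max_idPr h1).
Qed.

Lemma clamp_dist M x y : `|x| <= M -> `|x - clamp M y| <= `|x - y|.
Proof.
rewrite ler_norml => /andP[h1 h2]; rewrite /clamp /Num.max /Num.min.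
case: (ltP M y) => My; case: ltP => h3.
- by rewrite !ler0_norm; lra.
- have -> : x - - M = 0 by lra.
  by rewrite normr0.
- by [].
- by rewrite !ger0_norm; lra.
Qed.

Lemma clamp_rest_le M x : 0 <= M -> `|x - clamp M x| <= `|x|.
Proof.
move=> M0; rewrite /clamp /Num.max /Num.min.
case: (ltP M x) => My; case: ltP => h3.
- by rewrite !ger0_norm; lra.
- have -> : x - - M = x by lra.
  by [].
- by rewrite subrr normr0.
- by rewrite !ler0_norm; lra.
Qed.

Lemma clamp_continuous M : continuous (clamp M).
Proof.
move=> x; rewrite /clamp; apply: (@continuous_max _ _ (cst (- M)) (fun x => Num.min M x)).
  exact: cst_continuous.
by apply: (@continuous_min _ _ (cst M) id); [exact: cst_continuous|].
Qed.

(** Clamping the L^1 approximant to the range of [f] does not increase its distance to [f], and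
    boundedness turns L^1 closeness into L^2 closeness. *)
Lemma approx_continuous (f : R -> R) M e : measurable_fun I f ->
  (forall x, `|f x| <= M) -> 0 < e ->
  exists h : R -> R, [/\ continuous h, forall x, `|h x| <= M & ir (fun x => (f x - h x) ^+ 2) <= e].
Proof.
move=> mf fM e0; have M0 : 0 <= M by apply: le_trans (fM 0).
have igf : ig f by exact: (@ig_bounded _ M).
have [g_ [cg ig_ gf]] := approximation_continuous_integrable mI mu_circle_fin igf.
have d0 : 0 < e / (2 * M + 1) by rewrite divr_gt0//; lra.
move: gf => /fine_cvgP[_ /cvgrPdist_le/(_ _ d0)[k _ /(_ k (leqnn k))]] /= hk.
have ck : continuous (fun x => clamp M (g_ k x)).
  by move=> x; apply: continuous_comp; [exact: cg|exact: clamp_continuous].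
exists (fun x => clamp M (g_ k x)); split => //.
  by move=> x; exact: clamp_le.
have igk : ig (fun x => `|f x - g_ k x|) by apply: ig_norm; apply: igB => //; exact: ig_.
have h1 : ir (fun x => `|f x - g_ k x|) <= e / (2 * M + 1).
  by move: hk; rewrite sub0r normrN; apply: le_trans; exact: ler_norm.
apply: (@le_trans _ _ ((2 * M + 1) * ir (fun x => `|f x - g_ k x|))); last first.
  have p0 : 0 < 2 * M + 1 by lra.
  by rewrite mulrC -ler_pdivlMr.
rewrite -irZ//; apply: ir_le.
- apply: (sqiB _ _).2; first exact: (@sqi_bounded _ M).
  by apply: (@sqi_bounded _ M); [exact: continuous_measurable_circle|move=> x _; exact: clamp_le].
- exact: igZ.
move=> x _; rewrite -real_normK ?num_real// expr2.
have h2 := clamp_dist (g_ k x) (fM x).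
have h3 : `|f x - clamp M (g_ k x)| <= 2 * M + 1.
  by apply: le_trans (ler_normB _ _) _; have := fM x; have := clamp_le (g_ k x) M0; lra.
by apply: ler_pM.
Qed.

Lemma approx_clamp (f : R -> R) e : sqi f -> 0 < e ->
  exists M, 0 <= M /\ ir (fun x => (f x - clamp M (f x)) ^+ 2) <= e.
Proof.
move=> [mf hf] e0.
have [|||k hk] := @ir_dominated (fun k x => (f x - clamp k%:R (f x)) ^+ 2) (fun x => f x ^+ 2) _ hf _ _ e e0.
- move=> k; apply: measurable_funX; apply: measurable_funB => //.
  apply: measurable_maxr => //; exact: measurable_minr.
- move=> k x Ix; rewrite normrX -[f x ^+ 2]real_normK ?num_real//.
  apply: lerXn2r; rewrite ?nnegrE//.
  have k0 : (0 : R) <= k%:R by rewrite ler0n.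
  exact: clamp_rest_le.
- move=> x x0 x2; apply: cvg_near_cst; near=> k.
  rewrite clamp_id ?subrr ?expr0n//.
  near: k; exact: nbhs_infty_ger.
by exists k%:R; split => //; apply: le_trans hk; exact: ler_norm.
Unshelve. all: by end_near. Qed.

Lemma approx_trig (f : R -> R) e : sqi f -> 0 < e -> exists N c,
  (forall x, Im (trig N c x) = 0) /\
  ir (fun x => (f x - Re (trig N c x)) ^+ 2) <= e.
Proof.
(* Three errors and two uses of (a + b)^2 <= 2 a^2 + 2 b^2 give 2 + 4 + 4 = 10 sixteenths of [e]. *)
move=> hf e0; have e8 : 0 < e / 16 by rewrite divr_gt0.
have [M [M0 h1]] := approx_clamp hf e8.
have mc : measurable_fun I (fun x => clamp M (f x)).
  by apply: measurable_maxr => //; apply: measurable_minr => //; exact: hf.1.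
have [h [ch hM h2]] := approx_continuous mc (fun x => clamp_le (f x) M0) e8.
have [k h3] := approx_trig_continuous ch hM e8.
have hh : sqi h by apply: (@sqi_bounded _ M) => //; exact: continuous_measurable_circle.
have hc : sqi (fun x => clamp M (f x)).
  by apply: (@sqi_bounded _ M) => // x _; exact: clamp_le.
have hk : sqi (kmean h k).
  apply: (@sqi_bounded _ M); first exact: measurable_kmean.
  by move=> x _; apply: kmean_le => //; exact: continuous_measurable_circle.
have [s hs] := kmean_tsum k hh; have [N [c hNc]] := tsum_trig s.
have E x : ((kmean h k x)%:C)%C = trig N c x by rewrite -hNc -hs.
exists N, c; split; first by move=> x; rewrite -E.
under [X in ir X]funext do rewrite -E /=.
have -> : (fun x => (f x - kmean h k x) ^+ 2) =
   (fun x => ((f x - clamp M (f x)) + ((clamp M (f x) - h x) + (h x - kmean h k x))) ^+ 2).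
  by apply/funext => x; congr (_ ^+ 2); ring.
have q1 := sqiB hf hc; have q2 := sqiB hc hh; have q3 := sqiB hh hk.
apply: le_trans (ir_sqD_le q1 (sqiD q2 q3)) _.
have := ir_sqD_le q2 q3; move: h1 h2 h3; lra.
Qed.

(** * Parseval and the truncation of products *)

Lemma cint_fourier (f : R -> R) n : sqi f ->
  cint (fun y => ((f y)%:C)%C * cis ((- n)%:~R * y)) = ((2 * pi)%:C)%C * fourier f n.
Proof.
move=> hf; have p0 : 2 * pi != 0 :> R by rewrite gt_eqF ?two_pi_gt0.
apply: complex_eq; rewrite ?Re_mul ?Im_mul /= !mul0r ?subr0 ?addr0.
  rewrite mulVKf//; apply: eq_ir => x _.
  by rewrite mulrNz mulNr cosN; ring.
rewrite mulrN mulVKf// -irN; last by apply: sqi_mul => //; exact: sqi_sin.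
by apply: eq_ir => x _; rewrite mulrNz mulNr sinN; ring.
Qed.

Lemma sqnormc_ge0 (z : R[i]) : 0 <= sqnormc z.
Proof. by rewrite /sqnormc addr_ge0 ?sqr_ge0. Qed.

Lemma conj_trig N c x : conjc (trig N c x) =
  \sum_(n <- zr N) conjc (c n) * cis ((- n)%:~R * x).
Proof.
rewrite /trig rmorph_sum/=; apply: eq_bigr => n _.
by rewrite rmorphM mulrNz mulNr cisN.
Qed.

Lemma cig_trig N c : cig (trig N c).
Proof. by apply: cig_sum => p _; apply: cigZ; exact: cig_cis. Qed.

Lemma sqi_trig N c : sqi (fun x => Re (trig N c x)) /\ sqi (fun x => Im (trig N c x)).
Proof.
have [h1 h2] := cig_trig N c.
have b x : normc (trig N c x) <= \sum_(n <- zr N) normc (c n).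
  apply: le_trans (normc_sum _ _ _) _; apply: ler_sum => n _.
  by rewrite Normc.normcM normc_cis mulr1.
split; apply: (@sqi_bounded _ (\sum_(n <- zr N) normc (c n))); try exact: ig_measurable.
  by move=> x _; exact: le_trans (normc_Re _) (b x).
by move=> x _; exact: le_trans (normc_Im _) (b x).
Qed.

Lemma ig_sqnormc_sub (f : R -> R) N c : sqi f ->
  ig (fun x => sqnormc (Complex (f x) 0 - trig N c x)).
Proof.
move=> hf; have [h1 h2] := sqi_trig N c; rewrite /sqnormc.
apply: igD.
  under [X in ig X]funext do rewrite Re_add Re_opp /=.
  exact: (sqiB hf h1).2.
under [X in ig X]funext do rewrite Im_add Im_opp /= add0r sqrrN.
exact: h2.2.
Qed.

Lemma trig_sqr N c : ir (fun x => sqnormc (trig N c x)) =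
  2 * pi * \sum_(n <- zr N) sqnormc (c n).
Proof.
have e : cint (fun x => trig N c x * conjc (trig N c x)) =
    ((2 * pi)%:C)%C * \sum_(n <- zr N) c n * conjc (c n).
  transitivity (cint (fun x => \sum_(n <- zr N) \sum_(m <- zr N)
     (c n * conjc (c m)) * cis ((n - m)%:~R * x))).
    congr cint; apply/funext => x; rewrite conj_trig {1}/trig mulr_suml.
    apply: eq_bigr => n _; rewrite mulr_sumr; apply: eq_bigr => m _.
    by rewrite intrD mulrDl cisD; ring.
  rewrite cint_sum; last first.
    by move=> n _; apply: cig_sum => m _; apply: cigZ; exact: cig_cis.
  rewrite mulr_sumr big_seq [RHS]big_seq; apply: eq_bigr => n nN.
  rewrite cint_sum; last by move=> m _; apply: cigZ; exact: cig_cis.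
  rewrite (bigD1_seq _ nN (zr_uniq N))/= big1 ?addr0.
    by rewrite cintZ; [rewrite cint_cis subrr eqxx mulrC|exact: cig_cis].
  move=> m mn; rewrite cintZ; last exact: cig_cis.
  by rewrite cint_cis subr_eq0 eq_sym (negbTE mn) mulr0.
have sq z : sqnormc z = Re (z * conjc z).
  by case: z => a b; rewrite /sqnormc Re_mul /=; ring.
have := congr1 Re e; rewrite Re_mul /= mul0r subr0 Re_sum.
rewrite (_ : (fun x => sqnormc (trig N c x)) = (fun x => Re (trig N c x * conjc (trig N c x)))).
  by move=> ->; congr (_ * _); apply: eq_bigr => n _; exact: esym (sq _).
by apply/funext => x; exact: sq.
Qed.

Lemma pythagoras (f : R -> R) N c : sqi f ->
  ir (fun x => sqnormc (Complex (f x) 0 - trig N c x)) =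
  ir (fun x => f x ^+ 2) - 2 * pi * (\sum_(n <- zr N) sqnormc (fourier f n)) +
  2 * pi * \sum_(n <- zr N) sqnormc (fourier f n - c n).
Proof.
move=> hf; have [h1 h2] := sqi_trig N c.
have e : cint (fun x => conjc (trig N c x) * ((f x)%:C)%C) =
    ((2 * pi)%:C)%C * \sum_(n <- zr N) conjc (c n) * fourier f n.
  transitivity (cint (fun x => \sum_(n <- zr N)
     conjc (c n) * (((f x)%:C)%C * cis ((- n)%:~R * x)))).
    congr cint; apply/funext => x; rewrite conj_trig mulr_suml.
    by apply: eq_bigr => n _; ring.
  rewrite cint_sum; last by move=> n _; apply: cigZ; exact: cig_mul_cis.
  rewrite mulr_sumr; apply: eq_bigr => n _.
  by rewrite cintZ; [rewrite cint_fourier//; ring|exact: cig_mul_cis].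
have e1 : ir (fun x => Re (trig N c x) * f x) =
    2 * pi * \sum_(n <- zr N) Re (conjc (c n) * fourier f n).
  have := congr1 Re e; rewrite Re_mul /= mul0r subr0 Re_sum => <-.
  congr ir; apply/funext => x; rewrite Re_mul /=.
  by case: (trig N c x) => a b /=; ring.
have -> : (fun x => sqnormc (Complex (f x) 0 - trig N c x)) =
   (fun x => f x ^+ 2 + (- 2 * (Re (trig N c x) * f x) + sqnormc (trig N c x))).
  apply/funext => x; rewrite /sqnormc Re_add Im_add Re_opp Im_opp /=; ring.
have i1 : ig (fun x => Re (trig N c x) * f x) by exact: sqi_mul.
have i2 : ig (fun x => sqnormc (trig N c x)) by apply: igD; [exact: h1.2|exact: h2.2].
rewrite irD ?(hf.2)//; last by apply: igD => //; exact: igZ.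
rewrite irD ?irZ//; last exact: igZ.
rewrite trig_sqr e1 -addrA; congr (_ + _).
rewrite mulrCA -mulrDr -mulrN -mulrDr; congr (_ * _).
rewrite mulr_sumr -!big_split/= -sumrN -big_split/=; apply: eq_bigr => n _.
rewrite /sqnormc Re_add Im_add Re_opp Im_opp Re_mul; case: (c n) => a b /=.
case: (fourier f n) => a' b' /=; ring.
Qed.

(* The squared L^2 distance of [f] to its [N]-th Fourier partial sum. *)
Definition pdefect (f : R -> R) N : R :=
  ir (fun x => f x ^+ 2) - 2 * pi * \sum_(n <- zr N) sqnormc (fourier f n).

Lemma pythagoras_fourier (f : R -> R) N : sqi f ->
  ir (fun x => sqnormc (Complex (f x) 0 - trig N (fourier f) x)) = pdefect f N.
Proof.
move=> hf; rewrite pythagoras// (big1 _ _ (fun n => sqnormc (fourier f n - fourier f n))).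
  by rewrite mulr0 addr0.
by move=> n _; rewrite subrr /sqnormc /= expr0n addr0.
Qed.

Lemma pdefect_ge0 (f : R -> R) N : sqi f -> 0 <= pdefect f N.
Proof.
move=> hf; rewrite -pythagoras_fourier//; apply: ir_ge0 => x _.
exact: sqnormc_ge0.
Qed.

Lemma pdefect_le (f : R -> R) N N' : (N <= N')%N -> pdefect f N' <= pdefect f N.
Proof.
move=> NN; rewrite /pdefect lerD2l lerN2; apply: ler_wpM2l.
  exact: ltW two_pi_gt0.
by apply: sum_zr_le => // n; exact: sqnormc_ge0.
Qed.

(** By [pythagoras] the Fourier coefficients minimize the L^2 distance among trigonometric sums of
    the same range, so any approximation bounds the defect. *)
Lemma parseval (f : R -> R) e : sqi f -> 0 < e -> exists N, pdefect f N <= e.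
Proof.
move=> hf e0; have [N [c [hc hN]]] := approx_trig hf e0; exists N.
apply: le_trans hN.
have -> : (fun x => (f x - Re (trig N c x)) ^+ 2) =
   (fun x => sqnormc (Complex (f x) 0 - trig N c x)).
  apply/funext => x; rewrite /sqnormc Re_add Im_add Re_opp Im_opp /= hc; ring.
rewrite pythagoras// -/(pdefect f N) lerDl mulr_ge0 ?(ltW two_pi_gt0)//.
by apply: sumr_ge0 => n _; exact: sqnormc_ge0.
Qed.

(** The truncated convolution is the coefficient of S^2, with S the partial sum of u. In u^2 - S^2 =
    (u - S)(u + S) one uses |u + S| <= 2|u| + |u - S|, and [l] balances the mixed term: large [l]
    makes the part without the defect small. Since |cis| = 1, the bound is uniform in [n]; the
    factor 2 from [normc_cint] is absorbed by 2 pi. *)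
Lemma conv_fourier_le (u : R -> R) n K (l : R) : sqi u -> 1 <= l ->
  normc (fourier (fun x => u x ^+ 2) n -
    \sum_(k <- zr K | (`|n - k| <= K)%N) fourier u k * fourier u (n - k)) <=
  (l + 2) * pdefect u K + 8 * ir (fun x => u x ^+ 2) / l.
Proof.
move=> hu l1; set S := trig K (fourier u).
have l0 : 0 < l by lra.
have [s1 s2] := sqi_trig K (fourier u).
have cs := sqi_cos n; have sn := sqi_sin n.
have h1 : cint (fun x => ((u x ^+ 2)%:C)%C * cis ((- n)%:~R * x)) =
    ((2 * pi)%:C)%C * fourier (fun x => u x ^+ 2) n.
  have p0 : 2 * pi != 0 :> R by rewrite gt_eqF ?two_pi_gt0.
  have ibs (b : R -> R) : measurable_fun I b -> (forall x, I x -> `|b x| <= 1) ->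
      ig (fun x => u x ^+ 2 * b x).
    move=> mb hb; apply: (@ig_le _ (fun x => u x ^+ 2)); last exact: hu.2.
      by apply: measurable_funM => //; apply: measurable_funX; exact: hu.1.
    by move=> x Ix; rewrite normrM (ger0_norm (sqr_ge0 _)) ler_piMr ?sqr_ge0 ?hb.
  apply: complex_eq; rewrite ?Re_mul ?Im_mul /= !mul0r ?subr0 ?addr0.
    rewrite mulVKf//; apply: eq_ir => x _.
    by rewrite mulrNz mulNr cosN; ring.
  rewrite mulrN mulVKf// -irN; last first.
    apply: ibs; first exact: measurable_sin_int.
    by move=> x _; rewrite ler_norml sin_geN1 sin_le1.
  by apply: eq_ir => x _; rewrite mulrNz mulNr sinN; ring.
have igu2 : cig (fun x => ((u x ^+ 2)%:C)%C * cis ((- n)%:~R * x)).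
  have ibs (b : R -> R) : measurable_fun I b -> (forall x, I x -> `|b x| <= 1) ->
      ig (fun x => u x ^+ 2 * b x).
    move=> mb hb; apply: (@ig_le _ (fun x => u x ^+ 2)); last exact: hu.2.
      by apply: measurable_funM => //; apply: measurable_funX; exact: hu.1.
    by move=> x Ix; rewrite normrM (ger0_norm (sqr_ge0 _)) ler_piMr ?sqr_ge0 ?hb.
  split.
    under [X in ig X]funext do rewrite Re_mul /= mul0r subr0.
    apply: ibs; first exact: measurable_cos_int.
    by move=> x _; rewrite ler_norml cos_geN1 cos_le1.
  under [X in ig X]funext do rewrite Im_mul /= mul0r addr0.
  apply: ibs; first exact: measurable_sin_int.
  by move=> x _; rewrite ler_norml sin_geN1 sin_le1.
have SE : (fun x => S x * S x * cis ((- n)%:~R * x)) = (fun x => \sum_(k <- zr K) \sum_(m <- zr K)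
     (fourier u k * fourier u m) * cis ((k + m - n)%:~R * x)).
  apply/funext => x; rewrite {1}/S /trig !mulr_suml; apply: eq_bigr => k _.
  rewrite mulr_sumr mulr_suml; apply: eq_bigr => m _.
  by rewrite !intrD !mulrDl !cisD; ring.
have igS : cig (fun x => S x * S x * cis ((- n)%:~R * x)).
  rewrite SE; apply: cig_sum => k _; apply: cig_sum => m _; apply: cigZ; exact: cig_cis.
have h2 : cint (fun x => S x * S x * cis ((- n)%:~R * x)) =
   ((2 * pi)%:C)%C * \sum_(k <- zr K | (`|n - k| <= K)%N) fourier u k * fourier u (n - k).
  rewrite SE cint_sum; last first.
    by move=> k _; apply: cig_sum => m _; apply: cigZ; exact: cig_cis.
  rewrite mulr_sumr [RHS]big_mkcond/=; apply: eq_bigr => k _.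
  rewrite cint_sum; last by move=> m _; apply: cigZ; exact: cig_cis.
  have E m : cint (fun x => fourier u k * fourier u m * cis ((k + m - n)%:~R * x)) =
      if m == n - k then fourier u k * fourier u m * ((2 * pi)%:C)%C else 0.
    rewrite cintZ; last exact: cig_cis.
    rewrite cint_cis (_ : (k + m - n == 0) = (m == n - k)); last by lia.
    by case: ifP => // _; rewrite mulr0.
  under eq_bigr do rewrite E.
  case: ifP => hk.
    have nk : n - k \in zr K by rewrite mem_zr.
    rewrite (bigD1_seq _ nk (zr_uniq K))/= eqxx big1 ?addr0; first by rewrite mulrC.
    by move=> m /negbTE ->.
  rewrite big_seq big1// => m; rewrite mem_zr => mK.
  by case: eqP => // e; move: mK; rewrite e hk.
have p1 : (1 : R) <= pi by have := @pi_ge2 R; lra.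
have h3 : ((2 * pi)%:C)%C * (fourier (fun x => u x ^+ 2) n -
    \sum_(k <- zr K | (`|n - k| <= K)%N) fourier u k * fourier u (n - k)) =
  cint (fun x => ((u x ^+ 2)%:C)%C * cis ((- n)%:~R * x) + (-1) * (S x * S x * cis ((- n)%:~R * x))).
  rewrite cintD//; last by apply: cigZ.
  by rewrite cintZ// h1 h2; ring.
rewrite -(ler_pM2l (two_pi_gt0)).
rewrite -[X in X * normc _](gtr0_norm two_pi_gt0) -normc_real -Normc.normcM h3.
apply: le_trans (normc_cint _) _; first by apply: cigD => //; exact: cigZ.
pose D x := sqnormc (Complex (u x) 0 - S x).
have igD' : ig D by exact: ig_sqnormc_sub.
apply: (@le_trans _ _ (2 * ir (fun x => (l + 2) * D x + 8 / l * u x ^+ 2))); last first.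
  rewrite irD; [|exact: igZ|by apply: igZ; exact: hu.2].
  rewrite !irZ//; last exact: hu.2.
  rewrite pythagoras_fourier// [8 / l * _]mulrAC.
  apply: ler_wpM2r; last by lra.
  rewrite addr_ge0//; first by rewrite mulr_ge0 ?pdefect_ge0//; lra.
  by rewrite divr_ge0 ?(ltW l0)// mulr_ge0//; apply: ir_ge0 => x _; exact: sqr_ge0.
apply: ler_wpM2l => //; apply: ir_le.
- have [i1 i2] : cig (fun x => ((u x ^+ 2)%:C)%C * cis ((- n)%:~R * x) + (-1) * (S x * S x * cis ((- n)%:~R * x))).
    by apply: cigD => //; exact: cigZ.
  by apply: igD; exact: ig_norm.
- by apply: igD; apply: igZ => //; exact: hu.2.
move=> x _.
have -> : ((u x ^+ 2)%:C)%C * cis ((- n)%:~R * x) + (-1) * (S x * S x * cis ((- n)%:~R * x)) =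
   (Complex (u x) 0 - S x) * (Complex (u x) 0 + S x) * cis ((- n)%:~R * x).
  have -> : ((u x ^+ 2)%:C)%C = Complex (u x) 0 * Complex (u x) 0 :> R[i].
    by apply: complex_eq; rewrite ?Re_mul ?Im_mul /=; ring.
  ring.
set z := _ * cis _.
apply: (@le_trans _ _ (2 * normc z)).
  by rewrite mulr_natl mulr2n; apply: lerD; [exact: normc_Re|exact: normc_Im].
rewrite /z !Normc.normcM normc_cis mulr1.
set a := normc (_ - _); set b := normc (_ + _).
have a0 : 0 <= a := normc_ge0 _; have b0 : 0 <= b := normc_ge0 _.
have hb : b <= 2 * `|u x| + a.
  have -> : b = normc (((2 * u x)%:C)%C - (Complex (u x) 0 - S x)).
    congr normc; apply: complex_eq; rewrite ?Re_add ?Im_add ?Re_opp ?Im_opp ?Re_add ?Im_add ?Re_opp ?Im_opp /=; ring.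
  by apply: le_trans (normcB _ _) _; rewrite normc_real normrM (ger0_norm (_ : 0 <= 2)).
have -> : D x = a ^+ 2 by rewrite /D -normc_sqr.
rewrite -[u x ^+ 2]real_normK ?num_real//.
move: (normr_ge0 (u x)) hb; move: `|u x| => U U0 hb.
apply: (@le_trans _ _ (2 * (a * (2 * U + a)))); first by rewrite ler_wpM2l// ler_wpM2l.
have h4 : 4 * a * U <= l * a ^+ 2 + 8 / l * U ^+ 2.
  have -> : l * a ^+ 2 + 8 / l * U ^+ 2 =
     4 * a * U + l^-1 * ((l * a - 2 * U) ^+ 2 + 4 * U ^+ 2).
    by field; rewrite gt_eqF.
  rewrite lerDl mulr_ge0 ?invr_ge0 ?(ltW l0)//.
  by apply: addr_ge0; [exact: sqr_ge0|apply: mulr_ge0 => //; exact: sqr_ge0].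
lra.
Qed.

End circle_integral.

(** * From weighted sums to Hölder bounds *)

Section holder.
Context {R : realType}.
Local Notation normc := (@Normc.normc R).
Local Notation Re := (@complex.Re R).

Lemma cderiv_lipschitz (f df : R -> R[i]) (T D : R) :
  (forall x, cderiv f x (df x)) -> (forall x, `|x| <= T -> normc (df x) <= D) ->
  forall t t', `|t| <= T -> `|t'| <= T -> normc (f t - f t') <= D * `|t - t'|.
Proof.
move=> hf hD.
suff H t t' : t' < t -> `|t| <= T -> `|t'| <= T -> normc (f t - f t') <= D * `|t - t'|.
  move=> t t' tT t'T; have [h|h|->] := ltgtP t t'.
  - by rewrite -normcN opprB distrC; exact: H.
  - exact: H.
  - by rewrite !subrr normr0 mulr0 Normc.normc0.
move=> tt' tT t'T; have [z [z1 hz]] := normc_polar (f t - f t').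
pose F x := Re (z * f x).
have dF x : is_derive (x : R) (1 : R) F (Re (z * df x)) := (cderivZ z (hf x)).1.
have cF := deriv_continuous dF.
have [c] := MVT tt' (fun x _ => dF x) (continuous_subspaceT cF).
rewrite in_itv/= => /andP[c1 c2] e.
have -> : normc (f t - f t') = F t - F t' by rewrite -hz /F mulrBr Re_add Re_opp.
rewrite e gtr0_norm ?subr_gt0// ler_wpM2r ?subr_ge0 ?(ltW tt')//.
apply: le_trans (ler_norm _) _; apply: le_trans (normc_Re _) _.
rewrite Normc.normcM; apply: (@le_trans _ _ (normc (df c))).
  by rewrite ler_piMl ?normc_ge0.
apply: hD; move: tT t'T; rewrite !ler_norml => /andP[? ?] /andP[? ?].
by apply/andP; split; lra.
Qed.

Lemma normc_cis_sub (x y : R) : normc (cis x - cis y) <= `|x - y|.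
Proof.
have h (z : R) : cderiv (fun x => cis (1 * x)) z (Complex 0 1 * cis (1 * z)) := cderiv_cis 1 z.
have := @cderiv_lipschitz _ _ (Num.max `|x| `|y|) 1 h _ x y.
rewrite !mul1r; apply.
- by move=> z _; rewrite Normc.normcM normc_cis mulr1 normc_i.
- by rewrite le_max lexx.
- by rewrite le_max lexx orbT.
Qed.

(** Interpolates between the Lipschitz bound and the trivial bound 2. *)
Lemma normc_cis_holder (a x y : R) : 0 <= a -> a <= 1 ->
  normc (cis x - cis y) <= 2 * `|x - y| `^ a.
Proof.
move=> a0 a1; have [h|h] := leP `|x - y| 1.
  apply: le_trans (normc_cis_sub x y) _.
  have [->|n0] := eqVneq `|x - y| 0; first by rewrite mulr_ge0 ?powR_ge0.
  have p0 : 0 < `|x - y| by rewrite lt_neqAle eq_sym n0 normr_ge0.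
  apply: (@le_trans _ _ (`|x - y| `^ a)); last first.
    by have := powR_ge0 `|x - y| a; lra.
  by apply: ger1_powR => //; rewrite p0 h.
apply: (@le_trans _ _ 2).
  by apply: le_trans (normcB _ _) _; rewrite !normc_cis.
by rewrite ler_peMr// -(powRr0 `|x - y|); apply: ler_powR; rewrite ?(ltW h).
Qed.

Lemma powR_interp_le (a x z : R) : 0 <= a -> a <= 1 -> 0 <= x -> 0 <= z ->
  x `^ (1 - a) * z `^ a <= x + z.
Proof.
move=> a0 a1 x0 z0; set m := Num.max x z.
have xm : x <= m by rewrite le_max lexx.
have zm : z <= m by rewrite le_max lexx orbT.
have m0 : 0 <= m := le_trans x0 xm.
apply: (@le_trans _ _ m); last by rewrite /m /Num.max; case: ifP => _; lra.
have [me|mn] := eqVneq m 0.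
  have -> : x = 0 by lra.
  have -> : z = 0 by lra.
  have [->|an0] := eqVneq a 0; first by rewrite subr0 powRr1// mul0r.
  by rewrite [X in _ * X]powR0// mulr0.
apply: (@le_trans _ _ (m `^ (1 - a) * m `^ a)).
  apply: ler_pM; rewrite ?powR_ge0//; apply: ge0_ler_powR; rewrite ?nnegrE//; lra.
by rewrite -powRD ?mn ?implybT// subrK powRr1.
Qed.

Context (v : int -> R -> R[i]) (T a C B : R).
Context (a0 : 0 < a).
Context (a13 : a < 1 / 3).
Context (B0 : 0 <= B).
Context (hC : forall N t, `|t| <= T ->
  \sum_(n <- zr N) J n `^ (3 * a) * normc (v n t - v n 0) <= C).
Context (hB : forall n t t', `|t| <= T -> `|t'| <= T ->
  normc (v n t - v n t') <= B * `|n%:~R| * `|t - t'|).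

(* For [v n t = e^{-itn^3} u_n(t)] this is [u_n(t) - e^{itn^3} u_n(0)]. *)
Definition om (n : int) (t : R) : R[i] := ph (n ^+ 3) t * (v n t - v n 0).

Lemma normc_om n t : normc (om n t) = normc (v n t - v n 0).
Proof. by rewrite Normc.normcM normc_ph mul1r. Qed.

Let a1 : a <= 1. Proof. by move: a13 => h; lra. Qed.
Let a0' : 0 <= a. Proof. exact: ltW a0. Qed.

Lemma om_weight_le N t p : `|t| <= T -> p <= 3 * a ->
  \sum_(n <- zr N) J n `^ p * normc (om n t) <= C.
Proof.
move=> tT pa; apply: le_trans (hC N tT); apply: ler_sum => n _.
rewrite normc_om ler_wpM2r ?normc_ge0//.
by apply: ler_powR; rewrite ?J_ge1.
Qed.

Lemma om_sum_le N t : `|t| <= T -> \sum_(n <- zr N) normc (om n t) <= C.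
Proof.
move=> tT; have := @om_weight_le N t 0 tT; rewrite mulr_ge0// => /(_ isT).
by under eq_bigr do rewrite powRr0 mul1r.
Qed.

Lemma trig_om_bound N t x : `|t| <= T -> normc (trig N (om ^~ t) x) <= C.
Proof.
move=> tT; apply: le_trans (om_sum_le N tT).
apply: le_trans (normc_sum _ _ _) _; apply: ler_sum => n _.
by rewrite Normc.normcM normc_cis mulr1.
Qed.

Lemma trig_om_space N t x x' : `|t| <= T ->
  normc (trig N (om ^~ t) x - trig N (om ^~ t) x') <= 2 * C * `|x - x'| `^ a.
Proof.
move=> tT; have h1 : a <= 3 * a by move: a0' => h; lra.
have h := om_weight_le N tT h1.
apply: (@le_trans _ _ (2 * (\sum_(n <- zr N) J n `^ a * normc (om n t)) * `|x - x'| `^ a)); last first.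
  by rewrite ler_wpM2r ?powR_ge0// ler_wpM2l.
rewrite /trig -sumrB; apply: le_trans (normc_sum _ _ _) _.
rewrite mulr_sumr mulr_suml; apply: ler_sum => n _.
rewrite -mulrBr Normc.normcM.
have := normc_cis_holder (n%:~R * x) (n%:~R * x') a0' a1.
rewrite -mulrBr normrM powRM// => h2.
have h3 : `|n%:~R| `^ a <= J n `^ a.
  by apply: ge0_ler_powR; rewrite ?nnegrE ?J_ge0 ?le_J.
apply: (@le_trans _ _ (normc (om n t) * (2 * (J n `^ a * `|x - x'| `^ a)))).
  rewrite ler_wpM2l ?normc_ge0//; apply: le_trans h2 _.
  by rewrite ler_wpM2l// ler_wpM2r ?powR_ge0.
by rewrite le_eqVlt; apply/orP; left; apply/eqP; ring.
Qed.

(** Each increment d is at most y, the sum of the two increments from time 0, and at most B J |t -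
    t'|; hence d <= y^(1-a) (B J |t - t'|)^a. By [powR_interp_le], y^(1-a) J^a is at most J^(3a) y +
    J^-(2-3a), since 3a(1 - a) - (2 - 3a)a = a. The last power is summable exactly for a < 1/3, the
    same range in which 3a is a smoothing exponent. *)
Lemma v_holder N t t' : `|t| <= T -> `|t'| <= T ->
  \sum_(n <- zr N) normc (v n t - v n t') <=
  (B `^ a * (C + C + (1 + 2 * (1 + (1 - 3 * a)^-1)))) * `|t - t'| `^ a.
Proof.
move=> tT t'T.
have p1 : 1 < 2 - 3 * a by move: a13 => h; lra.
have hp := sum_J_le N p1.
have ep : 2 - 3 * a - 1 = 1 - 3 * a by ring.
rewrite ep in hp.
have h1 := hC N tT; have h2 := hC N t'T.
have Ba := powR_ge0 B a.
apply: (@le_trans _ _ (B `^ a * (\sum_(n <- zr N) (J n `^ (3 * a) * normc (v n t - v n 0) +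
    J n `^ (3 * a) * normc (v n t' - v n 0) + J n `^ (- (2 - 3 * a)))) * `|t - t'| `^ a)).
  rewrite mulr_sumr mulr_suml; apply: ler_sum => n _.
  set d := normc (v n t - v n t'); set y := normc (v n t - v n 0) + normc (v n t' - v n 0).
  have y0 : 0 <= y by rewrite addr_ge0 ?normc_ge0.
  have d0 : 0 <= d := normc_ge0 _.
  have dy : d <= y.
    rewrite /d (_ : v n t - v n t' = (v n t - v n 0) - (v n t' - v n 0)); last by ring.
    exact: normcB.
  have db : d <= B * J n * `|t - t'|.
    apply: le_trans (hB n tT t'T) _; rewrite ler_wpM2r// ler_wpM2l//; exact: le_J.
  have J0 := J_gt0 n : 0 < J n :> R.
  have e1 : d = d `^ (1 - a) * d `^ a.
    have [dz|dn] := eqVneq d 0; last by rewrite -powRD ?dn ?implybT// subrK powRr1.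
    by rewrite dz [X in _ * X]powR0 ?mulr0// gt_eqF.
  have e2 : y `^ (1 - a) * J n `^ a <= J n `^ (3 * a) * y + J n `^ (- (2 - 3 * a)).
    have := @powR_interp_le a (J n `^ (3 * a) * y) (J n `^ (- (2 - 3 * a))) a0' a1.
    rewrite mulr_ge0 ?powR_ge0// => /(_ isT isT); apply: le_trans.
    rewrite powRM ?powR_ge0// -!powRrM mulrAC -powRD; last first.
      by rewrite (gt_eqF J0) implybT.
    rewrite mulrC le_eqVlt; apply/orP; left; apply/eqP; congr (_ `^ _ * _); ring.
  rewrite -mulrDr -/y e1.
  apply: (@le_trans _ _ (y `^ (1 - a) * (B * J n * `|t - t'|) `^ a)).
    apply: ler_pM; rewrite ?powR_ge0//; apply: ge0_ler_powR; rewrite ?nnegrE ?subr_ge0//.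
    by rewrite !mulr_ge0 ?J_ge0.
  rewrite !powRM ?mulr_ge0 ?J_ge0//.
  rewrite (_ : y `^ (1 - a) * (B `^ a * J n `^ a * `|t - t'| `^ a) =
     B `^ a * (y `^ (1 - a) * J n `^ a) * `|t - t'| `^ a); last by ring.
  by rewrite ler_wpM2r ?powR_ge0// ler_wpM2l.
rewrite ler_wpM2r ?powR_ge0// ler_wpM2l//.
rewrite !big_split/=; exact: lerD (lerD h1 h2) hp.
Qed.

(** 2C for the modulus in space, 2C for the phases e^(itn^3) in time, and the rest from
    [v_holder]. *)
Definition Chol : R := 4 * C + B `^ a * (C + C + (1 + 2 * (1 + (1 - 3 * a)^-1))).

Lemma trig_om_time N t t' x : `|t| <= T -> `|t'| <= T ->
  normc (trig N (om ^~ t) x - trig N (om ^~ t') x) <= (Chol - 2 * C) * `|t - t'| `^ a.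
Proof.
move=> tT t'T.
have -> : (Chol - 2 * C) * `|t - t'| `^ a = 2 * C * `|t - t'| `^ a +
  (B `^ a * (C + C + (1 + 2 * (1 + (1 - 3 * a)^-1)))) * `|t - t'| `^ a.
  by rewrite /Chol; ring.
apply: le_trans (lerD (ler_wpM2r (powR_ge0 _ _) (ler_wpM2l _ (hC N tT))) (v_holder N tT t'T)) => //.
rewrite /trig -sumrB; apply: le_trans (normc_sum _ _ _) _.
rewrite mulr_sumr mulr_suml -big_split/=; apply: ler_sum => n _.
rewrite -mulrBl Normc.normcM normc_cis mulr1.
have -> : om n t - om n t' = (ph (n ^+ 3) t - ph (n ^+ 3) t') * (v n t - v n 0) +
   ph (n ^+ 3) t' * (v n t - v n t') by rewrite /om; ring.
apply: le_trans (normcD _ _) _; apply: lerD; last first.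
  by rewrite Normc.normcM normc_ph mul1r.
rewrite Normc.normcM.
have := normc_cis_holder ((n ^+ 3)%:~R * t) ((n ^+ 3)%:~R * t') a0' a1.
rewrite -mulrBr normrM powRM// => h2.
have h3 : `|(n ^+ 3)%:~R| `^ a <= J n `^ (3 * a).
  have -> : `|(n ^+ 3)%:~R : R| = `|n%:~R| `^ 3.
    by rewrite -[3]/(3%:R) powR_mulrn// rmorphXn normrX.
  by rewrite -powRrM; apply: ge0_ler_powR; rewrite ?nnegrE ?J_ge0 ?le_J ?mulr_ge0.
apply: (@le_trans _ _ (2 * (`|(n ^+ 3)%:~R| `^ a * `|t - t'| `^ a) * normc (v n t - v n 0))).
  by rewrite ler_wpM2r ?normc_ge0.
apply: (@le_trans _ _ (2 * (J n `^ (3 * a) * `|t - t'| `^ a) * normc (v n t - v n 0))).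
  by rewrite ler_wpM2r ?normc_ge0// ler_wpM2l// ler_wpM2r ?powR_ge0.
by rewrite le_eqVlt; apply/orP; left; apply/eqP; ring.
Qed.

Lemma trig_om_holder N (p p' : R * R) : `|p.1| <= T -> `|p'.1| <= T ->
  `|Re (trig N (om ^~ p.1) p.2) - Re (trig N (om ^~ p'.1) p'.2)| <= Chol * `|p - p'| `^ a.
Proof.
case: p p' => t x [t' x'] /= tT t'T.
have C0 : 0 <= C by apply: le_trans (om_sum_le 0 tT); apply: sumr_ge0 => n _; exact: normc_ge0.
have a3 : 0 < 1 - 3 * a by move: a13 => h; lra.
have D0 : 0 <= Chol - 2 * C.
  rewrite (_ : Chol - 2 * C = 2 * C + B `^ a * (C + C + (1 + 2 * (1 + (1 - 3 * a)^-1)))); last first.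
    by rewrite /Chol; ring.
  have : 0 <= (1 - 3 * a)^-1 by rewrite invr_ge0 ltW.
  move=> h; rewrite addr_ge0 ?mulr_ge0 ?powR_ge0//; lra.
have m1 : `|t - t'| <= `|((t, x) - (t', x') : R * R)|.
  by rewrite prod_normE/= le_max lexx.
have m2 : `|x - x'| <= `|((t, x) - (t', x') : R * R)|.
  by rewrite prod_normE/= le_max lexx orbT.
set m := `|((t, x) - (t', x') : R * R)| in m1 m2 *.
have m0 : 0 <= m := le_trans (normr_ge0 _) m1.
have q1 : `|t - t'| `^ a <= m `^ a by apply: ge0_ler_powR; rewrite ?nnegrE.
have q2 : `|x - x'| `^ a <= m `^ a by apply: ge0_ler_powR; rewrite ?nnegrE.
have -> : Re (trig N (om ^~ t) x) - Re (trig N (om ^~ t') x') =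
  Re ((trig N (om ^~ t) x - trig N (om ^~ t) x') + (trig N (om ^~ t) x' - trig N (om ^~ t') x')).
  by rewrite addrA subrK Re_add Re_opp.
apply: le_trans (normc_Re _) _; apply: le_trans (normcD _ _) _.
rewrite (_ : Chol * m `^ a = 2 * C * m `^ a + (Chol - 2 * C) * m `^ a); last by ring.
apply: lerD.
  by apply: le_trans (trig_om_space N x x' tT) _; rewrite ler_wpM2l ?mulr_ge0.
by apply: le_trans (trig_om_time N x' tT t'T) _; rewrite ler_wpM2l.
Qed.

End holder.

Section trig_limit.
Context {R : realType}.
Local Notation normc := (@Normc.normc R).
Local Notation Re := (@complex.Re R).

(** Pairing n with -n turns the symmetric partial sums into an ordinary absolutely convergent
    series. *)
Lemma Re_trig_cvg (c : int -> R[i]) C x :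
  (forall N, \sum_(n <- zr N) normc (c n) <= C) ->
  cvgn (fun N => Re (trig N c x)).
Proof.
move=> hC; pose F n := Re (c n * cis (n%:~R * x)).
pose u k := F k.+1%:Z + F (- k.+1%:Z).
have E : (fun N => Re (trig N c x)) = (fun N => F 0 + series u N).
  by apply/funext => N; rewrite /trig Re_sum sum_zr_split /series/= big_mkord.
rewrite E; apply: is_cvgD; first exact: is_cvg_cst.
apply: normed_cvg; apply: nondecreasing_is_cvgn.
  by apply: nondecreasing_series => n _ _; exact: normr_ge0.
exists C => _ [N _ <-]; apply: le_trans (hC N).
have -> : [normed series u] N = \sum_(k < N) `|u k|.
  by rewrite -(big_mkord xpredT (fun k => `|u k|)).
rewrite sum_zr_split.
apply: (@le_trans _ _ (\sum_(k < N) (normc (c k.+1%:Z) + normc (c (- k.+1%:Z))))).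
  apply: ler_sum => k _; apply: le_trans (ler_normD _ _) _.
  apply: lerD; apply: le_trans (normc_Re _) _.
    by rewrite Normc.normcM normc_cis mulr1.
  by rewrite Normc.normcM normc_cis mulr1.
by rewrite lerDr normc_ge0.
Qed.

Lemma lim_norm_le (s : nat -> R) (l C : R) : s @ \oo --> l -> (forall N, `|s N| <= C) -> `|l| <= C.
Proof.
move=> sl sC; have h : `|s N| @[N --> \oo] --> `|l| by apply: cvg_norm.
rewrite -(cvg_lim _ h)//; apply: limr_le; first by apply/cvg_ex; exists `|l|.
by apply: nearW => N; exact: sC.
Qed.

End trig_limit.

(** * Fourier coefficients of a KdV solution *)

Section fourier_of_kdv.
Context {R : realType}.
Local Notation normc := (@Normc.normc R).
Local Notation Re := (@complex.Re R).
Local Notation Im := (@complex.Im R).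
Local Notation I := (@circle R).
Implicit Types (f g : R -> R).

Lemma sobolev_fin_le s f N M : (sobolev_sqnorm s f <= M%:E)%E ->
  \sum_(n <- zr N) (1 + (n%:~R : R) ^+ 2) `^ s * sqnormc (fourier f n) <= M.
Proof.
move=> h; rewrite -lee_fin; apply: le_trans h; apply: esum_ge.
exists [set` zr N].
  by split => //; exact: finite_seq.
by rewrite -fsbig_seq ?zr_uniq// sumEFin.
Qed.

Lemma fourierE f n : fourier f n = Complex ((2 * pi)^-1 * ir (fun x => f x * cos (n%:~R * x)))
   (- ((2 * pi)^-1 * ir (fun x => f x * sin (n%:~R * x)))).
Proof. by []. Qed.

Lemma fourierB f g n : sqi f -> sqi g ->
  fourier (fun x => f x - g x) n = fourier f n - fourier g n.
Proof.
move=> hf hg; have hc := @sqi_cos R n; have hs := @sqi_sin R n.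
rewrite !fourierE; apply: complex_eq; rewrite ?Re_add ?Im_add ?Re_opp ?Im_opp /=.
  rewrite -mulrBr -irB; [|exact: sqi_mul|exact: sqi_mul].
  by congr (_ * _); apply: eq_ir => x _; rewrite mulrBl.
rewrite opprK addrC -mulrBr -mulrN -irN; last first.
  by apply: sqi_mul => //; exact: sqiB.
rewrite -irB; [|exact: sqi_mul|exact: sqi_mul].
by congr (_ * _); apply: eq_ir => x _; ring.
Qed.

Lemma fourierN f n : sqi f -> fourier f (- n) = conjc (fourier f n).
Proof.
move=> hf; rewrite !fourierE; apply: complex_eq => /=.
  by congr (_ * _); apply: eq_ir => x _; rewrite mulrNz mulNr cosN.
rewrite opprK -mulrN -irN; last by apply: sqi_mul => //; exact: sqi_sin.
by congr (_ * _); apply: eq_ir => x _; rewrite mulrNz mulNr sinN; ring.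
Qed.

Lemma ig_sq_mul f (b : R -> R) : sqi f -> measurable_fun I b ->
  (forall x, I x -> `|b x| <= 1) -> ig (fun x => f x ^+ 2 * b x).
Proof.
move=> hu mb hb; apply: (@ig_le _ _ (fun x => f x ^+ 2)); last exact: hu.2.
  by apply: measurable_funM => //; apply: measurable_funX; exact: hu.1.
by move=> x Ix; rewrite normrM (ger0_norm (sqr_ge0 _)) ler_piMr ?sqr_ge0 ?hb.
Qed.

(** A family of test functions closed under differentiation that contains both components of
    e^(-inx). *)
Definition trigfun (a b : R) (n : int) (x : R) : R :=
  a * cos (n%:~R * x) + b * sin (n%:~R * x).

Lemma is_derive_trigfun a b n (x : R) :
  is_derive x 1 (trigfun a b n) (trigfun (b * n%:~R) (- a * n%:~R) n x).
Proof.
rewrite /trigfun; apply: is_derive_eq; rewrite /GRing.scale/=; ring.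
Qed.

Lemma derive1_trigfun a b n :
  derive1 (trigfun a b n) = trigfun (b * n%:~R) (- a * n%:~R) n.
Proof.
apply/funext => x; rewrite derive1E.
have h := is_derive_trigfun a b n x; exact: (@derive_val _ _ _ _ _ _ _ h).
Qed.

Lemma test_trigfun a b n : test_function (trigfun a b n).
Proof.
split.
  move=> x; have e := cis_int_2pi n.
  have : cis (n%:~R * (x + 2 * pi)) = cis (n%:~R * x) :> R[i].
    by rewrite mulrDr cisD e mulr1.
  by rewrite /trigfun => -[-> ->].
move=> k x.
have [a' [b' ->]] : exists a' b', derive1n k (trigfun a b n) = trigfun a' b' n.
  elim: k => [|k [a' [b' IH]]]; first by exists a, b.
  by rewrite derive1nS IH derive1_trigfun; do 2 eexists.
by have := is_derive_trigfun a' b' n x => -[].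
Qed.

Context (u : R -> R -> R).
Context (hu : continuous_Hminus (1 / 2) u).
Context (hkdv : kdv_equation u).

Definition U n t : R[i] := fourier (u t) n.
Definition W n t : R[i] := fourier (fun x => u t x ^+ 2) n.

Lemma half_gt0 : (0 : R) < 1 / 2. Proof. by rewrite divr_gt0. Qed.

Lemma sqi_u t : sqi (u t).
Proof. by apply: in_L2_sqi; have [] := hu.1 t 0 (lexx _) half_gt0. Qed.

Lemma sqi_trigfun a b n : sqi (trigfun a b n).
Proof. by apply: sqiD; apply: sqiZ; [exact: sqi_cos|exact: sqi_sin]. Qed.

Lemma ir_trigfun f a b n : ig (fun x => f x * cos (n%:~R * x)) ->
  ig (fun x => f x * sin (n%:~R * x)) ->
  ir (fun x => f x * trigfun a b n x) =
  a * ir (fun x => f x * cos (n%:~R * x)) + b * ir (fun x => f x * sin (n%:~R * x)).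
Proof.
move=> hc hs; rewrite -!irZ// -irD; [|exact: igZ|exact: igZ].
by apply: eq_ir => x _; rewrite /trigfun; ring.
Qed.

Lemma ig_sq_cos f n : sqi f -> ig (fun x => f x ^+ 2 * cos (n%:~R * x)).
Proof.
move=> hf; apply: ig_sq_mul => //; first exact: measurable_cos_int.
by move=> x _; rewrite ler_norml cos_geN1 cos_le1.
Qed.

Lemma ig_sq_sin f n : sqi f -> ig (fun x => f x ^+ 2 * sin (n%:~R * x)).
Proof.
move=> hf; apply: ig_sq_mul => //; first exact: measurable_sin_int.
by move=> x _; rewrite ler_norml sin_geN1 sin_le1.
Qed.

Lemma kdv_pairing (a b : R) (n : int) (t : R) :
  is_derive t 1 (fun tau : R => ir (fun x => u tau x * trigfun a b n x))
    (- b * n%:~R ^+ 3 * ir (fun x => u t x * cos (n%:~R * x)) +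
     a * n%:~R ^+ 3 * ir (fun x => u t x * sin (n%:~R * x)) +
     2^-1 * (b * n%:~R * ir (fun x => u t x ^+ 2 * cos (n%:~R * x)) -
             a * n%:~R * ir (fun x => u t x ^+ 2 * sin (n%:~R * x)))).
Proof.
have := hkdv (test_trigfun a b n) t.
rewrite /derive1n /= !derive1_trigfun => h; apply: is_derive_eq h _.
have su := sqi_u t.
have i1 : ig (fun x => u t x * cos (n%:~R * x)) by apply: sqi_mul => //; exact: sqi_cos.
have i2 : ig (fun x => u t x * sin (n%:~R * x)) by apply: sqi_mul => //; exact: sqi_sin.
have i3 := ig_sq_cos n su; have i4 := ig_sq_sin n su.
pose d := b * n%:~R; pose e := - a * n%:~R : R.
transitivity (ir (fun x => u t x * trigfun (d * n%:~R * n%:~R * -1) (- (e * n%:~R * n%:~R)) n x) +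
   2^-1 * ir (fun x => u t x ^+ 2 * trigfun d e n x)); last first.
  rewrite !ir_trigfun// /d /e; ring.
rewrite -irZ; last first.
  have -> : (fun x => u t x ^+ 2 * trigfun d e n x) =
     (fun x => d * (u t x ^+ 2 * cos (n%:~R * x)) + e * (u t x ^+ 2 * sin (n%:~R * x))).
    by apply/funext => x; rewrite /trigfun; ring.
  by apply: igD; exact: igZ.
rewrite -irD; last 2 first.
- by apply: sqi_mul => //; exact: sqi_trigfun.
- apply: igZ; have -> : (fun x => u t x ^+ 2 * trigfun d e n x) =
     (fun x => d * (u t x ^+ 2 * cos (n%:~R * x)) + e * (u t x ^+ 2 * sin (n%:~R * x))).
    by apply/funext => x; rewrite /trigfun; ring.
  by apply: igD; exact: igZ.
apply: eq_ir => x _; rewrite /trigfun /d /e; ring.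
Qed.

Lemma cderiv_U n t : cderiv (U n) t (iC * n%:~R ^+ 3 * U n t - iC * n%:~R / 2 * W n t).
Proof.
have p0 : 2 * pi != 0 :> R by rewrite gt_eqF ?two_pi_gt0.
have hz : iC * n%:~R ^+ 3 * U n t - iC * n%:~R / 2 * W n t =
  Complex ((2 * pi)^-1 * (n%:~R ^+ 3 * ir (fun x => u t x * sin (n%:~R * x)) -
      2^-1 * (n%:~R * ir (fun x => u t x ^+ 2 * sin (n%:~R * x)))))
    ((2 * pi)^-1 * (n%:~R ^+ 3 * ir (fun x => u t x * cos (n%:~R * x)) -
      2^-1 * (n%:~R * ir (fun x => u t x ^+ 2 * cos (n%:~R * x))))).
  rewrite /U /W !fourierE.
  have -> : (n%:~R : R[i]) = Complex n%:~R 0.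
    by apply: complex_eq; rewrite ?Re_int ?Im_int.
  have -> : (2^-1 : R[i]) = Complex 2^-1 0.
    have -> : (2 : R[i]) = ((2 : R)%:C)%C by rewrite rmorph_nat.
    by rewrite -fmorphV.
  by apply: complex_eq; rewrite !exprS expr0 mulr1 ?Re_add ?Im_add ?Re_opp ?Im_opp !(Re_mul, Im_mul) /=; ring.
rewrite hz; split.
  have h := kdv_pairing 1 0 n t.
  have h' := @is_deriveZ _ _ _ _ (2 * pi)^-1 _ _ _ h.
  rewrite [X in is_derive _ _ X](_ : _ = (2 * pi)^-1 *: (fun tau : R => ir (fun x => u tau x * trigfun 1 0 n x))).
    by apply: is_derive_eq h' _; rewrite /GRing.scale/=; ring.
  apply/funext => x; rewrite /U fourierE /=; congr (_ * _); apply: eq_ir => y _.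
  by rewrite /trigfun; ring.
have h := kdv_pairing 0 (-1) n t.
have h' := @is_deriveZ _ _ _ _ (2 * pi)^-1 _ _ _ h.
rewrite [X in is_derive _ _ X](_ : _ = (2 * pi)^-1 *: (fun tau : R => ir (fun x => u tau x * trigfun 0 (-1) n x))).
  by apply: is_derive_eq h' _; rewrite /GRing.scale/=; ring.
apply/funext => x; rewrite /U fourierE /= -mulrN -irN; last first.
  by apply: sqi_mul; [exact: sqi_u|exact: sqi_sin].
by congr (_ * _); apply: eq_ir => y _; rewrite /trigfun; ring.
Qed.

(** Continuity at [t0] makes the squared distance at most 1 nearby, and the triangle inequality for
    squares costs the factors 2. *)
Lemma U_local_bound (s : R) (t0 : R) : 0 <= s -> s < 1 / 2 -> exists M : R,
  \forall t \near t0, forall N,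
    \sum_(n <- zr N) (1 + (n%:~R : R) ^+ 2) `^ s * sqnormc (U n t) <= M.
Proof.
move=> s0 s12.
have [_ fin0] := hu.1 t0 s s0 s12.
have pos f : (0 <= sobolev_sqnorm s f)%E.
  apply: esum_ge0 => n _; rewrite lee_fin mulr_ge0 ?powR_ge0//; exact: sqnormc_ge0.
have A0 : (sobolev_sqnorm s (u t0) <= (fine (sobolev_sqnorm s (u t0)))%:E)%E.
  by rewrite fineK// ge0_fin_numE.
exists (2 * fine (sobolev_sqnorm s (u t0)) + 2).
have /fine_cvgP[hfin /cvgrPdist_lt/(_ 1 ltr01)] := hu.2 s s0 s12 t0.
move: hfin; apply: filterS2 => t tfin t1 N.
have B1 : (sobolev_sqnorm s (fun x => (u t x - u t0 x)%R) <= 1%:E)%E.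
  rewrite -(fineK tfin) lee_fin; move: t1; rewrite sub0r normrN.
  by move=> /ltW; apply: le_trans; exact: ler_norm.
have h1 := sobolev_fin_le N A0; have h2 := sobolev_fin_le N B1.
have h3 : 2 * fine (sobolev_sqnorm s (u t0)) + 2 =
   2 * fine (sobolev_sqnorm s (u t0)) + 2 * 1 by rewrite mulr1.
rewrite h3; apply: le_trans (lerD (ler_wpM2l _ h1) (ler_wpM2l _ h2)) => //.
rewrite !mulr_sumr -big_split/=; apply: ler_sum => n _.
rewrite fourierB; [|exact: sqi_u|exact: sqi_u].
rewrite -/(U n t) -/(U n t0) mulrCA [2 * (_ * _)]mulrCA -mulrDr.
apply: ler_wpM2l; first exact: powR_ge0.
rewrite /sqnormc Re_add Im_add Re_opp Im_opp.
move: (Re (U n t)) (Im (U n t)) (Re (U n t0)) (Im (U n t0)) => a b a' b'.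
have := sqr_ge0 (2 * a' - a); have := sqr_ge0 (2 * b' - b); nra.
Qed.

Lemma U_bound (s T : R) : 0 <= s -> s < 1 / 2 -> exists M : R, forall N t, `|t| <= T ->
  \sum_(n <- zr N) J n `^ (2 * s) * normc (U n t) ^+ 2 <= M.
Proof.
move=> s0 s12.
pose P (k : nat) (t : R) := forall N,
    \sum_(n <- zr N) (1 + (n%:~R : R) ^+ 2) `^ s * sqnormc (U n t) <= k%:R.
have K : compact [set` `[- T, T]%R] := @segment_compact R (- T) T.
(* The local bounds hold for all t near a point and all large k at once, so compactness of [-T, T]
   yields a single k. *)
have /(_ nat \oo P _)[] := (compact_near_coveringP _).1 K.
  move=> x _; have [M hM] := U_local_bound x s0 s12.
  exists ([set t | forall N, \sum_(n <- zr N) (1 + (n%:~R : R) ^+ 2) `^ s * sqnormc (U n t) <= M],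
     [set k : nat | M <= k%:R]).
    by split => //=; exact: nbhs_infty_ger.
  by move=> [t k] /= [h1 h2] N; apply: le_trans (h1 N) h2.
move=> k _ /(_ k (leqnn k)) h; exists k%:R => N t tT.
rewrite (eq_bigr (fun n => J n `^ (2 * s) * sqnormc (U n t))); last first.
  by move=> n _; rewrite normc_sqr.
have := h t; rewrite /= in_itv/= -ler_norml => /(_ tT N).
apply: le_trans; apply: ler_sum => n _.
apply: ler_wpM2r; first exact: sqnormc_ge0.
rewrite powRrM; apply: ge0_ler_powR => //; rewrite ?nnegrE ?powR_ge0 ?addr_ge0 ?sqr_ge0//.
rewrite -[2]/(2%:R) powR_mulrn ?J_ge0// /J /Num.max.
case: ifP => _; last by rewrite expr1n lerDl sqr_ge0.
by rewrite real_normK ?num_real// lerDr.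
Qed.

End fourier_of_kdv.

(** * The interaction representation of a KdV solution *)

Section profile.
Context {R : realType}.
Local Notation normc := (@Normc.normc R).
Local Notation Re := (@complex.Re R).
Local Notation Im := (@complex.Im R).
Local Notation I := (@circle R).
Context (u : R -> R -> R).
Context (hu : continuous_Hminus (1 / 2) u).
Context (hkdv : kdv_equation u).

Definition V n t : R[i] := ph (- n ^+ 3) t * U u n t.
Definition dV n t : R[i] := ph (- n ^+ 3) t * (- (iC * n%:~R / 2 * W u n t)).

Lemma normc_V n t : normc (V n t) = normc (U u n t).
Proof. by rewrite Normc.normcM normc_ph mul1r. Qed.

Lemma V_at0 n : V n 0 = U u n 0.
Proof. by rewrite /V /ph mulr0 cis0 mul1r. Qed.

Lemma cderiv_V n t : cderiv (V n) t (dV n t).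
Proof.
apply: cderiv_eq (cderivM (cderiv_ph (- n ^+ 3) t) (cderiv_U hu hkdv n t)) _.
rewrite /dV rmorphN rmorphXn /=.
move: (ph _ t) (U u n t) (W u n t) => p a b; ring.
Qed.

Lemma VN (n : int) t : V (- n) t = conjc (V n t).
Proof.
rewrite /V /U fourierN; last exact: sqi_u.
rewrite rmorphM /=; congr (_ * _).
have e : - (- n) ^+ 3 = - (- n ^+ 3) by ring.
by rewrite e /ph mulrNz mulNr cisN.
Qed.

Lemma sum_tail_le (s : R) (F : int -> R) K N : 0 <= s -> (forall n, 0 <= F n) ->
  \sum_(n <- zr N) F n <=
  \sum_(n <- zr K) F n + K.+1%:R `^ (- s) * \sum_(n <- zr N) J n `^ s * F n.
Proof.
move=> s0 F0; rewrite (bigID (fun n : int => (`|n| <= K)%N)) /=; apply: lerD.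
  apply: (@sum_inj_le _ _ _ _ _ _ id) => //; try exact: zr_uniq.
  by move=> n _; rewrite mem_zr.
rewrite mulr_sumr big_mkcond/=; apply: ler_sum => n _; case: ifPn => [|_]; last first.
  by rewrite !mulr_ge0 ?powR_ge0.
rewrite -ltnNge => nK; rewrite mulrA ler_peMl//.
rewrite powRN -ler_pdivrMl ?invr_gt0 ?powR_gt0// invrK mulr1.
apply: ge0_ler_powR; rewrite ?nnegrE ?J_ge0//.
apply: le_trans (le_J _); rewrite -intr_norm; rewrite -[K.+1%:R]/(K.+1%:Z%:~R) ler_int; lia.
Qed.

(** By [parseval] the defect tends to 0, so at K it is 2 pi times the sum of the squared
    coefficients beyond K, and there the weight J^s gains (K+1)^-s. *)
Lemma pdefect_tail f (s M : R) K : sqi f -> 0 <= s ->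
  (forall N, \sum_(n <- zr N) J n `^ s * normc (fourier f n) ^+ 2 <= M) ->
  pdefect f K <= 2 * pi * (K.+1%:R `^ (- s) * M).
Proof.
move=> hf s0 hM; apply/ler_addgt0Pr => e e0.
have [N0 hN0] := parseval hf e0.
have {}hN0 : pdefect f (maxn N0 K) <= e.
  by apply: le_trans hN0; apply: pdefect_le; rewrite leq_maxl.
have h := sum_tail_le K (maxn N0 K) s0 (fun n => sqnormc_ge0 (fourier f n)).
have h2 : K.+1%:R `^ (- s) * \sum_(n <- zr (maxn N0 K)) J n `^ s * sqnormc (fourier f n)
    <= K.+1%:R `^ (- s) * M.
  rewrite ler_wpM2l ?powR_ge0//; apply: le_trans (hM (maxn N0 K)).
  by under eq_bigr do rewrite -normc_sqr.
have := ler_wpM2l (ltW (@two_pi_gt0 R)) (le_trans h (lerD (lexx _) h2)).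
move: hN0; rewrite /pdefect mulrDr; lra.
Qed.

(** The choice s = 1/4, inside the admissible range, gives the decay K^(-1/2). The defect at K = 0
    plus the zero coefficient recovers the L^2 norm. *)
Lemma U_sq_bound (T : R) : exists2 M : R, 0 <= M & forall t, `|t| <= T ->
  ir (fun x => u t x ^+ 2) <= M /\
  forall K, pdefect (u t) K <= K.+1%:R `^ (- (1 / 2)) * M.
Proof.
have s0 : 0 <= 1 / 4 :> R by rewrite divr_ge0.
have s1 : 1 / 4 < 1 / 2 :> R by lra.
have e2 : 2 * (1 / 4) = 1 / 2 :> R by field.
have [M hM] := U_bound hu T s0 s1; rewrite e2 in hM.
have p0 := @two_pi_gt0 R.
have s2 : 0 <= 1 / 2 :> R by rewrite divr_ge0.
exists (2 * pi * (2 * `|M|)) => [|t tT].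
  by rewrite mulr_ge0 ?(ltW p0)// mulr_ge0.
have tail := pdefect_tail _ (sqi_u hu t) s2 (fun N => hM N t tT).
have Mn := ler_norm M.
split=> [|K]; last first.
  apply: le_trans (tail K) _; rewrite mulrCA ler_wpM2l ?powR_ge0// ler_wpM2l ?(ltW p0)//.
  by have := normr_ge0 M; lra.
have h0 := tail 0%N; rewrite powR1 mul1r in h0.
have h1 := le_trans (weight_ge 0%N s2 (fun n => sqr_ge0 (normc (U u n t)))) (hM 0%N t tT).
have h2 : 2 * pi * (\sum_(n <- zr 0) sqnormc (U u n t)) <= 2 * pi * M.
  rewrite ler_wpM2l ?(ltW p0)//; apply: le_trans h1.
  by under [leRHS]eq_bigr do rewrite normc_sqr.
have h3 := ler_wpM2l (ltW p0) Mn.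
move: h0; rewrite /pdefect -/(U u) => h0.
by move: h2; rewrite /U => h2; lra.
Qed.

Lemma rem_V K n t : rem V dV K n t = ph (- n ^+ 3) t * (- (iC * n%:~R / 2)) *
  (W u n t - \sum_(k <- zr K | (`|(n - k)%R| <= K)%N) U u k t * U u (n - k) t).
Proof.
rewrite /rem /qsum /dV.
have -> : \sum_(k <- zr K | cut K n k) ph (- (3 * (k * (n - k) * n))) t * (V k t * V (n - k) t) =
  ph (- n ^+ 3) t * \sum_(k <- zr K | (`|(n - k)%R| <= K)%N) U u k t * U u (n - k) t.
  rewrite mulr_sumr; apply: eq_bigr => k _; rewrite /V.
  have -> : - n ^+ 3 = - (3 * (k * (n - k) * n)) + (- k ^+ 3 + - (n - k) ^+ 3) by ring.
  rewrite [in RHS]phD [in RHS]phD.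
  move: (ph _ t) (ph _ t) (ph _ t) (U u k t) (U u (n - k) t) => a b c d e; ring.
move: (ph _ t) (W u n t) (\sum_(k <- _ | _) _) => a b c; ring.
Qed.

Lemma normc_half_int (n : int) : normc (- (iC * n%:~R / 2)) = `|n%:~R| / 2.
Proof. by rewrite normcN !Normc.normcM normc_i mul1r normc_int normc_natV. Qed.

Lemma rem_V_small (T e : R) : 0 < e -> exists K0 : nat, forall K n t,
  (K0 <= K)%N -> `|t| <= T -> normc (rem V dV K n t) <= `|n%:~R| * e.
Proof.
move=> e0; have [M M0 hM] := U_sq_bound T.
(* [l] is fixed first, so that the part of [conv_fourier_le] without the defect is at most [e]; then
   [K] makes the defect part at most [e]. The square in [X] undoes the decay K^(-1/2). *)
pose l := 1 + 8 * M / e; have l1 : 1 <= l by rewrite lerDl divr_ge0 ?mulr_ge0 ?(ltW e0).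
have l0 : 0 < l by exact: lt_le_trans l1.
pose X := ((l + 2) * M / e) ^+ 2.
exists (Num.bound X) => K n t KK tT.
have [hM1 hM2] := hM t tT.
rewrite rem_V !Normc.normcM normc_ph mul1r normc_half_int.
rewrite -mulrA ler_wpM2l// ler_pdivrMl//.
apply: le_trans (conv_fourier_le n K (sqi_u hu t) l1) _.
have -> : 2 * e = e + e by ring.
apply: lerD.
  apply: (@le_trans _ _ ((l + 2) * (K.+1%:R `^ (- (1 / 2)) * M))).
    by rewrite ler_wpM2l//; lra.
  rewrite powRN mulrCA ler_pdivrMl ?powR_gt0// -ler_pdivrMr//.
  have Y0 : 0 <= (l + 2) * M / e by rewrite !mulr_ge0 ?invr_ge0 ?(ltW e0)//; lra.
  have -> : (l + 2) * M / e = X `^ (1 / 2).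
    rewrite /X -[_ ^+ 2]powR_mulrn// -powRrM.
    by rewrite (_ : 2%:R * (1 / 2) = 1) ?powRr1//; field.
  apply: ge0_ler_powR; rewrite ?nnegrE ?sqr_ge0 ?divr_ge0//.
  apply: le_trans (ltW (archi_boundP (sqr_ge0 _))) _; rewrite ler_nat; exact: leqW.
apply: (@le_trans _ _ (8 * M / l)).
  by rewrite ler_wpM2r ?invr_ge0 ?(ltW l0)// ler_wpM2l.
rewrite ler_pdivrMr// /l mulrDr mulr1.
rewrite (_ : e * (8 * M / e) = 8 * M); last by field; rewrite gt_eqF.
by rewrite lerDr ltW.
Qed.

Lemma normc_le_ReIm (z : R[i]) : normc z <= `|Re z| + `|Im z|.
Proof.
case: z => a b; rewrite /= -(ler_pXn2r (n := 2)) ?nnegrE ?sqrtr_ge0 ?addr_ge0//.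
rewrite sqr_sqrtr ?addr_ge0 ?sqr_ge0//.
rewrite -(real_normK (num_real a)) -(real_normK (num_real b)).
have := mulr_ge0 (normr_ge0 a) (normr_ge0 b); nra.
Qed.

Lemma V_lipschitz (T : R) : exists2 B : R, 0 <= B & forall n t t',
  `|t| <= T -> `|t'| <= T -> normc (V n t - V n t') <= B * `|n%:~R| * `|t - t'|.
Proof.
have [M M0 hM] := U_sq_bound T.
pose B := (2 * pi)^-1 * M.
have p0 : 0 <= (2 * pi)^-1 :> R by rewrite invr_ge0 ltW ?two_pi_gt0.
have B0 : 0 <= B by rewrite mulr_ge0.
exists B => // n t t' tT t'T.
apply: (cderiv_lipschitz (cderiv_V n) _ tT t'T) => {t t' tT t'T} t tT.
have su := sqi_u hu t.
have part (b : R -> R) : measurable_fun I b -> (forall x, I x -> `|b x| <= 1) ->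
    `|(2 * pi)^-1 * ir (fun x => u t x ^+ 2 * b x)| <= B.
  move=> mb hb; rewrite normrM (ger0_norm p0) ler_wpM2l//.
  have ib := ig_sq_mul su mb hb.
  apply: le_trans (ir_norm ib) _; apply: le_trans (hM t tT).1.
  apply: ir_le; [exact: ig_norm|exact: su.2|] => x Ix.
  by rewrite normrM (ger0_norm (sqr_ge0 _)) ler_piMr ?sqr_ge0 ?hb.
rewrite /dV Normc.normcM normc_ph mul1r normcN Normc.normcM -normcN normc_half_int.
suff : normc (W u n t) <= 2 * B.
  by move=> h; apply: le_trans (ler_wpM2l _ h) _; rewrite ?divr_ge0//; lra.
rewrite /W fourierE; apply: le_trans (normc_le_ReIm _) _ => /=.
rewrite normrN (_ : 2 * B = B + B); last by ring.
apply: lerD; apply: part.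
- exact: measurable_cos_int.
- by move=> x _; rewrite ler_norml cos_geN1 cos_le1.
- exact: measurable_sin_int.
- by move=> x _; rewrite ler_norml sin_geN1 sin_le1.
Qed.


(** Every spatial term of the equation is an x-derivative, so its zero coefficient vanishes. This
    propagates mean zero data to all times, which supplies the assumption [v0] of the normal
    form. *)
Lemma U_mean_cst t : U u 0 t = U u 0 0.
Proof.
have h x : cderiv (U u 0) x 0.
  by apply: cderiv_eq (cderiv_U hu hkdv 0 x) _; rewrite mulr0z expr0n/= !(mulr0, mul0r) subr0.
apply: complex_eq.
  by apply: (@is_derive_0_is_cst _ (fun x => Re (U u 0 x))) => x; case: (h x).
by apply: (@is_derive_0_is_cst _ (fun x => Im (U u 0 x))) => x; case: (h x).
Qed.

Context (U00 : U u 0 0 = 0).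

Lemma V_smoothing (T b : R) : 0 <= T -> b < 1 -> exists C : R, forall N t, `|t| <= T ->
  \sum_(n <- zr N) J n `^ b * normc (V n t - V n 0) <= C.
Proof.
move=> T0 b1; apply: (smoothing _ cderiv_V VN T0 _ _ b1) => [t|s s0 s1|e e0].
- by rewrite /V U_mean_cst U00 mulr0.
- have [M hM] := U_bound hu T s0 s1; exists M => N t tT.
  by under eq_bigr do rewrite normc_V; exact: hM.
- exact: rem_V_small.
Qed.

(** The representative of the nonlinear part defined at every (t, x), the difference u - q being
    determined only almost everywhere. *)
Definition nonlin (t x : R) : R := limn (fun N => Re (trig N (om V ^~ t) x)).

Lemma nonlin_bound (T : R) : 0 <= T -> exists C : R, forall N t x, `|t| <= T ->
  \sum_(n <- zr N) normc (om V n t) <= C /\ `|Re (trig N (om V ^~ t) x)| <= C.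
Proof.
(* Any exponent below 1/3 serves here; 1/4 is such a choice. *)
move=> T0; have [//|C hC] := @V_smoothing T (3 * (1 / 4)) T0; first by lra.
have a0 : 0 < 1 / 4 :> R by rewrite divr_gt0.
exists C => N t x tT; split; first exact: (om_sum_le a0 hC).
exact: le_trans (normc_Re _) (trig_om_bound a0 hC N x tT).
Qed.

Lemma nonlin_cvg t x : Re (trig N (om V ^~ t) x) @[N --> \oo] --> nonlin t x.
Proof.
have [C hC] := nonlin_bound (normr_ge0 t).
by apply: (@Re_trig_cvg _ _ C) => N; exact: (hC N t 0 (lexx _)).1.
Qed.

Lemma nonlin_periodic t : periodic2pi (nonlin t).
Proof.
move=> x; rewrite /nonlin; congr (limn _); apply/funext => N.
rewrite /trig; congr (Re _); apply: eq_bigr => n _.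
by rewrite mulrDr cisD cis_int_2pi mulr1.
Qed.

Lemma nonlin_holder : holder_minus_loc (1 / 3) nonlin.
Proof.
split=> [|a a0 a13 K Kc]; first exact: nonlin_periodic.
have [T T0 KT] : exists2 T : R, 0 <= T & forall p, K p -> `|p.1| <= T.
  have [M [_ hM]] := compact_bounded Kc.
  have MM : M < `|M| + 1 by rewrite (le_lt_trans (ler_norm M))// ltrDl.
  have hM1 := hM _ MM.
  exists (`|M| + 1) => [|p Kp]; first by rewrite addr_ge0.
  apply: le_trans (hM1 p Kp); by rewrite prod_normE/= le_max lexx.
have [C hC] := nonlin_bound T0.
have [//|C' hC'] := @V_smoothing T (3 * a) T0; first by lra.
have [B B0 hB] := V_lipschitz T.
pose D := `|C| + `|Chol a C' B|.
have hol := trig_om_holder a0 a13 B0 hC' hB.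
exists D; split=> [p Kp|p p' Kp Kp'].
  apply: lim_norm_le (@nonlin_cvg _ _) _ => N; apply: le_trans (hC N _ _ (KT _ Kp)).2 _.
  by rewrite (le_trans (ler_norm _))// lerDl.
apply: lim_norm_le (cvgB (@nonlin_cvg _ _) (@nonlin_cvg _ _)) _ => N.
apply: le_trans (hol N _ _ (KT _ Kp) (KT _ Kp')) _.
by rewrite ler_wpM2r ?powR_ge0// (le_trans (ler_norm _))// lerDr.
Qed.

End profile.

(** * Almost everywhere identification *)

Section almost_everywhere.
Context {R : realType}.
Local Notation mu := (@lebesgue_measure R).
Local Notation I := (@circle R).

Lemma lebesgue_measure_shift (c : R) (A : set (measurableTypeR R)) : measurable A ->
  pushforward mu ((fun x => x + c) : _ -> measurableTypeR R) A = mu A.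
Proof.
move=> mA; apply/esym/lebesgue_measure_unique => //=.
  by apply: measurable_funD.
move=> _ _ [[a b]] _ <-.
have e : (fun x : R => x + c) @^-1` [set` `]a, b]%R] = [set` `]a - c, b - c]%R].
  by apply/seteqP; split => x /=; rewrite !in_itv/= ltrBlDr lerBrDr.
rewrite /pushforward e !lebesgue_measure_itv/= !lte_fin ltrD2r.
by case: ifP => // _; rewrite -!EFinB; congr EFin; ring.
Qed.

Lemma negligible_shift (c : R) (A : set (measurableTypeR R)) :
  mu.-negligible A -> mu.-negligible [set x | A (x + c)].
Proof.
move=> [N [mN N0 AN]]; exists ((fun x : measurableTypeR R => x + c) @^-1` N); split.
- rewrite -[X in measurable X]setTI.
  have m : measurable_fun setT (fun x : measurableTypeR R => x + c) by apply: measurable_funD.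
  exact: m.
- by have := lebesgue_measure_shift c mN; rewrite /pushforward => ->.
- by move=> x; exact: AN.
Qed.

(** Every point is moved into [0, 2 pi] by an integer number of periods, so the exceptional set lies
    in a countable union of translates of a null set. *)
Lemma ae_periodic (f : R -> R) : periodic2pi f ->
  ae_eq mu I (EFin \o f) (cst 0%E) -> {ae mu, forall x, f x = 0}.
Proof.
move=> fp hI.
have p0 := @two_pi_gt0 R.
have fnat (k : nat) x : f (x + k%:R * (2 * pi)) = f x.
  elim: k => [|k IH]; first by rewrite mul0r addr0.
  by rewrite -natr1 mulrDl mul1r addrA fp.
have fint (k : int) x : f (x + k%:~R * (2 * pi)) = f x.
  case: k => k; first exact: fnat.
  by rewrite NegzE mulrNz mulNr -(fnat k.+1) subrK.
pose B := [set x | I x /\ f x <> 0].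
have nB : mu.-negligible B.
  apply: negligibleS hI => x /= [Ix fx] h; apply: fx.
  by have := h Ix => -[].
pose E (k : int) := [set x | B (x + k%:~R * (2 * pi))].
have nU : mu.-negligible (\bigcup_k (E (k%:Z) `|` E (- k%:Z))).
  apply: negligible_bigcup => k; apply: negligibleU; exact: negligible_shift.
apply: negligibleS nU => x /= fx; pose m := Num.floor (x / (2 * pi)).
have Bm : E (- m) x.
  rewrite /E /B /= fint; split => //.
  rewrite /circle /= in_itv /= mulrNz mulNr subr_ge0 lerBlDr.
  have h1 : m%:~R <= x / (2 * pi) by exact: Num.Theory.floor_le.
  have h2 : x / (2 * pi) < (m + 1)%:~R by exact: Num.Theory.floorD1_gt.
  rewrite -ler_pdivlMr// h1/=; move/ltW: h2; rewrite ler_pdivrMr// intrD mulrDl mul1r.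
  by rewrite addrC.
case: (intP m) Bm => [|k|k] Bm.
- by exists 0%N => //; left; move: Bm; rewrite oppr0.
- by exists k.+1 => //; right.
- by exists k.+1 => //; left; move: Bm; rewrite opprK.
Qed.

Lemma ae_eq0_of_ir (f : R -> R) : sqi f -> (forall e, 0 < e -> ir (fun x => f x ^+ 2) <= e) ->
  ae_eq mu I (EFin \o f) (cst 0%E).
Proof.
move=> hf he.
have i0 : ir (fun x => f x ^+ 2) = 0.
  apply/eqP; rewrite eq_le ir_ge0 ?andbT; last by move=> x _; exact: sqr_ge0.
  by apply/ler_addgt0Pr => e e0; rewrite add0r; exact: he.
have fin : (\int[mu]_(x in I) (f x ^+ 2)%:E \is a fin_num)%E.
  by apply: (integrable_fin_num _ hf.2); exact: measurable_circle.
have z : (\int[mu]_(x in I) `| (f x ^+ 2)%:E | = 0)%E.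
  under eq_integral do rewrite gee0_abs ?lee_fin ?sqr_ge0//.
  by rewrite -(fineK fin); congr EFin.
have mf2 : measurable_fun I (fun x => (f x ^+ 2)%:E).
  by apply/measurable_EFinP; apply: measurable_funX; exact: hf.1.
have := (@ae_eq_integral_abs _ _ _ mu I measurable_circle _ mf2).1 z.
apply: filterS => x h Ix; have := h Ix => -[/eqP].
by rewrite sqrf_eq0 => /eqP /= ->.
Qed.

Lemma fourier_ae (f g : R -> R) n : measurable_fun I f -> measurable_fun I g ->
  {ae mu, forall x, f x = g x} -> fourier f n = fourier g n.
Proof.
move=> mf mg fg.
have h (b : R -> R) : measurable_fun I b -> ir (fun x => f x * b x) = ir (fun x => g x * b x).
  move=> mb; rewrite /ir /Rintegral; congr fine; apply: ae_eq_integral.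
  - exact: measurable_circle.
  - by apply/measurable_EFinP; exact: measurable_funM.
  - by apply/measurable_EFinP; exact: measurable_funM.
  - by apply: negligibleS fg => x /= h1 h2; apply: h1 => _; rewrite h2.
by rewrite !fourierE !h//; [exact: measurable_sin_int|exact: measurable_cos_int].
Qed.

Lemma fourier0_eq0 (f : R -> R) : ir f = 0 -> fourier f 0 = 0.
Proof.
move=> f0; rewrite fourierE; apply: complex_eq => /=.
  rewrite (_ : (fun x => _) = f) ?f0 ?mulr0//.
  by apply/funext => x; rewrite mulr0z mul0r cos0 mulr1.
rewrite (_ : (fun x => _) = (fun=> 0)) ?ir0 ?mulr0 ?oppr0//.
by apply/funext => x; rewrite mulr0z mul0r sin0 mulr0.
Qed.

Lemma ir_sq_complex_le (f : R -> R) N c : sqi f ->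
  ir (fun x => (f x - complex.Re (trig N c x)) ^+ 2) <=
  ir (fun x => sqnormc (Complex (f x) 0 - trig N c x)).
Proof.
move=> hf; apply: ir_le.
- exact: (sqiB hf (sqi_trig N c).1).2.
- exact: ig_sqnormc_sub.
- by move=> x _; rewrite /sqnormc Re_add Re_opp lerDl sqr_ge0.
Qed.

Lemma airy_partial_sumE (g : R -> R) N t x :
  airy_partial_sum g N t x = trig N (fun n => ph (n ^+ 3) t * fourier g n) x.
Proof.
rewrite /airy_partial_sum /trig sum_zr; apply: eq_bigr => k _ /=.
rewrite /ph [t * _]mulrC cisD rmorphXn /=; ring.
Qed.

End almost_everywhere.

(** * Identification of the nonlinear part with its Fourier series *)

Section conclusion.
Context {R : realType}.
Local Notation mu := (@lebesgue_measure R).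
Local Notation I := (@circle R).
Local Notation Re := (@complex.Re R).
Context (g : R -> R) (u q : R -> R -> R).
Context (hg : sqi g).
Context (hmean : ir g = 0).
Context (hu : continuous_Hminus (1 / 2) u).
Context (hkdv : kdv_equation u).
Context (hug : {ae mu, forall x, u 0 x = g x}).
Context (hq : airy_evolution g q).

Lemma U_at0 n : U u n 0 = fourier g n.
Proof. by apply: fourier_ae => //; [exact: (sqi_u hu 0).1|exact: hg.1]. Qed.

Lemma U00 : U u 0 0 = 0.
Proof. by rewrite U_at0 fourier0_eq0. Qed.

Lemma om_VE n t : om (V u) n t = U u n t - ph (n ^+ 3) t * fourier g n.
Proof.
by rewrite /om V_at0 U_at0 mulrBr /V mulrA -phD subrr ph0 mul1r.
Qed.

Lemma nonlin_measurable t : measurable_fun I (nonlin u t).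
Proof.
apply: (measurable_fun_cvg (h := fun N x => Re (trig N (om (V u) ^~ t) x))).
  by move=> N; exact: (sqi_trig N _).1.1.
by move=> x _; exact: @nonlin_cvg _ u hu hkdv U00 t x.
Qed.

Lemma airy_L2_cvg t e : 0 < e -> exists N0, forall N, (N0 <= N)%N ->
  ir (fun x => (q t x - Re (airy_partial_sum g N t x)) ^+ 2) <= e.
Proof.
move=> e0; have [qL2 /fine_cvgP[_ /cvgrPdist_lt/(_ e e0)]] := hq t.
move=> [N0 _ hN0]; exists N0 => N NN.
have := hN0 N NN; rewrite /= sub0r normrN => /ltW; apply: le_trans.
apply: le_trans (ler_norm _); rewrite -/(Rintegral _ _ _) -/(ir _).
rewrite (_ : airy_partial_sum g N t = trig N (fun n => ph (n ^+ 3) t * fourier g n)).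
  by apply: ir_sq_complex_le; exact: in_L2_sqi.
by apply/funext => x; rewrite airy_partial_sumE.
Qed.

(** The difference of the two sides is periodic and has zero L^2 norm on a period. At level N it
    splits into the Fourier remainder of u (Parseval), that of q (definition of the Airy evolution),
    and that of the pointwise limit (dominated convergence). *)
Lemma nonlin_ae t : {ae mu, forall x, u t x - q t x = nonlin u t x}.
Proof.
have [C hC] := nonlin_bound hu hkdv U00 (normr_ge0 t).
have su := sqi_u hu t; have sq : sqi (q t) by apply: in_L2_sqi; exact: (hq t).1.
have wC x : `|nonlin u t x| <= C.
  have h := @nonlin_cvg _ u hu hkdv U00 t x; apply: (lim_norm_le h) => N.
  exact: (hC N t x (lexx _)).2.
have sw : sqi (nonlin u t) by apply: (sqi_bounded (nonlin_measurable t)) => x _; exact: wC.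
pose D x := u t x - q t x - nonlin u t x.
have sD : sqi D by apply: sqiB => //; exact: sqiB.
suff : {ae mu, forall x, D x = 0}.
  by apply: negligibleS => x /= h h'; apply: h; apply/eqP; rewrite -subr_eq0; apply/eqP.
apply: ae_periodic.
  move=> x; rewrite /D (nonlin_periodic u t x).
  have [[-> _ _] _] := hu.1 t 0 (lexx _) half_gt0.
  by have [[-> _ _] _] := hq t.
apply: ae_eq0_of_ir => // e e0.
(* Two uses of (a + b)^2 <= 2 a^2 + 2 b^2 on three errors: 2 + 4 + 4 = 10. *)
have e1 : 0 < e / 10 by rewrite divr_gt0.
have [N1 hN1] := parseval su e1.
have [N2 hN2] := airy_L2_cvg t e1.
pose r N x := Re (trig N (om (V u) ^~ t) x).
have sr N : sqi (r N) := (sqi_trig N _).1.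
(* Dominated convergence yields only some index; shifting it by N1 + N2 makes one N serve all three
   errors. *)
have [k hk] : exists k, `|ir (fun x => (r (k + (N1 + N2))%N x - nonlin u t x) ^+ 2)| <= e / 10.
  apply: (@ir_dominated _ _ (fun=> (C + C) ^+ 2)) e1.
  - by move=> k; apply: ig_measurable; exact: (sqiB (sr _) sw).2.
  - exact: ig_cst.
  - move=> k x _; rewrite normrX lerXn2r ?nnegrE//.
      by rewrite addr_ge0// (le_trans _ (wC 0)).
    by apply: le_trans (ler_normB _ _) _; apply: lerD; [exact: (hC _ _ _ (lexx _)).2|exact: wC].
  - move=> x _ _; have h := @nonlin_cvg _ u hu hkdv U00 t x.
    have h2 : r (k + (N1 + N2))%N x - nonlin u t x @[k --> \oo] --> 0.
      by rewrite -(subrr (nonlin u t x)); apply: cvgB; [rewrite (cvg_shiftn (N1 + N2) (r ^~ x))|exact: cvg_cst].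
    by rewrite -(mulr0 0); apply: cvgM.
set N := (k + (N1 + N2))%N in hk.
pose A x := u t x - Re (trig N (U u ^~ t) x).
pose B x := Re (airy_partial_sum g N t x) - q t x.
pose E x := r N x - nonlin u t x.
have sA : sqi A := sqiB su (sqi_trig N _).1.
have sB : sqi B.
  apply: sqiB => //; under [X in sqi X]funext do rewrite airy_partial_sumE.
  exact: (sqi_trig N _).1.
have sE : sqi E := sqiB (sr N) sw.
have hA : ir (fun x => A x ^+ 2) <= e / 10.
  apply: le_trans (ir_sq_complex_le N _ su) _.
  rewrite pythagoras_fourier//; apply: le_trans hN1; apply: pdefect_le.
  by rewrite /N; lia.
have hB : ir (fun x => B x ^+ 2) <= e / 10.
  rewrite (eq_ir (g := fun x => (q t x - Re (airy_partial_sum g N t x)) ^+ 2)).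
    by apply: hN2; rewrite /N; lia.
  by move=> x _; rewrite /B; ring.
have hE : ir (fun x => E x ^+ 2) <= e / 10 := le_trans (ler_norm _) hk.
have DE : D = fun x => A x + (B x + E x).
  apply/funext => x; rewrite /D /A /B /E /r.
  have -> : trig N (om (V u) ^~ t) x = trig N (U u ^~ t) x - airy_partial_sum g N t x.
    rewrite airy_partial_sumE /trig -sumrB; apply: eq_bigr => n _.
    by rewrite om_VE mulrBl.
  by rewrite Re_add Re_opp; ring.
rewrite DE; apply: le_trans (ir_sqD_le sA (sqiD sB sE)) _.
have := ir_sqD_le sB sE; lra.
Qed.

End conclusion.

Theorem mainTheorem14 (R : realType) (g : R -> R) (u q : R -> R -> R)
    (hg : in_Hminus (1 / 2) g)
    (hmean : Rintegral lebesgue_measure (@circle R) g = 0)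
    (hu : kdv_solution (1 / 2) g u)
    (hq : airy_evolution g q) :
  exists w : R -> R -> R,
    (forall t : R, {ae lebesgue_measure, forall x : R, u t x - q t x = w t x}) /\
    holder_minus_loc (1 / 3) w.
Proof.
have [hc hug hkdv] := hu.
have sg : sqi g by apply: in_L2_sqi; have [] := hg 0 (lexx _) half_gt0.
exists (nonlin u); split; first by move=> t; exact: (nonlin_ae sg hmean hc hkdv hug hq t).
by apply: nonlin_holder => //; exact: (U00 sg hmean hc hug).
Qed.
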